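(* Let $\mathfrak g$ be a $\mathbb Z$-graded quadratic color Lie algebra with form $B$, and let $\Omega'_{\mathfrak g}\in\widehat{\mathfrak U}_\varepsilon(\mathfrak g)$ be the normal-ordered Casimir element. For $\rho\in(\mathfrak g^* )_{(0,0_\Gamma)}$ the following are equivalent: (a) $\Omega_{\mathfrak g}:=\Omega'_{\mathfrak g}+2\rho^\sharp$ lies in the center of $\widehat{\mathfrak U}_\varepsilon(\mathfrak g)$; (b) $\psi_{\mathrm{KP}}=\mathrm d\rho$.
   Context: Fix an abelian group $\Gamma$ (additive, neutral element $0_\Gamma$) and a commutation factor $\varepsilon:\Gamma\times\Gamma\to\mathbb C^\times$, i.e. $\varepsilon$ is multiplicative in each variable and $\varepsilon(\alpha,\beta)\varepsilon(\beta,\alpha)=1$. For homogeneous $x,y$ of degrees $|x|,|y|\in\Gamma$ write $\varepsilon(x,y)=\varepsilon(|x|,|y|)$, $\varepsilon(x)=\varepsilon(x,x)$. A color Lie algebra is a $\Gamma$-graded complex vector space with a $\Gamma$-graded bilinear bracket with $[x,y]=-\varepsilon(x,y)[y,x]$ and $[x,[y,z]]=[[x,y],z]+\varepsilon(x,y)[y,[x,z]]$. $\mathbb Z$-graded quadratic color Lie algebra: a color Lie algebra $\mathfrak g=\bigoplus_{i\in\mathbb Z}\mathfrak g_i$ with each $\mathfrak g_i$ a finite-dimensional $\Gamma$-graded subspace, $[\mathfrak g_i,\mathfrak g_j]\subseteq\mathfrak g_{i+j}$, and a nondegenerate bilinear form $B$ which is $\varepsilon$-symmetric, invariant ($B([x,y],z)=B(x,[y,z])$)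 and satisfies $B(x,y)=0$ for bihomogeneous $x,y$ unless $\deg x+\deg y=0$ and $|x|+|y|=0_\Gamma$. Put $\mathfrak g_+=\bigoplus_{i>0}\mathfrak g_i$, $\mathfrak g_-=\bigoplus_{i\le0}\mathfrak g_i$, with projections $\pi_\pm$. $(e_a)$ is a homogeneous basis with $B$-dual basis $(e^a)$, $B(e_a,e^b)=\delta_{ab}$. $\mathfrak g^*$ is the restricted dual, graded by $(\mathfrak g^* )_{(i,\gamma)}=(\mathfrak g_{(-i,-\gamma)})^*$; $\rho^\sharp\in\mathfrak g$ is defined by $B(\rho^\sharp,y)=\rho(y)$; $\mathrm d\rho(x,y)=\rho([x,y])$. $\operatorname{tr}_\varepsilon(T)=\sum_a\varepsilon(e_a)B(T(e_a),e^a)$ for finite-rank $T$. Kac--Peterson cocycle: $\psi_{\mathrm{KP}}(x,y)=\tfrac12\operatorname{tr}_\varepsilon(\mathrm{ad}_x\pi_-\mathrm{ad}_y\pi_+)-\tfrac12\varepsilon(x,y)\operatorname{tr}_\varepsilon(\mathrm{ad}_y\pi_-\mathrm{ad}_x\pi_+)$ for homogeneous $x,y$. $S_\varepsilon(\mathfrak g)$ is generated by $\mathfrak g$ with $xy=\varepsilon(x,y)yx$; $\mathfrak U_\varepsilon(\mathfrak g)$ is generated by $\mathfrak g$ with $xy-\varepsilon(x,y)yx=[x,y]$. For $F=S_\varepsilon$ or $\mathfrak U_\varepsilon$ the completion $\widehat F(\mathfrak g)$ is the direct sum over $(i,\gamma)$ of $\prod_{r\ge0}\bigoplus_{\alpha+\beta=\gamma}F(\mathfrak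 g_-)_{(i-r,\alpha)}\otimes F(\mathfrak g_+)_{(r,\beta)}$, with products extended. $Q:S_\varepsilon(\mathfrak g_\pm)\to\mathfrak U_\varepsilon(\mathfrak g_\pm)$ is $Q(x_1\cdots x_k)=\frac1{k!}\sum_{\sigma\in S_k}p'(\sigma;x_1,\dots,x_k)x_{\sigma(1)}\cdots x_{\sigma(k)}$, $p'=\prod_{i<j,\ \sigma^{-1}(i)>\sigma^{-1}(j)}\varepsilon(x_i,x_j)$; $\widehat Q$ is induced componentwise by $Q\otimes Q$. $\Omega'_{\mathfrak g}=\widehat Q(p)$ with $p=\sum_ae^ae_a\in\widehat S^2_\varepsilon(\mathfrak g)$. The center of $\widehat{\mathfrak U}_\varepsilon(\mathfrak g)$ is understood in the color sense ($zu=\varepsilon(z,u)uz$); an element is central iff it is annihilated by all $L_x$, $L_xu=xu-\varepsilon(x,u)ux$, $x\in\mathfrak g$. *)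

(* Defs.v *)
From HB Require Import structures.
From mathcomp Require Import all_boot all_order all_algebra perm.
From mathcomp Require Import finmap monalg.
From mathcomp Require Import boolp classical_sets functions cardinality fsbigop.
From mathcomp Require Import reals complex.

Set Implicit Arguments.
Unset Strict Implicit.
Unset Printing Implicit Defensive.

Import GRing.Theory Num.Theory.

Local Open Scope classical_set_scope.
Local Open Scope ring_scope.

Section LinearSpan.
Context (K : fieldType) (V : lmodType K).

Inductive lspan_spec (S : set V) : V -> Prop :=
| lspan_zero : lspan_spec S 0
| lspan_step c x v : S x -> lspan_spec S v -> lspan_spec S (c *: x + v).

Definition lspan (S : set V) : {pred V} := [pred v | `[< lspan_spec S v >]].

Lemma lspanP S v : reflect (lspan_spec S v) (v \in lspan S).
Proof. exact: asboolP. Qed.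

Lemma lspan_closed S : GRing.subsemimod_closed (lspan S).
Proof.
split; first split.
- by apply/lspanP; constructor.
- move=> x y /lspanP xS /lspanP yS; apply/lspanP.
  by elim: xS => [|c z v Sz _ IH]; rewrite ?add0r // -addrA; constructor.
- move=> c x /lspanP xS; apply/lspanP.
  elim: xS => [|d z v Sz _ IH]; first by rewrite scaler0; constructor.
  by rewrite scalerDr scalerA; constructor.
Qed.

HB.instance Definition _ S :=
  GRing.isSubmodClosed.Build K V (lspan S) (lspan_closed S).

Lemma mem_lspan (S : set V) x : S x -> x \in lspan S.
Proof.
move=> Sx; apply/lspanP; rewrite -[x]addr0 -[x]scale1r.
by apply: lspan_step => //; apply: lspan_zero.
Qed.

End LinearSpan.

Section LinearQuotient.
Context (K : fieldType) (V : lmodType K) (S : set V).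

Definition lquot : Type := Quotient.quot (lspan S).
HB.instance Definition _ := GRing.Zmodule.on lquot.

Definition lpi (v : V) : lquot := \pi_(Quotient.quot (lspan S))%qT v.
Definition lrepr (q : lquot) : V := repr (q : Quotient.quot (lspan S)).

Lemma lreprK q : lpi (lrepr q) = q.
Proof. exact: reprK. Qed.

Lemma lpiP x y : reflect (lpi x = lpi y) (x - y \in lspan S).
Proof. by rewrite Quotient.idealrBE; apply: eqP. Qed.

Lemma lpi_zmod : zmod_morphism lpi.
Proof. by move=> x y; rewrite /lpi raddfB. Qed.
HB.instance Definition _ := GRing.isZmodMorphism.Build V lquot lpi lpi_zmod.

Definition lquot_scale (c : K) (q : lquot) := lpi (c *: lrepr q).

Lemma lpiZ c v : lquot_scale c (lpi v) = lpi (c *: v).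
Proof. by apply/lpiP; rewrite -scalerBr rpredZ //; apply/lpiP; rewrite lreprK. Qed.

Lemma lquot_scalerA a b q :
  lquot_scale a (lquot_scale b q) = lquot_scale (a * b) q.
Proof. by rewrite -[q]lreprK !lpiZ scalerA. Qed.
Lemma lquot_scale1r : left_id 1 lquot_scale.
Proof. by move=> q; rewrite -[q]lreprK lpiZ scale1r. Qed.
Lemma lquot_scalerDr : right_distributive lquot_scale +%R.
Proof.
by move=> c p q; rewrite -[p]lreprK -[q]lreprK -raddfD !lpiZ scalerDr raddfD.
Qed.
Lemma lquot_scalerDl q : {morph lquot_scale^~ q : a b / a + b}.
Proof. by move=> a b; rewrite -[q]lreprK !lpiZ scalerDl raddfD. Qed.

HB.instance Definition _ := GRing.Zmodule_isLmodule.Build K lquot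
  lquot_scalerA lquot_scale1r lquot_scalerDr lquot_scalerDl.

Lemma lpi_scalable : scalable lpi.
Proof. by move=> c v; rewrite -lpiZ. Qed.
HB.instance Definition _ := GRing.isScalable.Build K V lquot *:%R lpi lpi_scalable.

End LinearQuotient.

(* The linear extension to the free module on X of a map defined on X. *)
Definition malg_ext (K : fieldType) (X : choiceType) (W : lmodType K)
    (f : X -> W) (t : {malg K[X]}) : W :=
  \sum_(k <- msupp t) t@_k *: f k.

Section LinearExtension.
Context (K : fieldType) (X : choiceType) (W : lmodType K) (f : X -> W).

Lemma malg_extEw (E : {fset X}) (t : {malg K[X]}) : {subset msupp t <= E} ->
  malg_ext f t = \sum_(k <- E) t@_k *: f k.
Proof.
move=> /fsubsetP tE; rewrite /malg_ext (big_fset_incl _ tE) //= => k _.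
by move/mcoeff_outdom ->; rewrite scale0r.
Qed.

Lemma malg_ext_linear : linear (malg_ext f).
Proof.
move=> c s t; pose E := (msupp (c *: s + t) `|` msupp s `|` msupp t)%fset.
rewrite !(@malg_extEw E); do ?by move=> k kE; rewrite !inE kE ?orbT.
rewrite scaler_sumr -big_split; apply: eq_bigr => k _.
by rewrite mcoeffD mcoeffZ scalerDl scalerA.
Qed.
HB.instance Definition _ :=
  GRing.isLinear.Build K {malg K[X]} W *:%R (malg_ext f) malg_ext_linear.

Lemma malg_extU k : malg_ext f << 1 *g k >> = f k.
Proof. by rewrite /malg_ext msuppU oner_eq0 big_seq_fset1 mcoeffUU scale1r. Qed.
End LinearExtension.

Lemma lspan_ker (K : fieldType) (V W : lmodType K) (S : set V)
    (f : {linear V -> W}) t :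
  (forall s, S s -> f s = 0) -> t \in lspan S -> f t = 0.
Proof.
move=> f0 /lspanP; elim=> [|c x v /f0 fx _ IH]; first exact: linear0.
by rewrite linearP fx IH scaler0 addr0.
Qed.

Lemma lspan_ext (K : fieldType) (V W : lmodType K) (S : set V)
    (f : {linear V -> W}) t :
  (forall s, S s -> f s = 0) -> f (lrepr (lpi S t)) = f t.
Proof.
move=> f0; apply/eqP; rewrite -subr_eq0 -linearB; apply/eqP.
by apply: (lspan_ker f0); apply/lpiP; rewrite lreprK.
Qed.

Section Tensor.
Context (K : fieldType) (U W : lmodType K).

Local Notation gen p := (<< 1 *g p >> : {malg K[(U * W)%type]}).

Inductive tensor_rel : set {malg K[(U * W)%type]} :=
| tensor_relL c u u' w :
    tensor_rel (gen (c *: u + u', w) - (c *: gen (u, w) + gen (u', w)))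
| tensor_relR c u w w' :
    tensor_rel (gen (u, c *: w + w') - (c *: gen (u, w) + gen (u, w'))).

Definition tensor := lquot tensor_rel.
HB.instance Definition _ := GRing.Lmodule.on tensor.

Definition tens (u : U) (w : W) : tensor := lpi tensor_rel (gen (u, w)).

(* The linear map induced by f; meaningful when f is bilinear. *)
Definition tensor_lift (Z : lmodType K) (f : U -> W -> Z) (t : tensor) : Z :=
  malg_ext (fun p => f p.1 p.2) (lrepr t).

End Tensor.

Lemma tensor_liftP (K : fieldType) (U W Z : lmodType K) (f : U -> W -> Z) :
  (forall w, linear (f^~ w)) -> (forall u, linear (f u)) ->
  linear (tensor_lift f) /\ forall u w, tensor_lift f (tens u w) = f u w.
Proof.
move=> fl fr; set F := malg_ext (fun p : (U * W)%type => f p.1 p.2).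
have F0 s : tensor_rel s -> F s = 0.
  by case=> *; rewrite /F linearB linearP /= !malg_extU /= ?fl ?fr subrr.
have Fpi t : F (lrepr (lpi (@tensor_rel K U W) t)) = F t by exact: lspan_ext.
split=> [c p q|u w]; rewrite /tensor_lift -/F; last by rewrite Fpi /F malg_extU.
rewrite -[p]lreprK -[q]lreprK.
have -> : c *: (lpi (@tensor_rel K U W) (lrepr p) : tensor U W) + lpi (@tensor_rel K U W) (lrepr q) = lpi (@tensor_rel K U W) (c *: lrepr p + lrepr q).
  by rewrite linearP.
by rewrite !Fpi /F linearP.
Qed.

Section FreeAlgebra.
Context (X : choiceType).

Definition word : Type := seq X.
HB.instance Definition _ := Choice.on word.

Lemma word_unit (s t : word) : s ++ t = [::] -> s = [::] /\ t = [::].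
Proof. by case: s t => [|? ?] []. Qed.

HB.instance Definition _ := Choice_isMonomialDef.Build word
  (@catA X) (@cat0s X) (@cats0 X) word_unit.

Lemma free_scalerAr (K : fieldType) (c : K) (x y : {malg K[word]}) :
  c *: (x * y) = x * (c *: y).
Proof.
rewrite -[c *: (x * y)]mul_malgC -[c *: y]mul_malgC !mulrA; congr (_ * y).
rewrite malgM_def fgmulUg [RHS]malgM_def fgmulgU; apply: eq_bigr => k _.
by rewrite mul1m mulm1 mulrC.
Qed.

End FreeAlgebra.

Section Enveloping.
Context (K : fieldType) (Gam : zmodType) (eps : Gam -> Gam -> K).
Context (V : lmodType K) (gr : Gam -> {pred V}) (br : V -> V -> V).
Context (h : {pred V}).

Definition letter : Type := {x : V | x \in h}.
HB.instance Definition _ := Choice.on letter.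

Local Notation freealg := {malg K[word letter]}.
Local Notation gen x := (<< 1 *g ([:: x] : word letter) >> : freealg).

Inductive env_rel : set freealg :=
| env_rel_lin c (x y z : letter) : val z = c *: val x + val y ->
    env_rel (gen z - (c *: gen x + gen y))
| env_rel_br a b (x y z : letter) : val x \in gr a -> val y \in gr b ->
    val z = br (val x) (val y) ->
    env_rel (gen x * gen y - eps a b *: (gen y * gen x) - gen z).

Definition env_ideal : set freealg :=
  [set t | exists u r v, env_rel r /\ t = u * r * v].

(* The algebra generated by the subspace h with the relations
   x y - eps(x, y) y x = br x y; h is meant to be stable under br. *)
Definition env := lquot env_ideal.
HB.instance Definition _ := GRing.Lmodule.on env.

Local Notation pi := (lpi env_ideal).

Lemma env_idealM u v t : t \in lspan env_ideal -> u * t * v \in lspan env_ideal.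
Proof.
move=> /lspanP; elim=> [|c x w [u' [r [v' [rr ->]]]] _ IH].
  by rewrite mulr0 mul0r rpred0.
rewrite mulrDr mulrDl; apply: rpredD; last exact: IH.
rewrite -free_scalerAr -scalerAl; apply: rpredZ; apply: mem_lspan.
by exists (u * u'), r, (v' * v); split=> //; rewrite !mulrA.
Qed.

Definition env_one : env := pi 1.
Definition env_mul (p q : env) : env := pi (lrepr p * lrepr q).

Lemma env_piM x y : env_mul (pi x) (pi y) = pi (x * y).
Proof.
apply/lpiP; set x' := lrepr _; set y' := lrepr _.
have /lpiP xx : pi x' = pi x by apply: lreprK.
have /lpiP yy : pi y' = pi y by apply: lreprK.
have -> : x' * y' - x * y = 1 * (x' - x) * y' + x * (y' - y) * 1.
  by rewrite mul1r mulr1 mulrBl mulrBr addrA subrK.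
by rewrite rpredD // env_idealM.
Qed.

Lemma env_mulA : associative env_mul.
Proof.
by move=> p q r; rewrite -[p]lreprK -[q]lreprK -[r]lreprK !env_piM mulrA.
Qed.
Lemma env_mul1 : left_id env_one env_mul.
Proof. by move=> p; rewrite -[p]lreprK env_piM mul1r. Qed.
Lemma env_1mul : right_id env_one env_mul.
Proof. by move=> p; rewrite -[p]lreprK env_piM mulr1. Qed.
Lemma env_mulDl : left_distributive env_mul +%R.
Proof.
move=> p q r; rewrite -[p]lreprK -[q]lreprK -[r]lreprK.
by rewrite -raddfD !env_piM mulrDl raddfD.
Qed.
Lemma env_mulDr : right_distributive env_mul +%R.
Proof.
move=> p q r; rewrite -[p]lreprK -[q]lreprK -[r]lreprK.
by rewrite -raddfD !env_piM mulrDr raddfD.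
Qed.

Lemma mcoeff1_gen (x : letter) : (gen x)@_(@mone (word letter)) = 0.
Proof. by rewrite mcoeffU. Qed.

Lemma env_rel_mcoeff1 r : env_rel r -> r@_(@mone (word letter)) = 0.
Proof.
case=> [c x y z _|a b x y z _ _ _].
  have := (mcoeff1_gen x, mcoeff1_gen y, mcoeff1_gen z).
  move: (gen x) (gen y) (gen z) => X Y Z [[X0 Y0] Z0].
  by rewrite mcoeffB mcoeffD mcoeffZ X0 Y0 Z0 mulr0 addr0 subr0.
have := (mcoeff1_gen x, mcoeff1_gen y, mcoeff1_gen z).
move: (gen x) (gen y) (gen z) => X Y Z [[X0 Y0] Z0].
by rewrite !mcoeffB mcoeffZ !rmorphM /= X0 Y0 Z0 !mulr0 !subr0.
Qed.

Lemma env_one_neq0 : env_one != 0.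
Proof.
apply/eqP; rewrite -(raddf0 pi) => /lpiP; rewrite subr0 => /lspanP.
have aux t : lspan_spec env_ideal t -> t@_(@mone (word letter)) = 0.
  elim=> [|c x v [u [r [w [/env_rel_mcoeff1 r0 ->]]]] _ IH]; first exact: mcoeff0.
  by rewrite mcoeffD mcoeffZ !rmorphM /= r0 mulr0 mul0r mulr0 IH addr0.
by move=> /aux/eqP; rewrite mcoeff1 eqxx oner_eq0.
Qed.

HB.instance Definition _ := GRing.Zmodule_isNzRing.Build env
  env_mulA env_mul1 env_1mul env_mulDl env_mulDr env_one_neq0.

Lemma env_piX x y : (pi x : env) * (pi y : env) = pi (x * y).
Proof. exact: env_piM. Qed.

Lemma env_piZ c x : c *: (pi x : env) = pi (c *: x).
Proof. by rewrite lpi_scalable. Qed.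

Lemma env_scalerAl (c : K) (p q : env) : c *: (p * q) = (c *: p) * q.
Proof.
rewrite -[p]lreprK -[q]lreprK env_piX.
by rewrite !env_piZ env_piX scalerAl.
Qed.
HB.instance Definition _ := GRing.Lmodule_isLalgebra.Build K env env_scalerAl.

Lemma env_scalerAr (c : K) (p q : env) : c *: (p * q) = p * (c *: q).
Proof.
rewrite -[p]lreprK -[q]lreprK env_piX.
by rewrite !env_piZ env_piX free_scalerAr.
Qed.
HB.instance Definition _ := GRing.Lalgebra_isAlgebra.Build K env env_scalerAr.

Definition env_in (x : letter) : env := pi (gen x).

(* The algebra morphism induced by f; meaningful when f respects env_rel. *)
Definition env_lift (A : algType K) (f : letter -> A) (u : env) : A :=
  malg_ext (fun s : word letter => \prod_(x <- (s : seq letter)) f x) (lrepr u).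

End Enveloping.

Section EnvelopingLift.
Context (K : fieldType) (Gam : zmodType) (eps : Gam -> Gam -> K).
Context (V : lmodType K) (gr : Gam -> {pred V}) (br : V -> V -> V).
Context (h : {pred V}) (A : algType K) (f : letter h -> A).

Let F := malg_ext (fun s : word (letter h) => \prod_(x <- (s : seq (letter h))) f x).

Lemma env_ext_lin c x y : F (c *: x + y) = c *: F x + F y.
Proof. exact: malg_ext_linear. Qed.
Lemma env_ext_D x y : F (x + y) = F x + F y.
Proof. by rewrite -[x]scale1r env_ext_lin !scale1r. Qed.
Lemma env_ext_Z c x : F (c *: x) = c *: F x.
Proof. by rewrite -[c *: x]addr0 env_ext_lin /F linear0 addr0. Qed.
Lemma env_ext_B x y : F (x - y) = F x - F y.
Proof. by rewrite -(scaleN1r y) env_ext_D env_ext_Z scaleN1r. Qed.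
Lemma env_ext_M x y : F (x * y) = F x * F y.
Proof.
rewrite /F malgM_def /fgmul !linear_sum /= [in RHS]/malg_ext mulr_suml.
apply: eq_bigr => s _; rewrite linear_sum mulr_sumr; apply: eq_bigr => t _.
have -> : << x@_s * y@_t *g mmul s t >> = (x@_s * y@_t) *: << 1 *g mmul s t >> :> {malg K[word (letter h)]}.
  by rewrite malgZ_def /fgscale msuppU oner_eq0 big_seq_fset1 mcoeffUU mulr1.
by rewrite linearZ /= malg_extU big_cat /= -scalerAl -scalerAr scalerA.
Qed.

Lemma env_liftP :
  (forall c x y z, val z = c *: val x + val y -> f z = c *: f x + f y) ->
  (forall a b x y z, val x \in gr a -> val y \in gr b ->
      val z = br (val x) (val y) -> f x * f y - eps a b *: (f y * f x) = f z) ->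
  let G : env eps gr br h -> A := env_lift f in
  [/\ linear G, G 1 = 1, forall u v, G (u * v) = G u * G v &
  forall x, G (env_in eps gr br x) = f x].
Proof.
move=> flin fbr G.
have Fg x : F << 1 *g ([:: x] : word (letter h)) >> = f x.
  by rewrite /F malg_extU big_seq1.
have F0 s : env_ideal eps gr br s -> F s = 0.
  move=> [u [r [v [rr ->]]]]; rewrite !env_ext_M.
  suff -> : F r = 0 by rewrite mulr0 mul0r.
  case: rr => [c x y z E|a b x y z xa yb E].
    have := (Fg x, Fg y, Fg z); rewrite (flin _ _ _ _ E).
    move: << 1 *g ([:: x] : word (letter h)) >> << 1 *g ([:: y] : word (letter h)) >>
      << 1 *g ([:: z] : word (letter h)) >> => X Y Z [[FX FY] FZ].
    by rewrite env_ext_B env_ext_lin FX FY FZ subrr.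
  have := (Fg x, Fg y, Fg z); rewrite -(fbr _ _ _ _ _ xa yb E).
  move: << 1 *g ([:: x] : word (letter h)) >> << 1 *g ([:: y] : word (letter h)) >>
    << 1 *g ([:: z] : word (letter h)) >> => X Y Z [[FX FY] FZ].
  by rewrite !env_ext_B env_ext_Z !env_ext_M FX FY FZ subrr.
have Fpi t : F (lrepr (lpi (@env_ideal _ _ eps _ gr br h) t)) = F t by exact: lspan_ext.
rewrite /G /env_lift -/F; split => [c p q||u v|x].
- rewrite -[p]lreprK -[q]lreprK env_piZ.
  have -> : (lpi (@env_ideal _ _ eps _ gr br h) (c *: lrepr p) : env eps gr br h) + lpi (@env_ideal _ _ eps _ gr br h) (lrepr q) = lpi (@env_ideal _ _ eps _ gr br h) (c *: lrepr p + lrepr q).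
    by rewrite raddfD.
  by rewrite !Fpi /F linearP.
- rewrite [lrepr _]/(lrepr (lpi _ _)) Fpi.
  rewrite /F (_ : 1 = << 1 *g (mone : word _) >>) //; by rewrite malg_extU big_nil.
- by rewrite -[u]lreprK -[v]lreprK env_piX !Fpi env_ext_M.
- by rewrite Fpi Fg.
Qed.
End EnvelopingLift.

Section DirectSum.
Context (K : fieldType) (V : lmodType K) (I : choiceType) (P : I -> {pred V}).

Definition is_decomposition (x : V) (f : I -> V) : Prop :=
  [/\ forall i, f i \in P i, finite_set [set i | f i != 0]
    & x = \sum_(i \in [set: I]) f i].

Definition is_direct_sum : Prop :=
  (forall i, GRing.submod_closed (P i)) /\
  (forall x, exists! f, is_decomposition x f).

(* The i-th component of x; meaningful when V is the direct sum of P. *)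
Definition component (i : I) (x : V) : V :=
  xget (fun=> 0) (is_decomposition x) i.

End DirectSum.

Definition commutation_factor (K : fieldType) (Gam : zmodType)
    (eps : Gam -> Gam -> K) : Prop :=
  [/\ forall a b c, eps (a + b) c = eps a c * eps b c,
      forall a b c, eps a (b + c) = eps a b * eps a c
    & forall a b, eps a b * eps b a = 1].

Record colorLie (K : fieldType) (Gam : zmodType) (eps : Gam -> Gam -> K) :=
  ColorLie {
  cl_space :> lmodType K;
  cl_gr : Gam -> {pred cl_space};
  bracket : cl_space -> cl_space -> cl_space;
  cl_direct : is_direct_sum cl_gr;
  bracket_linearl : forall y, linear (bracket^~ y);
  bracket_linearr : forall x, linear (bracket x);
  bracket_gr : forall a b x y, x \in cl_gr a -> y \in cl_gr b ->
    bracket x y \in cl_gr (a + b);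
  bracket_skew : forall a b x y, x \in cl_gr a -> y \in cl_gr b ->
    bracket x y = - (eps a b *: bracket y x);
  bracket_jacobi : forall a b c x y z,
    x \in cl_gr a -> y \in cl_gr b -> z \in cl_gr c ->
    bracket x (bracket y z) =
      bracket (bracket x y) z + eps a b *: bracket y (bracket x z) }.

Record zqColorLie (K : fieldType) (Gam : zmodType) (eps : Gam -> Gam -> K) :=
  ZqColorLie {
  zq_lie :> colorLie eps;
  zq_gr : int -> {pred zq_lie};
  form : zq_lie -> zq_lie -> K;
  zq_direct : is_direct_sum zq_gr;
  zq_graded : forall i x a, x \in zq_gr i ->
    component (@cl_gr _ _ _ zq_lie) a x \in zq_gr i;
  zq_findim : forall i, exists s : seq zq_lie,
    {subset zq_gr i <= lspan [set x | x \in s]};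
  zq_bracket : forall i j x y, x \in zq_gr i -> y \in zq_gr j ->
    bracket x y \in zq_gr (i + j);
  form_linearl : forall y, scalar (form^~ y);
  form_linearr : forall x, scalar (form x);
  form_nondegl : forall x, (forall y, form x y = 0) -> x = 0;
  form_nondegr : forall y, (forall x, form x y = 0) -> y = 0;
  form_sym : forall a b x y, x \in cl_gr a -> y \in cl_gr b ->
    form x y = eps a b * form y x;
  form_inv : forall x y z, form (bracket x y) z = form x (bracket y z);
  form_deg : forall i j a b x y,
    x \in zq_gr i -> x \in cl_gr a -> y \in zq_gr j -> y \in cl_gr b ->
    form x y != 0 -> i + j = 0 /\ a + b = 0 }.

Section Algebra.
Context (K : fieldType) (Gam : zmodType) (eps : Gam -> Gam -> K).
Context (g : zqColorLie eps).

Definition bihom (d : int * Gam) : {pred g} :=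
  [pred x | (x \in zq_gr d.1) && (x \in cl_gr d.2)].

Definition gpos : {pred g} := lspan [set x | exists2 i : int, 0 < i & x \in zq_gr i].
Definition gneg : {pred g} := lspan [set x | exists2 i : int, i <= 0 & x \in zq_gr i].

Definition proj_pos (x : g) : g :=
  \sum_(i \in [set i : int | 0 < i]) component (@zq_gr _ _ _ g) i x.
Definition proj_neg (x : g) : g :=
  \sum_(i \in [set i : int | i <= 0]) component (@zq_gr _ _ _ g) i x.

Definition gall : {pred g} := predT.
Definition full_letter (x : g) : letter gall := exist _ x isT.

Section Completion.
(* The two cases of interest are br = 0, giving the color symmetric algebra,
   and br = bracket, giving the enveloping algebra. *)
Context (br : g -> g -> g).

Local Notation F := (env eps (@cl_gr _ _ _ g) br).

Definition env_gr (h : {pred g}) (d : int * Gam) : {pred F h} :=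
  lspan [set u : F h | exists k (x : 'I_k -> letter h) (dg : 'I_k -> int * Gam),
    [/\ forall i, val (x i) \in bihom (dg i), \sum_i dg i = d
      & u = \prod_(i < k) env_in eps (@cl_gr _ _ _ g) br (x i)]].

Definition normal : Type := tensor (F gneg) (F gpos).
HB.instance Definition _ := GRing.Lmodule.on normal.

Definition normal_gr (p : int * Gam * nat) : {pred normal} :=
  lspan [set t : normal | exists a b u v,
    [/\ a + b = p.1.2, u \in @env_gr gneg (p.1.1 - p.2%:Z, a),
        v \in @env_gr gpos (p.2%:Z, b) & t = tens u v]].

Definition env_incl (h : {pred g}) : F h -> F gall :=
  env_lift (fun x => env_in eps (@cl_gr _ _ _ g) br (full_letter (val x))).

(* The multiplication map F(g_-) (x) F(g_+) -> F(g), which is bijective by the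
   Poincare-Birkhoff-Witt theorem, and its inverse. *)
Definition normal_mul : normal -> F gall :=
  tensor_lift (fun u v => env_incl u * env_incl v).
Definition normal_form (u : F gall) : normal :=
  xget 0 [set t | normal_mul t = u].

(* w d r is the component of bidegree d of w in
   (+)_(a + b = d.2) F(g_-)_(d.1 - r, a) (x) F(g_+)_(r, b). *)
Definition series : Type := int * Gam -> nat -> normal.
HB.instance Definition _ := GRing.Lmodule.on series.

Definition in_completion (w : series) : Prop :=
  (forall d r, w d r \in normal_gr (d, r)) /\ finite_set [set d | w d != 0].

Definition series_of (u : F gall) : series :=
  fun d r => component normal_gr (d, r) (normal_form u).

Definition series_in (x : g) : series :=
  series_of (env_in eps (@cl_gr _ _ _ g) br (full_letter x)).

(* For u and v in the completion, each component of the product receives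
   finitely many nonzero contributions, since
   F(g_+)_r F(g_-)_(j - s) F(g_+)_s only meets the components of positive
   degree at least max(s, r + j). *)
Definition series_mul (u v : series) : series := fun d t =>
  \sum_(p \in [set: int * Gam * nat]) \sum_(q \in [set: int * Gam * nat])
    component normal_gr (d, t)
      (normal_form (normal_mul (u p.1 p.2) * normal_mul (v q.1 q.2))).

Definition series_component (a : Gam) (w : series) : series :=
  fun d r => if d.2 == a then w d r else 0.

Definition in_center (z : series) : Prop :=
  in_completion z /\
  forall a b u, in_completion u -> series_component b u = u ->
    series_mul (series_component a z) u =
      eps a b *: series_mul u (series_component a z).

End Completion.

Local Notation S := (env eps (@cl_gr _ _ _ g) (fun _ _ => 0)).
Local Notation U := (env eps (@cl_gr _ _ _ g) (@bracket _ _ _ g)).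

Definition perm_factor k (s : 'S_k) (dg : 'I_k -> Gam) : K :=
  \prod_(i < k) \prod_(j < k | (i < j)%N && (s^-1%g j < s^-1%g i)%N)
    eps (dg i) (dg j).

Definition is_symmetrization (h : {pred g}) (Q : S h -> U h) : Prop :=
  linear Q /\
  forall k (x : 'I_k -> letter h) (dg : 'I_k -> Gam),
    (forall i, val (x i) \in cl_gr (dg i)) ->
    Q (\prod_(i < k) env_in _ _ _ (x i)) =
      (k`!%:R)^-1 *: \sum_(s : 'S_k)
        perm_factor s dg *: \prod_(i < k) env_in _ _ _ (x (s i)).

Definition symmetrization (h : {pred g}) : S h -> U h :=
  xget (fun=> 0) (@is_symmetrization h).

Definition series_symmetrization (w : series (fun _ _ => 0)) :
    series (@bracket _ _ _ g) :=
  fun d r => tensor_lift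
    (fun u v => tens (symmetrization u) (symmetrization v)) (w d r).

Section Basis.
Context (A : choiceType) (e e' : A -> g) (dg : A -> int * Gam).

Definition is_homogeneous_basis : Prop :=
  [/\ forall a, e a \in bihom (dg a),
      forall x, x \in lspan (range e)
    & forall c : A -> K, finite_set [set a | c a != 0] ->
        \sum_(a \in [set: A]) c a *: e a = 0 -> forall a, c a = 0].

Definition is_dual_basis : Prop := forall a b, form (e a) (e' b) = (a == b)%:R.

Definition color_trace (T : g -> g) : K :=
  \sum_(a \in [set: A]) eps (dg a).2 (dg a).2 * form (T (e a)) (e' a).

Definition psiKP_hom (a b : Gam) (x y : g) : K :=
  2^-1 * color_trace (bracket x \o proj_neg \o bracket y \o proj_pos)
  - 2^-1 * eps a b *
      color_trace (bracket y \o proj_neg \o bracket x \o proj_pos).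

Definition psiKP (x y : g) : K :=
  \sum_(a \in [set: Gam]) \sum_(b \in [set: Gam])
    psiKP_hom a b (component (@cl_gr _ _ _ g) a x)
                  (component (@cl_gr _ _ _ g) b y).

Definition casimir_symbol : series (fun _ _ => 0) := fun d r =>
  \sum_(a \in [set: A])
    series_of (env_in eps (@cl_gr _ _ _ g) (fun _ _ => 0) (full_letter (e' a))
               * env_in _ _ _ (full_letter (e a))) d r.

Definition casimir : series (@bracket _ _ _ g) :=
  series_symmetrization casimir_symbol.

End Basis.

Definition in_restricted_dual (d : int * Gam) (rho : {scalar g}) : Prop :=
  forall d' x, d' != - d -> x \in bihom d' -> rho x = 0.

Definition sharp (rho : {scalar g}) : g :=
  xget 0 [set v | forall y, form v y = rho y].

Definition coboundary (rho : {scalar g}) (x y : g) : K := rho (bracket x y).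

End Algebra.

(* Main.v *)
(* Fix a homogeneous basis e_a with dual basis e^a, and let c_m be the sum of
   the e^a e_a with deg e_a = m. By the Poincare-Birkhoff-Witt theorem, proved
   with Bergman's diamond lemma for an order putting g_- before g_+, the
   normal-ordered Casimir element is c_0 + 2 (c_1 + c_2 + ...). Put
   t_m = sum_a [x, e^a] e_a over deg e_a = m. Invariance of the form gives
   [x, c_m] = t_m - t_(m + deg x), while t_m + t_(deg x - m) is the element
   b_m = sum_a [[x, e^a], e_a] of g. Hence [x, c_0 + 2 (c_1 + ... + c_N)]
   telescopes, modulo terms deep in the filtration by the degree of the factor
   in U(g_+), to an element v of g, namely a sum of b_m over 0 < m <= deg x (or
   minus the sum of b_m over deg x <= m < 0), and expanding the color traces
   gives B(v, y) = 2 psi_KP(x, y). Since B([x, rho^#], y) = - drho(x, y), the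
   form pairs [x, Omega] with y to 2 (psi_KP - drho)(x, y), and centrality
   reduces to the vanishing of this pairing. *)
From HB Require Import structures.
From mathcomp Require Import all_boot all_order all_algebra perm.
From mathcomp Require Import finmap monalg.
From mathcomp Require Import boolp classical_sets functions cardinality fsbigop.
From mathcomp Require Import reals complex wochoice ring zify.
Require Import Defs.

Set Implicit Arguments.
Unset Strict Implicit.
Unset Printing Implicit Defensive.

Import Order.TTheory GRing.Theory Num.Theory.

Local Open Scope classical_set_scope.
Local Open Scope ring_scope.

(** * Free algebras *)

(** Omega is an infinite sum, so [x, Omega] has no meaning inside the enveloping algebra itself. The
    computations use partial sums of Omega, and centrality in the completion is translated into the
    statement that commutators with these partial sums sink arbitrarily deep in a separated
    filtration. The filtration is stable under left multiplication, while right multiplication by v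
    shifts it by deg v; an estimate for one letter therefore passes to a word with a loss that
    depends on the word only, and a longer partial sum absorbs it. This is compatible with the
    completion because each component of a product there sees finitely many terms of each factor.
    The reduction system has a second kind of rule besides the exchange of letters: a letter with
    eps(a, a) = -1 satisfies 2 a a = [a, a]. Some ambiguities with a repeated odd letter resolve
    only after division by 2, and the ambiguity a a a after division by 3. Run with the zero
    bracket, the same system describes the color symmetric algebra, so a single argument yields
    normal words for both algebras and also the existence of the symmetrization map. *)

Section LinearFunction.
Context (K : fieldType) (U W : lmodType K) (f : U -> W).
Hypothesis lf : linear f.
Let F : {linear U -> W} :=
  HB.pack f (GRing.isLinear.Build K U W *:%R f lf).
Lemma lin0 : f 0 = 0. Proof. exact: (linear0 F). Qed.
Lemma linD x y : f (x + y) = f x + f y. Proof. exact: (linearD F). Qed.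
Lemma linN x : f (- x) = - f x. Proof. exact: (linearN F). Qed.
Lemma linB x y : f (x - y) = f x - f y. Proof. exact: (linearB F). Qed.
Lemma linZ c x : f (c *: x) = c *: f x. Proof. exact: (linearZ_LR F). Qed.
Lemma lin_sum (I : Type) (r : seq I) (P : pred I) (G : I -> U) :
  f (\sum_(i <- r | P i) G i) = \sum_(i <- r | P i) f (G i).
Proof. exact: (linear_sum F). Qed.
End LinearFunction.

Section FreeModule.
Context (K : fieldType) (X : choiceType).
Implicit Types (t : {malg K[X]}) (P Q : X -> Prop).

Lemma malg_ext_id t : malg_ext (fun k => << 1 *g k >>) t = t.
Proof.
apply/malgP => k; rewrite /malg_ext raddf_sum /=.
under eq_bigr do rewrite mcoeffZ mcoeffU.
have [kt|kt] := boolP (k \in msupp t); last first.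
  rewrite mcoeff_outdom // big1_seq // => i /andP[_ it].
  by case: eqP => [ik|_]; [rewrite -ik it in kt | rewrite mulr0].
rewrite (big_fsetD1 k kt) /= eqxx mulr1 big1_seq ?addr0 // => i /andP[_].
by rewrite !inE => /andP[/negPf -> _]; rewrite mulr0n mulr0.
Qed.

Lemma malg_ext_linE (W : lmodType K) (f : {linear {malg K[X]} -> W}) t :
  f t = malg_ext (fun k => f << 1 *g k >>) t.
Proof.
rewrite -[in LHS](malg_ext_id t) /malg_ext linear_sum.
by apply: eq_bigr => k _; rewrite linearZ.
Qed.

(** Degree, normality and membership of the letters in a subalgebra are all expressed as support
    conditions, so that linear combinations and products are treated once for all of them. *)
Definition sup P t := forall k, k \in msupp t -> P k.

Lemma eq_malg_ext_sup (W : lmodType K) P (f g : X -> W) t : sup P t ->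
  (forall k, P k -> f k = g k) -> malg_ext f t = malg_ext g t.
Proof.
move=> Pt fg; rewrite /malg_ext; apply: eq_big_seq => k kt.
by rewrite fg //; apply: Pt.
Qed.

Lemma linear_sup0 (W : lmodType K) P (f : {malg K[X]} -> W) t : linear f ->
  sup P t -> (forall k, P k -> f << 1 *g k >> = 0) -> f t = 0.
Proof.
move=> lf Pt h; pose F : {linear {malg K[X]} -> W} :=
  HB.pack f (GRing.isLinear.Build K {malg K[X]} W *:%R f lf).
have -> : f t = F t by [].
rewrite malg_ext_linE /malg_ext big_seq big1 // => k kt.
by rewrite [F _]h ?scaler0 //; apply: Pt.
Qed.

Lemma linear_word0 (W : lmodType K) (f : {malg K[X]} -> W) t : linear f ->
  (forall k, f << 1 *g k >> = 0) -> f t = 0.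
Proof. by move=> lf h; apply: (@linear_sup0 _ (fun=> True)). Qed.

Lemma linear_eq_sup (W : lmodType K) P (f h : {malg K[X]} -> W) t :
  linear f -> linear h -> sup P t ->
  (forall k, P k -> f << 1 *g k >> = h << 1 *g k >>) -> f t = h t.
Proof.
move=> lf lh Pt fh; apply/eqP; rewrite -subr_eq0; apply/eqP.
apply: (linear_sup0 (f := fun t => f t - h t) _ Pt) => [|k Pk].
  by move=> c u v; rewrite lf lh scalerBr opprD addrACA.
by rewrite fh // subrr.
Qed.

Lemma sup0 P : sup P 0. Proof. by move=> k; rewrite msupp0. Qed.
Lemma supU P k : P k -> sup P << 1 *g k >>.
Proof. by move=> Pk l; rewrite msuppU oner_eq0 inE => /eqP ->. Qed.
Lemma supD P s t : sup P s -> sup P t -> sup P (s + t).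
Proof.
move=> Ps Pt k /(fsubsetP (msuppD_le _ _)); rewrite inE.
by case/orP => [/Ps|/Pt].
Qed.
Lemma supZ P c t : sup P t -> sup P (c *: t).
Proof. by move=> Pt k /(fsubsetP (msuppZ_le _ _))/Pt. Qed.
Lemma sup_sum P (I : Type) (r : seq I) (S : pred I) (F : I -> {malg K[X]}) :
  (forall i, S i -> sup P (F i)) -> sup P (\sum_(i <- r | S i) F i).
Proof. by move=> h; elim/big_ind: _ => //; [apply: sup0|apply: supD]. Qed.
Lemma sup_sum_seq P (I : eqType) (r : seq I) (F : I -> {malg K[X]}) :
  (forall i, i \in r -> sup P (F i)) -> sup P (\sum_(i <- r) F i).
Proof. by move=> h; rewrite big_seq; apply: sup_sum. Qed.

Lemma supW P Q t : (forall k, P k -> Q k) -> sup P t -> sup Q t.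
Proof. by move=> PQ Pt k /Pt/PQ. Qed.

End FreeModule.

Lemma sup_ext (K : fieldType) (X Y : choiceType) (P : X -> Prop) (Q : Y -> Prop)
    (f : X -> {malg K[Y]}) t :
  sup P t -> (forall k, P k -> sup Q (f k)) -> sup Q (malg_ext f t).
Proof. by move=> Pt h; apply: sup_sum_seq => k /Pt/h; apply: supZ. Qed.

Lemma supI_eq0 (K : fieldType) (X : choiceType) (t : {malg K[X]}) :
  sup (fun=> False) t -> t = 0.
Proof.
move=> h; apply/malgP => k; rewrite mcoeff0; apply/eqP; rewrite mcoeff_eq0.
by apply/negP => /h.
Qed.

Section FreeAlgebra.
Context (K : fieldType) (X : choiceType).
Local Notation FA := {malg K[word X]}.
Local Notation "[:w s ]" := (<< 1 *g (s : word X) >> : FA) (format "[:w  s ]").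

Lemma wordM s t : [:w s] * [:w t] = [:w s ++ t].
Proof. by rewrite malgM_def fgmulUU mulr1. Qed.
Lemma word_nil : [:w [::]] = 1.
Proof. by []. Qed.

Lemma supM (P Q R : word X -> Prop) (s t : FA) : sup P s -> sup Q t ->
  (forall u v : word X, P u -> Q v -> R (u ++ v)) -> sup R (s * t).
Proof.
move=> Ps Qt PQR; rewrite malgM_def /fgmul.
apply: sup_sum_seq => u /Ps Pu; apply: sup_sum_seq => v /Qt Qv.
move=> k /(fsubsetP msuppU_le); rewrite inE => /eqP ->; exact: PQR.
Qed.

(** Compatibility of scaling with the right factor is a hypothesis, so that the target can be the
    free algebra on the basis as well as an enveloping algebra. *)
Lemma word_ext_M (B : lalgType K) (f : X -> B) :
  (forall (c : K) (x y : B), c *: (x * y) = x * (c *: y)) ->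
  let F := malg_ext (fun s : word X => \prod_(x <- (s : seq X)) f x) in
  forall p q, F (p * q) = F p * F q.
Proof.
move=> scalAr F p q; rewrite /F malgM_def /fgmul !linear_sum /= [in RHS]/malg_ext mulr_suml.
apply: eq_bigr => s _; rewrite linear_sum mulr_sumr; apply: eq_bigr => t _.
have -> : << p@_s * q@_t *g mmul s t >> = (p@_s * q@_t) *: << 1 *g mmul s t >> :> FA.
  by rewrite malgZ_def /fgscale msuppU oner_eq0 big_seq_fset1 mcoeffUU mulr1.
by rewrite linearZ /= malg_extU big_cat /= -scalerAl -scalAr scalerA.
Qed.

End FreeAlgebra.

Notation "[:w s ]" := (<< 1 *g (s : word _) >>) (format "[:w  s ]").

(** * Normal forms in enveloping algebras *)

Section CommutationFactor.
Context (K : fieldType) (Gam : zmodType) (eps : Gam -> Gam -> K).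
Hypothesis heps : commutation_factor eps.

Lemma epsDl a b c : eps (a + b) c = eps a c * eps b c.
Proof. by case: heps. Qed.
Lemma epsDr a b c : eps a (b + c) = eps a b * eps a c.
Proof. by case: heps. Qed.
Lemma epsC a b : eps a b * eps b a = 1.
Proof. by case: heps. Qed.
Lemma eps_neq0 a b : eps a b != 0.
Proof.
by apply/eqP => E; move/eqP: (epsC a b); rewrite E mul0r eq_sym oner_eq0.
Qed.
Lemma epsV a b : eps b a = (eps a b)^-1.
Proof. by apply: (mulfI (eps_neq0 a b)); rewrite epsC mulfV ?eps_neq0. Qed.
Lemma eps0r a : eps a 0 = 1.
Proof.
apply: (mulfI (eps_neq0 a 0)); rewrite mulr1.
by rewrite -epsDr addr0.
Qed.
Lemma eps0l a : eps 0 a = 1.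
Proof. by rewrite epsV eps0r invr1. Qed.
Lemma epsNr a b : eps a (- b) = (eps a b)^-1.
Proof.
by apply: (mulfI (eps_neq0 a b)); rewrite -epsDr subrr eps0r mulfV ?eps_neq0.
Qed.
Lemma epsNl a b : eps (- a) b = (eps a b)^-1.
Proof. by rewrite epsV epsNr -epsV. Qed.
Lemma eps_sqr a : eps a a = 1 \/ eps a a = -1.
Proof.
by apply/pred2P; rewrite /= -sqrf_eq1 expr2 epsC.
Qed.
End CommutationFactor.

(** The bracket axioms behind the diamond lemma, separated from the bracket of g so that the zero
    bracket, which gives the color symmetric algebra, is covered too. *)
Record color_bracket (K : fieldType) (Gam : zmodType) (eps : Gam -> Gam -> K)
    (V : lmodType K) (gr : Gam -> {pred V}) (br : V -> V -> V) : Prop := {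
  cb_linl : forall y, linear (br^~ y);
  cb_linr : forall x, linear (br x);
  cb_gr : forall a b x y, x \in gr a -> y \in gr b -> br x y \in gr (a + b);
  cb_skew : forall a b x y, x \in gr a -> y \in gr b ->
    br x y = - (eps a b *: br y x);
  cb_jacobi : forall a b c x y z, x \in gr a -> y \in gr b -> z \in gr c ->
    br x (br y z) = br (br x y) z + eps a b *: br y (br x z) }.

(** * Syzygies of the defining relations *)

Section OverlapAlgebra.
Context (K : fieldType) (B : lalgType K) (phi : {scalar B}).
Hypothesis scalAr : forall (c : K) (x y : B), c *: (x * y) = x * (c *: y).

Let phiE : (forall x y, phi (x + y) = phi x + phi y) *
  (forall x, phi (- x) = - phi x) * (forall c x, phi (c *: x) = c * phi x).
Proof. by split; [split=> [x y|x]; rewrite ?raddfD ?raddfN|move=> c x; rewrite linearZ]. Qed.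

(** R, P, Q, S, T stand for [x, y], [y, z], [x, z], [[x, y], z], [y, [x, z]], and the Jacobi
    identity enters as S + ab T. The functional phi carries the identity into K, where [field]
    treats the noncommutative monomials as atoms. *)
Lemma overlap_algebra (ab ac bc : K) (X Y Z P Q R S T : B) : ab != 0 ->
  let J c x y r := x * y - c *: (y * x) - r in
  phi (J ab X Y R * Z - X * J bc Y Z P) =
  phi (- (ab *: (Y * J ac X Z Q)) + bc *: (J ac X Z Q * Y)
  - (ab * ac) *: (J bc Y Z P * X) + (bc * ac) *: (Z * J ab X Y R)
  + J (ab * ac) X P (S + ab *: T) - J (ac * bc) R Z S
  - ab *: J (ab^-1 * bc) Y Q T).
Proof.
move=> ab0 J; rewrite /J !(mulrBl, mulrBr) -!scalerAl -!scalAr !mulrA !phiE.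
by field.
Qed.

Lemma skew_algebra (ab ba : K) (X Y R : B) : ab * ba = 1 ->
  phi (Y * X - ba *: (X * Y) - - (ba *: R)) =
  phi (- (ba *: (X * Y - ab *: (Y * X) - R))).
Proof. by move=> E; rewrite !phiE !mulrDr !mulrN mulrA [ba * ab]mulrC E; ring. Qed.

Lemma linr_algebra (ab c : K) (X Y Y' R R' : B) :
  phi (X * (c *: Y + Y') - ab *: ((c *: Y + Y') * X) - (c *: R + R')) =
  phi (c *: (X * Y - ab *: (Y * X) - R) + (X * Y' - ab *: (Y' * X) - R')).
Proof. by rewrite !(mulrDl, mulrDr) -!scalerAl -!scalAr !phiE; ring. Qed.

Lemma linl_algebra (ab c : K) (X X' Y R R' : B) :
  phi ((c *: X + X') * Y - ab *: (Y * (c *: X + X')) - (c *: R + R')) =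
  phi (c *: (X * Y - ab *: (Y * X) - R) + (X' * Y - ab *: (Y * X') - R')).
Proof. by rewrite !(mulrDl, mulrDr) -!scalerAl -!scalAr !phiE; ring. Qed.
End OverlapAlgebra.

Section MalgMcoeff.
Context (K : fieldType) (X : choiceType).
Definition mcoeffl (k : X) (t : {malg K[X]}) : K := t@_k.
Lemma mcoeffl_scalar k : scalar (mcoeffl k).
Proof. by move=> c s t; rewrite /mcoeffl mcoeffD mcoeffZ. Qed.
HB.instance Definition _ k :=
  GRing.isLinear.Build K {malg K[X]} K *%R (mcoeffl k) (mcoeffl_scalar k).
Lemma eq_mcoeffl s t : (forall k, mcoeffl k s = mcoeffl k t) -> s = t.
Proof. by move=> h; apply/malgP => k; apply: h. Qed.
End MalgMcoeff.

Section Overlap.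
Context (K : fieldType) (Gam : zmodType) (eps : Gam -> Gam -> K).
Hypothesis heps : commutation_factor eps.
Context (V : lmodType K) (gr : Gam -> {pred V}) (br : V -> V -> V).
Hypothesis hbr : color_bracket eps gr br.
Context (A : choiceType) (iota : {linear V -> {malg K[word A]}}).

Let iotaD x y : iota (x + y) = iota x + iota y. Proof. exact: linearD. Qed.
Let iotaZ c x : iota (c *: x) = c *: iota x. Proof. exact: linearZ. Qed.
Let iotaN x : iota (- x) = - iota x. Proof. exact: linearN. Qed.

(** The degrees are arguments because x and y do not determine them: 0 is homogeneous of every
    degree, and brackets may vanish. *)
Definition defect al be x y : {malg K[word A]} :=
  iota x * iota y - eps al be *: (iota y * iota x) - iota (br x y).

Lemma defectE al be x y : defect al be x y =
  iota x * iota y - eps al be *: (iota y * iota x) - iota (br x y).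
Proof. by []. Qed.

(* The syzygy between the two reductions of a word x y z. *)
Lemma defect_overlap al be ga x y z :
  x \in gr al -> y \in gr be -> z \in gr ga ->
  defect al be x y * iota z - iota x * defect be ga y z =
  - (eps al be *: (iota y * defect al ga x z))
  + eps be ga *: (defect al ga x z * iota y)
  - (eps al be * eps al ga) *: (defect be ga y z * iota x)
  + (eps be ga * eps al ga) *: (iota z * defect al be x y)
  + defect al (be + ga) x (br y z) - defect (al + be) ga (br x y) z
  - eps al be *: defect be (al + ga) y (br x z).
Proof.
move=> xa yb zc; rewrite /defect (cb_jacobi hbr xa yb zc) iotaD iotaZ.
rewrite (epsDr heps al) (epsDr heps be) (epsDl heps al) (epsV heps al be).
apply: eq_mcoeffl => w; apply: overlap_algebra; last exact: eps_neq0.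
exact: free_scalerAr.
Qed.

Lemma defect_skew al be x y : x \in gr al -> y \in gr be ->
  defect be al y x = - (eps be al *: defect al be x y).
Proof.
move=> xa yb; rewrite /defect (cb_skew hbr yb xa) iotaN iotaZ.
apply: eq_mcoeffl => w; apply: skew_algebra; exact: epsC.
Qed.

Lemma defect_linr al be x c y y' :
  defect al be x (c *: y + y') = c *: defect al be x y + defect al be x y'.
Proof.
rewrite /defect (cb_linr hbr) !(iotaD, iotaZ).
apply: eq_mcoeffl => w; apply: linr_algebra; exact: free_scalerAr.
Qed.

Lemma defect_linl al be y c x x' :
  defect al be (c *: x + x') y = c *: defect al be x y + defect al be x' y.
Proof.
rewrite /defect (cb_linl hbr) !(iotaD, iotaZ).
apply: eq_mcoeffl => w; apply: linl_algebra; exact: free_scalerAr.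
Qed.

Lemma defect0r al be x : defect al be x 0 = 0.
Proof.
have := defect_linr al be x 1 0 0.
by rewrite !scale1r addr0 => /(congr1 (fun t => t - defect al be x 0)); rewrite addrK subrr.
Qed.
Lemma defect0l al be x : defect al be 0 x = 0.
Proof.
have := defect_linl al be x 1 0 0.
by rewrite !scale1r addr0 => /(congr1 (fun t => t - defect al be 0 x)); rewrite addrK subrr.
Qed.

End Overlap.

(** * Termination measure and leftmost reductions *)

Section Inversions.
Context (A : eqType) (le : rel A).
Hypothesis le_total : total le.

Definition gt a b := ~~ le a b.

Fixpoint inv (w : seq A) : nat :=
  if w is a :: s then (count (gt a) s + inv s)%N else 0%N.

Lemma gt_le a b : gt a b -> le b a.
Proof. by rewrite /gt; case/orP: (le_total a b) => ->. Qed.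

Lemma inv_swap u a b v : gt a b -> inv (u ++ a :: b :: v) = (inv (u ++ b :: a :: v)).+1.
Proof.
move=> ab; elim: u => [|c u IH] /=.
  by rewrite ab /gt (gt_le ab) /=; lia.
by rewrite IH !count_cat /=; lia.
Qed.

Lemma inv_bound w : (inv w <= size w * size w)%N.
Proof.
elim: w => //= a w IH; have := count_size (gt a) w; lia.
Qed.

(* As inv w <= size w ^ 2, this compares sizes first and inversions second. *)
Definition mu w := (size w * (size w * size w) + inv w)%N.

Lemma mu_size w w' : (size w < size w')%N -> (mu w < mu w')%N.
Proof.
move=> h; have := inv_bound w; rewrite /mu.
have h1 : ((size w).+1 * ((size w).+1 * (size w).+1) <= size w' * (size w' * size w'))%N.
  by rewrite !leq_mul.
lia.
Qed.

Lemma mu_swap u a b v : gt a b -> mu (u ++ a :: b :: v) = (mu (u ++ b :: a :: v)).+1.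
Proof. by move=> ab; rewrite /mu inv_swap // !size_cat /= addnS. Qed.

Variable bad : rel A.

(** Always taking the leftmost bad pair fixes the reduction strategy, so that the normal form is a
    function. Its minimality, recorded in [redP], leaves one relative position of the two pairs to
    discuss in an ambiguity. *)
Fixpoint red (w : seq A) : option (seq A * A * A * seq A) :=
  if w is a :: w' then
    if w' is b :: v then
      if bad a b then Some ([::], a, b, v)
      else omap (fun q => (a :: q.1.1.1, q.1.1.2, q.1.2, q.2)) (red w')
    else None
  else None.

Lemma red_cons a b v : red (a :: b :: v) = if bad a b then Some ([::], a, b, v)
  else omap (fun q => (a :: q.1.1.1, q.1.1.2, q.1.2, q.2)) (red (b :: v)).
Proof. by []. Qed.

Lemma redP w u a b v : red w = Some (u, a, b, v) ->
  [/\ w = u ++ a :: b :: v, bad a b &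
    forall u' a' b' v', w = u' ++ a' :: b' :: v' -> bad a' b' -> (size u <= size u')%N].
Proof.
elim: w u a b v => // c [|d w] IH u a b v //; rewrite red_cons.
case: ifP => [cd [<- <- <- <-] //|cd].
case E: (red (d :: w)) => [[[[u1 a1] b1] v1]|] //= [<- <- <- <-].
have [wE ab h] := IH _ _ _ _ E; split=> //; first by rewrite wE.
move=> [|x u'] a' b' v' /=; first by case=> <- <- _; rewrite cd.
by case=> _ /h{}h /h.
Qed.

Lemma redN w : red w = None -> forall u a b v, w = u ++ a :: b :: v -> ~~ bad a b.
Proof.
elim: w => [|c [|d w] IH]; first by move=> _ [|? ?].
  by move=> _ [|? [|? ?]] ? ? ?.
rewrite red_cons; case: ifP => // cd; case E: (red (d :: w)) => [[[[u1 a1] b1] v1]|] // _.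
move=> [|x u] a b v /=; first by case=> <- <- _; rewrite cd.
by case=> _ /(IH E).
Qed.

(** The trichotomy behind the ambiguities of the diamond lemma: two adjacent pairs of a word
    coincide, share a letter, or are disjoint. *)
Lemma split_compare (u u' v v' : seq A) a b c d :
  u ++ a :: b :: v = u' ++ c :: d :: v' -> (size u <= size u')%N ->
  [\/ [/\ u = u', a = c, b = d & v = v'],
      [/\ u' = u ++ [:: a], b = c & v = d :: v'] |
      exists x, u' = u ++ [:: a, b & x] /\ v = x ++ c :: d :: v'].
Proof.
elim: u u' => [|p u IH] [|p' u'] //=.
- by case=> -> -> -> _; constructor 1.
- case: u' => [|q x] /= [-> -> ->] _; first by constructor 2.
  by constructor 3; exists x.
- case=> -> /IH{}IH /IH [[-> -> -> ->]|[-> -> ->]|[x [-> ->]]].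
  + by constructor 1.
  + by constructor 2.
  + by constructor 3; exists x.
Qed.
End Inversions.

Section Sandwich.
Context (K : fieldType) (B : lalgType K) (W : lmodType K) (f : {linear B -> W}).
Hypothesis scalAr : forall (c : K) (x y : B), c *: (x * y) = x * (c *: y).

Lemma sandwich_linear P Q c p q :
  f (P * (c *: p + q) * Q) = c *: f (P * p * Q) + f (P * q * Q).
Proof. by rewrite mulrDr mulrDl -scalAr -scalerAl linearP. Qed.

Lemma sandwich_linearl d Q : linear (fun P => f (P * d * Q)).
Proof. by move=> c p q; rewrite !mulrDl -!scalerAl linearP. Qed.

Lemma sandwich_linearr P d : linear (fun Q => f (P * d * Q)).
Proof. by move=> c p q; rewrite mulrDr -scalAr linearP. Qed.

Lemma sandwichJ P Q c p q r :
  f (P * (p - c *: q - r) * Q) = f (P * p * Q) - c *: f (P * q * Q) - f (P * r * Q).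
Proof.
by rewrite !mulrBr !mulrBl -scalAr -scalerAl linearB /= linearB /= linearZ.
Qed.
End Sandwich.

Lemma mulrA5 (B : pzRingType) (p d x y v : B) :
  p * d * x * y * v = p * d * (x * y * v).
Proof. by rewrite !mulrA. Qed.

(** * Confluence *)

Section NormalForm.
Context (K : fieldType).
Hypotheses (two_neq0 : 2 != 0 :> K) (three_neq0 : 3 != 0 :> K).
Context (Gam : zmodType) (eps : Gam -> Gam -> K).
Hypothesis heps : commutation_factor eps.
Context (V : lmodType K) (gr : Gam -> {pred V}) (br : V -> V -> V).
Hypothesis hbr : color_bracket eps gr br.
Context (A : choiceType) (le : rel A) (e : A -> V) (dg : A -> Gam).
Hypotheses (le_total : total le) (le_anti : antisymmetric le) (le_trans : transitive le).
Hypothesis e_gr : forall a, e a \in gr (dg a).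
Hypothesis e_span : forall c x, x \in gr c ->
  lspan_spec [set y | exists2 a, dg a = c & y = e a] x.
Local Notation FA := {malg K[word A]}.
Context (iota : {linear V -> FA}).
Hypothesis iota_e : forall a, iota (e a) = [:w [:: a]].

Local Notation gt := (gt le).
Local Notation mu := (mu le).

Definition oddA a := eps (dg a) (dg a) == -1.
(** A repeated odd letter is reducible even in a sorted word: for eps(a, a) = -1 the defining
    relation reads 2 a a = [a, a]. This is the origin of the factor 2^-1 in [red1]. *)
Definition bad a b := gt a b || ((a == b) && oddA a).
Local Notation red := (red bad).
Definition normal_word (w : word A) : Prop := red w = None.

Definition red1 (w : word A) : FA :=
  if red w is Some (u, a, b, v) then
    if a == b then 2^-1 *: ([:w u] * iota (br (e a) (e a)) * [:w v])
    else eps (dg a) (dg b) *: [:w u ++ b :: a :: v] +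
         [:w u] * iota (br (e a) (e b)) * [:w v]
  else [:w w].

(** The default value 0 for exhausted fuel is not reached from fuel [mu w], since each reduction
    lowers [mu] and only the empty word has measure 0. *)
Fixpoint nf_fuel n (w : word A) : FA :=
  if red w is None then [:w w]
  else if n is n'.+1 then malg_ext (nf_fuel n') (red1 w) else 0.

Definition nf1 (w : word A) : FA := nf_fuel (mu w) w.
Local Notation nf := (malg_ext nf1).

Lemma iota_gr c x : x \in gr c -> sup (fun w => exists2 a, dg a = c & w = [:: a]) (iota x).
Proof.
move=> /e_span; elim=> [|k y z [a ac ->] _ IH]; first by rewrite linear0; exact: sup0.
by rewrite linearP; apply: supD IH; rewrite iota_e; apply: supZ; apply: supU; exists a.
Qed.

Lemma sup_br (P : word A -> Prop) u v a b :
  (forall d, dg d = dg a + dg b -> P (u ++ d :: v)) ->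
  sup P ([:w u] * iota (br (e a) (e b)) * [:w v]).
Proof.
move=> h; apply: (@supM _ _ (fun w => exists2 d, dg d = dg a + dg b & w = u ++ [:: d]) (eq v)).
- apply: (@supM _ _ (eq u) (fun w => exists2 d, dg d = dg a + dg b & w = [:: d])).
  + exact: supU.
  + exact: iota_gr (cb_gr hbr (e_gr a) (e_gr b)).
  + by move=> _ _ <- [d dd ->]; exists d.
- exact: supU.
- by move=> _ _ [d dd ->] <-; rewrite -catA; exact: h.
Qed.

Lemma red1_mu w : red w != None -> sup (fun w' => (mu w' < mu w)%N) (red1 w).
Proof.
rewrite /red1; case E: (red w) => [[[[u a] b] v]|] // _.
have [-> ab _] := redP E.
have small c d : sup (fun w' => (mu w' < mu (u ++ a :: b :: v))%N)
    ([:w u] * iota (br (e c) (e d)) * [:w v]).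
  by apply: sup_br => f _; apply: mu_size; rewrite !size_cat /= !addnS.
case: eqP => [_|/eqP/negPf nab]; first exact: supZ.
apply: supD => //; apply: supZ; apply: supU.
have ab' : gt a b by move: ab; rewrite /bad nab orbF.
by rewrite (mu_swap le_total _ _ ab').
Qed.

Lemma nf_fuel_stable n m w : (mu w <= n)%N -> (mu w <= m)%N ->
  nf_fuel n w = nf_fuel m w.
Proof.
elim: n m w => [|n IH] m w.
  by rewrite leqn0 /mu addn_eq0 muln_eq0 => /andP[/orP[/nilP ->|]]; case: w => //; case: m.
case: m => [|m].
  by move=> _; rewrite leqn0 /mu addn_eq0 muln_eq0 => /andP[/orP[/nilP ->|]]; case: w.
move=> wn wm /=; case E: (red w) => [q|] //.
apply: eq_malg_ext_sup (red1_mu _) _; first by rewrite E.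
by move=> w' w'w /=; apply: IH; lia.
Qed.

Lemma nfU w : nf [:w w] = nf1 w. Proof. exact: malg_extU. Qed.

Lemma nf1_normal w : normal_word w -> nf1 w = [:w w].
Proof. by rewrite /nf1 /normal_word => h; case: (mu w) => /=; rewrite h. Qed.

Lemma nf1_red w : nf1 w = nf (red1 w).
Proof.
case E: (red w) => [q|]; last by rewrite /red1 E nfU.
rewrite {1}/nf1; case M: (mu w) => [|n] /=.
  by move: M E; rewrite /mu => /eqP; rewrite addn_eq0 muln_eq0 => /andP[/orP[/nilP ->|]]; case: w.
rewrite E; apply: eq_malg_ext_sup (red1_mu _) _; first by rewrite E.
by move=> w' w'w; apply: nf_fuel_stable => //; lia.
Qed.

Lemma nf_ind (P : word A -> Prop) :
  (forall w, (forall w', (mu w' < mu w)%N -> P w') -> P w) -> forall w, P w.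
Proof.
move=> h w; have [n] := ubnP (mu w); elim: n w => // n IH w wn.
by apply: h => w' w'w; apply: IH; lia.
Qed.

(** A property of words kept by exchanges and by contraction to a bracket survives normalization. It
    is applied to bidegrees and to words with letters in a subalgebra. *)
Lemma sup_nf1 (P : word A -> Prop) w :
  (forall u a b v, P (u ++ a :: b :: v) -> P (u ++ b :: a :: v)) ->
  (forall u a b v, P (u ++ a :: b :: v) -> sup P ([:w u] * iota (br (e a) (e b)) * [:w v])) ->
  P w -> sup (fun w' => P w' /\ normal_word w') (nf1 w).
Proof.
move=> P1 P2; elim/nf_ind: w => w IH Pw.
case E: (red w) => [q|]; last by rewrite nf1_normal //; apply: supU.
rewrite nf1_red.
have Pr : sup P (red1 w).
  rewrite /red1 E; case: q E => [[[u a] b] v] /redP [wE _ _]; rewrite wE in Pw.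
  case: eqP => [ab|_]; first by apply: supZ; apply: P2; rewrite -ab in Pw.
  by apply: supD (P2 _ _ _ _ Pw); apply: supZ; apply: supU; exact: P1.
apply: (@sup_ext _ _ _ (fun w' => P w' /\ (mu w' < mu w)%N)); last first.
  by move=> w' [Pw' w'w]; apply: IH.
by move=> w' ww; split; [apply: Pr|apply: (red1_mu _ ww); rewrite E].
Qed.

Local Notation D a b := (defect eps br iota (dg a) (dg b) (e a) (e b)).

Definition sand (P Q p : FA) : FA := nf (P * p * Q).

Lemma sandP P Q c p q : sand P Q (c *: p + q) = c *: sand P Q p + sand P Q q.
Proof. exact: (@sandwich_linear K FA FA (malg_ext nf1) (@free_scalerAr A K)). Qed.

Lemma sandJ P Q c p q r :
  sand P Q (p - c *: q - r) = sand P Q p - c *: sand P Q q - sand P Q r.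
Proof. exact: (@sandwichJ K FA FA (malg_ext nf1) (@free_scalerAr A K)). Qed.

Definition ell (u v : word A) (p : FA) : FA := nf ([:w u] * p * [:w v]).

Lemma ell_linear u v : linear (ell u v).
Proof. by move=> c p q; apply: sandP. Qed.
HB.instance Definition _ u v := GRing.isLinear.Build K FA FA *:%R (ell u v) (ell_linear u v).

Lemma ellD u v p q : ell u v (p + q) = ell u v p + ell u v q. Proof. exact: linearD. Qed.
Lemma ellN u v p : ell u v (- p) = - ell u v p. Proof. exact: linearN. Qed.
Lemma ellZ u v c p : ell u v (c *: p) = c *: ell u v p. Proof. exact: linearZ. Qed.

Lemma ellB u v p q : ell u v (p - q) = ell u v p - ell u v q. Proof. exact: linearB. Qed.

Lemma ellJ u v c p q r :
  ell u v (p - c *: q - r) = ell u v p - c *: ell u v q - ell u v r.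
Proof. by rewrite linearB /= linearB /= linearZ. Qed.

Lemma ell_l u v s p : ell u v ([:w s] * p) = ell (u ++ s) v p.
Proof. by rewrite /ell mulrA wordM. Qed.
Lemma ell_r u v s p : ell u v (p * [:w s]) = ell u (s ++ v) p.
Proof. by rewrite /ell -wordM !mulrA. Qed.

Lemma iota2 a b : iota (e a) * iota (e b) = [:w [:: a; b]].
Proof. by rewrite !iota_e wordM. Qed.

Lemma ell_defect u v a b : ell u v (D a b) = nf1 (u ++ a :: b :: v)
  - eps (dg a) (dg b) *: nf1 (u ++ b :: a :: v) - ell u v (iota (br (e a) (e b))).
Proof.
rewrite /defect.
rewrite ellJ.
rewrite (iota2 a b) (iota2 b a).
have E c d : ell u v [:w [:: c; d]] = nf1 (u ++ c :: d :: v).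
  by rewrite /ell wordM wordM nfU -catA.
by rewrite (E a b) (E b a).
Qed.

Lemma ell_red w u a b v : red w = Some (u, a, b, v) -> ell u v (D a b) = 0.
Proof.
move=> E; have [wE ab _] := redP E; rewrite ell_defect -wE nf1_red /red1 E.
have [eab|nab] := eqVneq a b.
  move: ab; rewrite -eab /bad /gt; have -> : le a a by case/orP: (le_total a a).
  rewrite eqxx /= => /eqP ->; rewrite -eab in wE.
  rewrite -wE nf1_red /red1 E -eab eqxx linearZ /= -/(ell u v _) scaleN1r opprK.
  by rewrite -scalerDl (_ : 2^-1 + 2^-1 = 1) ?scale1r ?subrr //; field.
by rewrite linearD linearZ /= nfU -/(ell u v _) [_ + ell _ _ _]addrC addrK subrr.
Qed.

(** Only pairs with [le b a] are covered: then w is the larger of the two words that differ by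
    exchanging a and b, and [mu w] can carry the induction. The opposite order follows by
    [defect_skew]. *)
Let claim w := forall u a b v, w = u ++ a :: b :: v -> le b a -> ell u v (D a b) = 0.

(** For eps(a, a) = 1 skew symmetry gives [a, a] = -[a, a], and 2 is invertible; so even squares
    call for no rule. *)
Lemma defect_even a : ~~ oddA a -> D a a = 0.
Proof.
move=> na; rewrite /defect; have [E|E] := eps_sqr heps (dg a); last by rewrite /oddA E eqxx in na.
have := cb_skew hbr (e_gr a) (e_gr a); rewrite E !scale1r => B.
have -> : br (e a) (e a) = 0.
  apply/eqP; have /eqP : 2%:R *: br (e a) (e a) = 0.
    by rewrite scaler_nat mulr2n {1}B addNr.
  by rewrite scaler_eq0 (negPf two_neq0).
by rewrite subrr linear0 subr0.
Qed.

#[local] Opaque defect.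

Section OverlapCases.
Variables (W : lmodType K) (P1 P2 E1 E2 E3 E4 : W) (c1 c2 c3 c4 : K).
Hypotheses (P10 : P1 = 0)
  (E : P1 - P2 = - (c1 *: E3) + c2 *: E4 - c3 *: E1 + c4 *: E2).
Hypotheses (E10 : E1 = 0) (E40 : E4 = 0).

Let E' : - P2 = - (c1 *: E3) + c4 *: E2.
Proof. by move: E; rewrite P10 E10 E40 !scaler0 sub0r subr0 addr0. Qed.

Lemma overlap_case0 : E2 = 0 -> E3 = 0 -> P2 = 0.
Proof.
move=> E20 E30; apply/eqP; move/eqP: E'.
by rewrite E20 E30 !scaler0 oppr0 addr0 oppr_eq0.
Qed.

Lemma overlap_case2 : E2 = 0 -> E3 = P2 -> c1 = -1 -> P2 = 0.
Proof.
move=> E20 E30 c1E; apply/eqP; move/eqP: E'.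
rewrite E20 E30 c1E scaler0 addr0 scaleN1r opprK eq_sym -addr_eq0 -mulr2n.
by rewrite -scaler_nat scaler_eq0 (negPf two_neq0).
Qed.

(** Three equal odd letters: every surviving term of the syzygy is a multiple of P2 and it collapses
    to 3 P2 = 0, the counterpart of [a, [a, a]] = 0. With only the first two letters equal,
    [overlap_case2] arrives in the same way at 2 P2 = 0. *)
Lemma overlap_case3 : E2 = P2 -> E3 = P2 -> c1 = -1 -> c4 = 1 -> P2 = 0.
Proof.
move=> E20 E30 c1E c4E; apply/eqP; move/eqP: E'.
rewrite E20 E30 c1E c4E scale1r scaleN1r opprK eq_sym -addr_eq0 -mulr2n -mulrSr.
by rewrite -scaler_nat scaler_eq0 (negPf three_neq0).
Qed.
End OverlapCases.

Lemma double_eq0 (W : lmodType K) (p : W) k : k = -1 -> p - k *: p - 0 = 0 -> p = 0.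
Proof.
move=> -> /eqP; rewrite subr0 scaleN1r opprK -mulr2n -scaler_nat.
by rewrite scaler_eq0 (negPf two_neq0) => /eqP.
Qed.

Lemma drop_zeros (W : zmodType) (p x y z t l1 l2 l3 : W) :
  p = - x + y - z + t + l1 - l2 - l3 -> l1 = 0 -> l2 = 0 -> l3 = 0 ->
  p = - x + y - z + t.
Proof. by move=> -> -> -> ->; rewrite !subr0 addr0. Qed.

Section Step.
Variable N : nat.
Hypothesis IH : forall w, (mu w < N)%N -> claim w.

Lemma small u v a b : (mu (u ++ a :: b :: v) < N)%N -> (mu (u ++ b :: a :: v) < N)%N ->
  ell u v (D a b) = 0.
Proof.
move=> h1 h2; case/orP: (le_total b a) => ab; first exact: (IH h1).
rewrite (defect_skew heps hbr iota (e_gr b) (e_gr a)) ellN ellZ (IH h2) //.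
by rewrite scaler0 oppr0.
Qed.

(** Bilinearity of the defect reduces the assertion to basis letters. It disposes of the terms with
    an inner bracket, whose words are shorter than the word under discussion. *)
Lemma small_size u v al be x y :
  (forall w, size w = (size u + size v).+2 -> (mu w < N)%N) ->
  x \in gr al -> y \in gr be -> ell u v (defect eps br iota al be x y) = 0.
Proof.
move=> h /e_span; elim=> [|c _ z [a <- ->] _ IHz] yb.
  by rewrite (defect0l hbr) linear0.
rewrite (defect_linl hbr) ellD ellZ IHz // addr0.
have -> : ell u v (defect eps br iota (dg a) be (e a) y) = 0; last by rewrite scaler0.
move/e_span: yb; elim=> [|c' _ z' [b <- ->] _ IHz'].
  by rewrite (defect0r hbr) linear0.
rewrite (defect_linr hbr) ellD ellZ IHz' // addr0 small ?scaler0 //;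
  by apply: h; rewrite size_cat /= !addnS.
Qed.

Lemma gt_trans a b c : gt a b -> gt b c -> gt a c.
Proof.
move=> ab /(gt_le le_total) cb; apply: contra ab => ac; exact: le_trans ac cb.
Qed.

Section Overlap.
Variables (u v : word A).
Let M x y z := mu (u ++ [:: x, y, z & v]).
Let M12 x y z : gt x y -> M x y z = (M y x z).+1.
Proof. exact: mu_swap. Qed.
Let M23 x y z : gt y z -> M x y z = (M x z y).+1.
Proof.
move=> yz; have := mu_swap le_total (u ++ [:: x]) v yz.
by rewrite -!catA.
Qed.
Let sm12 x y z : (M x y z < N)%N -> (M y x z < N)%N -> ell u (z :: v) (D x y) = 0.
Proof. exact: small. Qed.
Let sm23 x y z : (M x y z < N)%N -> (M x z y < N)%N -> ell (u ++ [:: x]) v (D y z) = 0.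
Proof. by move=> h1 h2; apply: small; rewrite -catA. Qed.

(** The syzygy [defect_overlap] placed between u and v. Its three terms with an inner bracket
    involve words one letter shorter and vanish by induction; the six others remain. *)
Lemma overlap_rel a b c : M a b c = N ->
  ell u (c :: v) (D a b) - ell (u ++ [:: a]) v (D b c) =
  - (eps (dg a) (dg b) *: ell (u ++ [:: b]) v (D a c))
  + eps (dg b) (dg c) *: ell u (b :: v) (D a c)
  - (eps (dg a) (dg b) * eps (dg a) (dg c)) *: ell u (a :: v) (D b c)
  + (eps (dg b) (dg c) * eps (dg a) (dg c)) *: ell (u ++ [:: c]) v (D a b).
Proof.
move=> MN.
have lower al be x y : x \in gr al -> y \in gr be ->
    ell u v (defect eps br iota al be x y) = 0.
  by apply: small_size => w ws; rewrite -MN; apply: mu_size; rewrite ws size_cat /= !addnS.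
have /(congr1 (ell u v)) := defect_overlap heps hbr iota (e_gr a) (e_gr b) (e_gr c).
rewrite !iota_e.
set L := [:w [:: a]] * _; set X := _ *: ([:w [:: b]] * _); set Y := _ *: (_ * [:w [:: b]]).
set Z := _ *: (_ * [:w [:: a]]); set W := _ *: ([:w [:: c]] * _).
set l1 := defect _ _ _ _ _ _ (br _ _); set l2 := defect _ _ _ _ _ (br _ _) _.
set l3 := _ *: defect _ _ _ _ _ _ (br _ _).
have -> : ell u v (- X + Y - Z + W + l1 - l2 - l3) =
  - ell u v X + ell u v Y - ell u v Z + ell u v W + ell u v l1 - ell u v l2 - ell u v l3.
  by rewrite linearB linearB linearD linearD linearB linearD linearN.
rewrite ellB /L ell_r ell_l => E.
have EX : ell u v X = eps (dg a) (dg b) *: ell (u ++ [:: b]) v (D a c).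
  by rewrite /X ellZ ell_l.
have EY : ell u v Y = eps (dg b) (dg c) *: ell u (b :: v) (D a c).
  rewrite /Y ellZ ell_r cat1s; reflexivity.
have EZ : ell u v Z = (eps (dg a) (dg b) * eps (dg a) (dg c)) *: ell u (a :: v) (D b c).
  rewrite /Z ellZ ell_r cat1s; reflexivity.
have EW : ell u v W = (eps (dg b) (dg c) * eps (dg a) (dg c)) *: ell (u ++ [:: c]) v (D a b).
  rewrite /W ellZ ell_l; reflexivity.
have l10 : ell u v l1 = 0 by exact: lower (e_gr a) (cb_gr hbr (e_gr b) (e_gr c)).
have l20 : ell u v l2 = 0 by exact: lower (cb_gr hbr (e_gr a) (e_gr b)) (e_gr c).
have l30 : ell u v l3 = 0.
  rewrite /l3 ellZ (lower _ _ _ _ (e_gr b) (cb_gr hbr (e_gr a) (e_gr c))).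
  exact: scaler0.
rewrite -EX -EY -EZ -EW; exact: drop_zeros E l10 l20 l30.
Qed.

Lemma overlap_step a b c : M a b c = N -> bad a b -> le c b ->
  ell u (c :: v) (D a b) = 0 -> ell (u ++ [:: a]) v (D b c) = 0.
Proof.
move=> MN ab cb P1.
have [/andP[/eqP bc nb]|bc] := boolP ((b == c) && ~~ oddA b).
  by rewrite -bc (defect_even nb); apply: linear0.
have {}bc : gt b c || ((b == c) && oddA b).
  rewrite negb_and negbK in bc; case: (eqVneq b c) bc => [_ /= ->|nbc _]; first by rewrite orbT.
  rewrite orbF; apply/negP => bc; move/eqP: nbc; apply; apply: le_anti.
  by rewrite bc cb.
have rel := overlap_rel MN.
(* The four cases are a > b > c, a > b = c, a = b > c and a = b = c, where each equality concerns an
   odd letter. *)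
case/orP: ab => [ab|/andP[/eqP ab oa]]; case/orP: bc => [bc|/andP[/eqP bc ob]].
- have ac := gt_trans ab bc.
  have m1 := M12 c ab; have m2 := M23 b ac; have m3 := M12 a bc.
  have m4 := M23 a bc; have m5 := M12 b ac; have m6 := M23 c ab.
  apply: (overlap_case0 P1 rel).
  + by apply: sm12; lia.
  + by apply: sm12; lia.
  + by apply: sm23; lia.
  + by apply: sm23; lia.
- subst c; have m1 := M12 b ab; have m2 := M23 b ab.
  apply: (overlap_case0 P1 rel).
  + by apply: sm12; lia.
  + exact: P1.
  + by apply: sm23; lia.
  + by apply: sm23; lia.
- subst b; have m1 := M23 a bc; have m2 := M12 a bc.
  apply: (overlap_case2 P1 rel).
  + by apply: sm12; lia.
  + by apply: sm12; lia.
  + by apply: sm23; lia.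
  + reflexivity.
  + exact/eqP.
- subst b c; apply: (overlap_case3 P1 rel).
  + exact: P1.
  + exact: P1.
  + reflexivity.
  + reflexivity.
  + exact/eqP.
  + by move/eqP: oa => ->; rewrite mulrNN mulr1.
Qed.
End Overlap.

(** For disjoint pairs, u D(a, b) x D(c, d) v is expanded in two ways. Expanding the second defect
    (G) only produces contexts in which D(a, b) is already known to vanish; expanding the first (H)
    leaves the assertion about D(c, d) together with terms settled by induction. *)
Lemma far_step u a b x c d v : mu (u ++ a :: b :: x ++ c :: d :: v) = N ->
  bad a b -> bad c d ->
  ell u (x ++ c :: d :: v) (D a b) = 0 -> ell (u ++ a :: b :: x) v (D c d) = 0.
Proof.
move=> MN ab cd A1.
pose G := sand ([:w u] * D a b * [:w x]) [:w v].
pose H := sand [:w u] ([:w x] * D c d * [:w v]).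
have HE y : H y = nf ([:w u] * y * ([:w x] * D c d * [:w v])) by [].
have GE y : G y = nf ([:w u] * D a b * ([:w x] * y * [:w v])).
  exact: (congr1 (malg_ext nf1) (mulrA5 [:w u] (D a b) [:w x] y [:w v])).
have Gw s : G [:w s] = ell u (x ++ s ++ v) (D a b).
  by rewrite GE wordM wordM -catA.
have Hw s : H [:w s] = ell (u ++ s ++ x) v (D c d).
  rewrite HE -(mulrA5 [:w u] [:w s] [:w x] (D c d) [:w v]).
  by rewrite wordM wordM -catA.
have lowG y f : y \in gr f -> G (iota y) = 0.
  move=> /e_span; elim=> [|k _ z [m _ ->] _ IHz].
    by rewrite linear0 /G /sand mulr0 mul0r linear0.
  have -> : G (iota (k *: e m + z)) = k *: G (iota (e m)) + G (iota z).
    by rewrite linearP; apply: sandP.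
  rewrite IHz iota_e Gw small_size ?scaler0 ?addr0 //.
  by move=> w ws; rewrite -MN; apply: mu_size; rewrite ws !size_cat /= !size_cat /=; lia.
have lowH y f : y \in gr f -> H (iota y) = 0.
  move=> /e_span; elim=> [|k _ z [m _ ->] _ IHz].
    by rewrite linear0 /H /sand mulr0 mul0r linear0.
  have -> : H (iota (k *: e m + z)) = k *: H (iota (e m)) + H (iota z).
    by rewrite linearP; apply: sandP.
  rewrite IHz iota_e Hw small_size ?scaler0 ?addr0 //.
  by move=> w ws; rewrite -MN; apply: mu_size; rewrite ws !size_cat /= !size_cat /=; lia.
have M1 m n p q : mu ((u ++ m :: n :: x) ++ p :: q :: v) = mu (u ++ m :: n :: x ++ p :: q :: v).
  by rewrite -catA.
have M1' p q p' q' : gt p q ->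
    mu (u ++ p' :: q' :: x ++ p :: q :: v) = (mu (u ++ p' :: q' :: x ++ q :: p :: v)).+1.
  by move=> pq; rewrite -!M1; apply: mu_swap.
have M2' p q p' q' : gt p q ->
    mu (u ++ p :: q :: x ++ p' :: q' :: v) = (mu (u ++ q :: p :: x ++ p' :: q' :: v)).+1.
  by move=> pq; apply: mu_swap.
have F0 : G (D c d) = 0.
  have -> : G (D c d) = ell u (x ++ c :: d :: v) (D a b)
      - eps (dg c) (dg d) *: ell u (x ++ d :: c :: v) (D a b) - G (iota (br (e c) (e d))).
    by rewrite {1}defectE /G sandJ iota2 iota2 -/G Gw Gw.
  rewrite A1 (lowG _ _ (cb_gr hbr (e_gr c) (e_gr d))).
  suff -> : ell u (x ++ d :: c :: v) (D a b) = 0 by rewrite scaler0 !subr0.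
  case/orP: cd => [cd|/andP[/eqP cd _]]; last by rewrite -cd in A1 *; apply: A1.
  have := M1' _ _ a b cd; case/orP: ab => [ab|/andP[/eqP ab _]] m1.
    by have := M2' _ _ d c ab => m2; apply: small; lia.
  by rewrite -ab in MN m1 *; apply: small; lia.
have {F0} : H (D a b) = 0 by rewrite -F0 GE.
have -> : H (D a b) = ell (u ++ a :: b :: x) v (D c d)
    - eps (dg a) (dg b) *: ell (u ++ b :: a :: x) v (D c d) - H (iota (br (e a) (e b))).
  by rewrite {1}defectE /H sandJ iota2 iota2 -/H Hw Hw.
rewrite (lowH _ _ (cb_gr hbr (e_gr a) (e_gr b))).
case/orP: ab => [ab|/andP[/eqP ab /eqP oa]].
  have -> : ell (u ++ b :: a :: x) v (D c d) = 0; last by rewrite scaler0 !subr0.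
  have := M2' _ _ c d ab; case/orP: cd => [cd|/andP[/eqP cd _]] m1.
    by have := M1' _ _ b a cd => m2; apply: small; rewrite M1; lia.
  by rewrite -cd in MN m1 *; apply: small; rewrite M1; lia.
(* For a = b odd the two words of the expansion coincide, and what vanishes is twice the term
   sought. *)
rewrite -ab; exact: double_eq0.
Qed.
End Step.

(** An arbitrary reducible pair is compared with the leftmost one, for which the assertion holds by
    the very definition of the normal form ([ell_red]). *)
Lemma claim_all w : claim w.
Proof.
elim/nf_ind: w => w IH u' c d v' wE dc.
have [/andP[/eqP cd nb]|cd] := boolP ((c == d) && ~~ oddA c).
  by rewrite -cd (defect_even nb); apply: linear0.
have {}cd : bad c d.
  rewrite /bad; rewrite negb_and negbK in cd; case: (eqVneq c d) cd => [_ /= ->|nbc _].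
    by rewrite orbT.
  rewrite orbF; apply/negP => bc; move/eqP: nbc; apply; apply: le_anti.
  by rewrite bc dc.
case E: (red w) => [[[[u a] b] v]|]; last first.
  by have := redN E wE; rewrite cd.
have [wE2 ab first] := redP E.
have P1 := ell_red E.
have sz := first _ _ _ _ wE cd.
rewrite wE in wE2.
case: (split_compare (esym wE2) sz) => [[<- <- <- <-] //|[u'E bc vE]|[x [u'E vE]]].
- rewrite u'E; subst c v u'; apply: (overlap_step IH _ ab dc P1).
  by rewrite wE -catA.
- rewrite u'E; subst v u'; apply: (far_step IH _ ab cd P1).
  by rewrite wE -catA.
Qed.

Lemma nf_defect p q al be x y : x \in gr al -> y \in gr be ->
  nf (p * defect eps br iota al be x y * q) = 0.
Proof.
move=> xa yb; pose d := defect eps br iota al be x y; rewrite -/d.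
have h u v : ell u v d = 0.
  (* Any bound above the measure of all words of length s + 2 serves, with s = size u + size v; the
     cube of s + 3 exceeds (s + 2)^3 + (s + 2)^2. *)
  apply: (@small_size (mu (u ++ v) + (size u + size v).+3 * ((size u + size v).+3 * (size u + size v).+3)).+1) xa yb.
    by move=> w _; apply: claim_all.
  by move=> w ws; have := inv_bound le w; rewrite /mu ws; nia.
apply: (linear_word0 (f := fun p => nf (p * d * q))) => [|u].
  exact: (@sandwich_linearl K FA FA (malg_ext nf1)).
apply: (linear_word0 (f := fun q => nf ([:w u] * d * q))) => [|v]; last exact: h.
exact: (@sandwich_linearr K FA FA (malg_ext nf1) (@free_scalerAr A K)).
Qed.

End NormalForm.

(** * Direct sums *)

Section FiniteSums.
Context (V : zmodType) (I : choiceType).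
Implicit Types (f : I -> V) (E : {fset I}).

Lemma fsum_fset f E : (forall i, f i != 0 -> i \in E) ->
  \sum_(i \in [set: I]) f i = \sum_(i <- E) f i.
Proof.
move=> h; apply: fsbigTE => i; apply: contraNeq; exact: h.
Qed.

Lemma finite_support_fset f : finite_set [set i | f i != 0] ->
  exists E, forall i, f i != 0 -> i \in E.
Proof.
by move=> ff; exists (fset_set [set i | f i != 0]) => i fi; rewrite in_fset_set // inE.
Qed.

Lemma finite_support_sub f E : (forall i, f i != 0 -> i \in E) ->
  finite_set [set i | f i != 0].
Proof. by move=> h; apply: sub_finite_set (finite_fset E) => i /h. Qed.
End FiniteSums.

Section DirectSumTheory.
Context (K : fieldType) (V : lmodType K) (I : choiceType) (P : I -> {pred V}).
Hypothesis hP : is_direct_sum P.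

Lemma ds0 i : 0 \in P i. Proof. by have [] := hP.1 i. Qed.
Lemma dsP i c x y : x \in P i -> y \in P i -> c *: x + y \in P i.
Proof. by have [_ h] := hP.1 i; apply: h. Qed.
Lemma componentP x : is_decomposition P x (component P ^~ x).
Proof.
have [f [fx _]] := hP.2 x.
by rewrite /component; case: xgetP => [g _ //|/(_ f)]; case.
Qed.

Lemma component_uniq x f : is_decomposition P x f -> component P ^~ x = f.
Proof.
by have [g [_ gu]] := hP.2 x => /gu <-; apply/esym/gu/componentP.
Qed.

Lemma component_in i x : component P i x \in P i.
Proof. by have [] := componentP x. Qed.

Lemma component_supp x : exists E : {fset I}, forall i, component P i x != 0 -> i \in E.
Proof. by have [_ /finite_support_fset] := componentP x. Qed.

Lemma component_sum x (E : {fset I}) : (forall i, component P i x != 0 -> i \in E) ->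
  x = \sum_(i <- E) component P i x.
Proof. by move=> h; have [_ _ xE] := componentP x; rewrite {1}xE; apply: fsum_fset. Qed.

Lemma component_linear i : linear (component P i).
Proof.
move=> c x y; pose f j := c *: component P j x + component P j y.
have [E hE] := component_supp x; have [F hF] := component_supp y.
suff /component_uniq/(congr1 (fun h => h i)) : is_decomposition P (c *: x + y) f by [].
have fEF j : f j != 0 -> j \in (E `|` F)%fset.
  rewrite inE; apply: contraNT; rewrite negb_or /f => /andP[jE jF].
  have /eqP -> : component P j x == 0 by apply: contraNT jE => /hE.
  have /eqP -> : component P j y == 0 by apply: contraNT jF => /hF.
  by rewrite scaler0 addr0.
split.
- by move=> j; apply: dsP; apply: component_in.
- exact: finite_support_sub fEF.
- have hx j : component P j x != 0 -> j \in (E `|` F)%fset by move=> /hE; rewrite inE => ->.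
  have hy j : component P j y != 0 -> j \in (E `|` F)%fset.
    by move=> /hF; rewrite inE orbC => ->.
  by rewrite (fsum_fset fEF) big_split -scaler_sumr /= -(component_sum hx) -(component_sum hy).
Qed.

Lemma component_big i (J : Type) (r : seq J) (F : J -> V) :
  component P i (\sum_(j <- r) F j) = \sum_(j <- r) component P i (F j).
Proof.
pose G : {linear V -> V} :=
  HB.pack (component P i) (GRing.isLinear.Build K V V *:%R _ (component_linear i)).
exact: (linear_sum G).
Qed.

Lemma component0 i : component P i 0 = 0.
Proof. by have := component_big i (Nil unit) (fun=> 0); rewrite !big_nil. Qed.
Lemma componentZ i c x : component P i (c *: x) = c *: component P i x.
Proof. by rewrite -[c *: x]addr0 component_linear component0 addr0. Qed.

Lemma component_hom i j x : x \in P i -> component P j x = if j == i then x else 0.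
Proof.
move=> xi; suff /component_uniq/(congr1 (fun h => h j)) :
  is_decomposition P x (fun j => if j == i then x else 0) by [].
have fE k : (if k == i then x else 0) != 0 -> k \in [fset i]%fset.
  by have [->|_] := eqVneq k i; [rewrite inE eqxx|rewrite eqxx].
split; last by rewrite (fsum_fset fE) big_seq_fset1 ifT.
- by move=> k; case: eqP => [->|_] //; apply: ds0.
- exact: finite_support_sub fE.
Qed.

Lemma component_id i x : x \in P i -> component P i x = x.
Proof. by move=> /component_hom ->; rewrite eqxx. Qed.
End DirectSumTheory.

(** Besides directness this criterion identifies [component], which is otherwise known only through
    a choice. *)
Lemma direct_sum_proj (K : fieldType) (V : lmodType K) (I : choiceType)
    (P : I -> {pred V}) (pr : I -> V -> V) :
  (forall i, GRing.submod_closed (P i)) ->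
  (forall i, linear (pr i)) ->
  (forall i x, pr i x \in P i) ->
  (forall i x, x \in P i -> pr i x = x) ->
  (forall i j x, x \in P i -> j != i -> pr j x = 0) ->
  (forall x, exists2 E : {fset I}, forall i, pr i x != 0 -> i \in E &
     x = \sum_(i <- E) pr i x) ->
  is_direct_sum P /\ forall i x, component P i x = pr i x.
Proof.
move=> Psub prl prP prid pr0 prE.
have hd x : is_decomposition P x (pr^~ x).
  have [E h xE] := prE x; split=> //; first exact: finite_support_sub h.
  by rewrite (fsum_fset h).
have prsum i (J : Type) (r : seq J) (F : J -> V) :
    pr i (\sum_(j <- r) F j) = \sum_(j <- r) pr i (F j).
  pose G : {linear V -> V} := HB.pack (pr i) (GRing.isLinear.Build K V V *:%R _ (prl i)).
  exact: (linear_sum G).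
have ds : is_direct_sum P.
  split=> // x; exists (pr^~ x); split; first exact: hd.
  move=> f [fP /finite_support_fset[E hE] xE]; apply: funext => i.
  rewrite xE (fsum_fset hE) prsum.
  have [iE|iE] := boolP (i \in E).
    rewrite (big_fsetD1 i iE) /= prid // big1_seq ?addr0 // => j /andP[_].
    by rewrite !inE => /andP[ji _]; apply: (pr0 j) => //; rewrite eq_sym.
  rewrite big1_seq; last first.
    move=> j /andP[_ jE]; apply: (pr0 j) => //; apply: contraNneq iE => -> //.
  by apply/eqP; rewrite eq_sym; apply: contraNT iE => /hE.
split=> // i x; by have /(congr1 (fun h => h i)) := component_uniq ds (hd x).
Qed.

(** * The Poincare-Birkhoff-Witt theorem *)

Record ordered_basis (K : fieldType) (Gam : zmodType) (eps : Gam -> Gam -> K)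
    (V : lmodType K) (gr : Gam -> {pred V}) (br : V -> V -> V)
    (A : choiceType) (le : rel A) (e : A -> V) (dg : A -> Gam)
    (iota : {linear V -> {malg K[word A]}}) : Prop := {
  ob_two : 2 != 0 :> K;
  ob_three : 3 != 0 :> K;
  ob_eps : commutation_factor eps;
  ob_br : color_bracket eps gr br;
  ob_total : total le;
  ob_anti : antisymmetric le;
  ob_trans : transitive le;
  ob_gr : forall a, e a \in gr (dg a);
  ob_span : forall c x, x \in gr c ->
    lspan_spec [set y | exists2 a, dg a = c & y = e a] x;
  ob_iota : forall a, iota (e a) = [:w [:: a]] }.

Lemma linear_relL (K : fieldType) (U W : lmodType K) (f : {linear U -> W}) c x y z :
  f (z - (c *: x + y)) = f z - (c *: f x + f y).
Proof. by rewrite linearB linearP. Qed.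

Lemma linear_relJ (K : fieldType) (U W : lmodType K) (f : {linear U -> W}) c x y z :
  f (x - c *: y - z) = f x - c *: f y - f z.
Proof. by rewrite !linearB linearZ. Qed.

Lemma nf_normal (K : fieldType) (Gam : zmodType) (eps : Gam -> Gam -> K)
    (V : lmodType K) (br : V -> V -> V) (A : choiceType) (le : rel A) (e : A -> V)
    (dg : A -> Gam) (iota : {linear V -> {malg K[word A]}}) p :
  sup (normal_word eps le dg) p -> malg_ext (nf1 eps br le e dg iota) p = p.
Proof.
move=> ph; rewrite -[RHS]malg_ext_id; apply: eq_malg_ext_sup ph _ => w.
exact: nf1_normal.
Qed.

Section Env.
Context (K : fieldType) (Gam : zmodType) (eps : Gam -> Gam -> K).
Context (V : lmodType K) (gr : Gam -> {pred V}) (br : V -> V -> V).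
Context (A : choiceType) (le : rel A) (e : A -> V) (dg : A -> Gam).
Local Notation FA := {malg K[word A]}.
Context (iota : {linear V -> FA}).
Hypothesis H : ordered_basis eps gr br le e dg iota.
Context (h : {pred V}).
Hypothesis h_sub : GRing.submod_closed h.
Hypothesis h_br : forall x y, x \in h -> y \in h -> br x y \in h.
Hypothesis h_span : forall x, x \in h ->
  lspan_spec [set y | exists2 a, e a \in h & y = e a] x.

Local Notation nf := (malg_ext (nf1 eps br le e dg iota)).
Local Notation U := (env eps gr br h).
Local Notation FL := {malg K[word (letter h)]}.
Local Notation pi := (lpi (@env_ideal _ _ eps _ gr br h)).
Local Notation normalw := (normal_word eps le dg).

Let f_word (s : word (letter h)) : FA := \prod_(x <- (s : seq (letter h))) iota (val x).
Local Notation wordT := (malg_ext f_word).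

Let wordTM (p q : FL) : wordT (p * q) = wordT p * wordT q.
Proof. exact: word_ext_M (@free_scalerAr A K) p q. Qed.

Let wordT1 (x : letter h) : wordT << 1 *g ([:: x] : word (letter h)) >> = iota (val x).
Proof. by rewrite malg_extU /f_word big_seq1. Qed.

Let wordTL c x y z : wordT (z - (c *: x + y)) = wordT z - (c *: wordT x + wordT y).
Proof. exact: linear_relL. Qed.
Let wordTJ c x y z : wordT (x - c *: y - z) = wordT x - c *: wordT y - wordT z.
Proof. exact: linear_relJ. Qed.

Definition toFA (u : U) : FA := nf (wordT (lrepr u)).

Lemma env_rel_defect r : env_rel eps gr br r ->
  wordT r = 0 \/ exists a b x y, [/\ x \in gr a, y \in gr b &
    wordT r = defect eps br iota a b x y].
Proof.
case=> [c x y z E|a b x y z xa yb E]; [left|right]; last exists a, b, (val x), (val y);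
  have := (wordT1 x, wordT1 y, wordT1 z);
  move: << 1 *g ([:: x] : word (letter h)) >> << 1 *g ([:: y] : word (letter h)) >>
    << 1 *g ([:: z] : word (letter h)) >> => X Y Z [[FX FY] FZ].
  by rewrite wordTL FX FY FZ E linearP; apply: subrr.
split=> //; rewrite wordTJ wordTM wordTM FX FY FZ E.
reflexivity.
Qed.

(** The half of the Poincare-Birkhoff-Witt theorem that rests on confluence: normalization kills the
    image of the defining ideal, so the normal form depends on the class alone and not on its
    representative. *)
Lemma toFA_pi t : toFA (pi t) = nf (wordT t).
Proof.
apply: (@lspan_ext _ _ _ _ (malg_ext (nf1 eps br le e dg iota) \o malg_ext f_word)).
move=> s [u [r [v [/env_rel_defect rr ->]]]] /=.
rewrite wordTM wordTM; case: rr => [->|[a [b [x [y [xa yb ->]]]]]].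
  by rewrite mulr0 mul0r linear0.
have X := nf_defect (ob_two H) (ob_three H) (ob_eps H) (ob_br H) (ob_total H) (ob_anti H)
  (ob_trans H) (ob_gr H) (ob_span H) (ob_iota H) (wordT u) (wordT v) xa yb.
exact: X.
Qed.

Lemma toFA_linear : linear toFA.
Proof.
move=> c p q; rewrite -[p]lreprK -[q]lreprK env_piZ.
have -> : (pi (c *: lrepr p) : U) + pi (lrepr q) = pi (c *: lrepr p + lrepr q).
  by rewrite raddfD.
by rewrite !toFA_pi linearP /= linearP.
Qed.
HB.instance Definition _ := GRing.isLinear.Build K U FA *:%R toFA toFA_linear.

Let pi_rel r : env_rel eps gr br r -> pi r = 0.
Proof.
move=> rr; rewrite -(raddf0 pi); apply/lpiP; rewrite subr0; apply: mem_lspan.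
by exists 1, r, 1; rewrite mul1r mulr1.
Qed.

Lemma env_in_lin c (x y z : letter h) : val z = c *: val x + val y ->
  env_in eps gr br z = c *: env_in eps gr br x + env_in eps gr br y.
Proof.
move=> /(@env_rel_lin _ _ eps _ gr br h)/pi_rel; rewrite /env_in.
move: << 1 *g ([:: x] : word (letter h)) >> << 1 *g ([:: y] : word (letter h)) >>
    << 1 *g ([:: z] : word (letter h)) >> => X Y Z.
rewrite raddfB raddfD /= env_piZ => /eqP; rewrite subr_eq0 => /eqP; exact.
Qed.

Lemma env_in_br a b (x y z : letter h) :
  val x \in gr a -> val y \in gr b -> val z = br (val x) (val y) ->
  env_in eps gr br x * env_in eps gr br y =
  eps a b *: (env_in eps gr br y * env_in eps gr br x) + env_in eps gr br z.
Proof.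
move=> xa yb /(env_rel_br eps xa yb)/pi_rel; rewrite /env_in.
move: << 1 *g ([:: x] : word (letter h)) >> << 1 *g ([:: y] : word (letter h)) >>
    << 1 *g ([:: z] : word (letter h)) >> => X Y Z.
rewrite !env_piX env_piZ 2!raddfB /= => /eqP; rewrite subr_eq0 => /eqP <-.
by rewrite addrC subrK.
Qed.

Definition letterS x (xh : x \in h) : letter h := exist _ x xh.

(* The inclusion of h, with junk value 0 outside h. *)
Definition inl (x : V) : U := if insub x is Some l then env_in eps gr br l else 0.

Lemma inlE (x : letter h) : inl (val x) = env_in eps gr br x.
Proof. by rewrite /inl valK. Qed.

Lemma inl_lin c x y : x \in h -> y \in h -> inl (c *: x + y) = c *: inl x + inl y.
Proof.
move=> xh yh; have zh : c *: x + y \in h by apply: (h_sub.2).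
rewrite -[x]/(val (letterS xh)) -[y]/(val (letterS yh)) -[_ + _]/(val (letterS zh)).
rewrite !inlE; exact: env_in_lin.
Qed.

Lemma inl0 : inl 0 = 0.
Proof.
have h0 : 0 \in h by case: h_sub.
have := inl_lin 1 h0 h0; rewrite !scale1r addr0 => /eqP.
by rewrite addrC -subr_eq subrr => /eqP.
Qed.

Lemma inl_br a b x y : x \in h -> y \in h -> x \in gr a -> y \in gr b ->
  inl x * inl y = eps a b *: (inl y * inl x) + inl (br x y).
Proof.
move=> xh yh xa yb; have zh := h_br xh yh.
rewrite -[br x y]/(val (letterS zh)) -[x]/(val (letterS xh)) -[y]/(val (letterS yh)).
rewrite !inlE; exact: env_in_br.
Qed.

Let g_word (w : word A) : U := \prod_(a <- (w : seq A)) inl (e a).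
Definition ofFA : FA -> U := malg_ext g_word.
HB.instance Definition _ := GRing.Linear.on ofFA.

Lemma ofFAP c p q : ofFA (c *: p + q) = c *: ofFA p + ofFA q.
Proof. exact: linearP. Qed.

Lemma ofFA_M p q : ofFA (p * q) = ofFA p * ofFA q.
Proof. apply: word_ext_M => c x y; exact: env_scalerAr. Qed.
Lemma ofFA_word w : ofFA [:w w] = \prod_(a <- (w : seq A)) inl (e a).
Proof. exact: malg_extU. Qed.
Lemma ofFA_1 : ofFA 1 = 1.
Proof. by rewrite -word_nil ofFA_word big_nil. Qed.

Definition word_in (w : word A) : Prop := all (fun a => e a \in h) w.

Lemma inh_cat (u v : word A) : word_in (u ++ v) <-> word_in u /\ word_in v.
Proof. by rewrite /word_in all_cat; split=> [/andP|[-> ->]]. Qed.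

Lemma h_lspan (S : set V) x : (forall y, S y -> y \in h) -> lspan_spec S x -> x \in h.
Proof.
move=> Sh; elim=> [|c y z /Sh yh _ zh]; first by case: h_sub.
by apply: (h_sub.2).
Qed.

Lemma iota_inh x : x \in h -> sup (fun w => word_in w) (iota x) /\ ofFA (iota x) = inl x.
Proof.
move=> /h_span; elim=> [|c y z [a ah ->] zs [IH1 IH2]].
  by rewrite !linear0 inl0; split=> //; apply: sup0.
have zh : z \in h by apply: h_lspan zs => ? [? ? ->].
rewrite linearP ofFAP (ob_iota H) IH2 inl_lin // ofFA_word big_seq1; split=> //.
by apply: supD IH1; apply: supZ; apply: supU; rewrite /word_in /= ah.
Qed.

Lemma ofFA_wordT t : ofFA (wordT t) = pi t.
Proof.
pose f t := ofFA (wordT t) - pi t.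
suff : f t = 0 by move=> /eqP; rewrite subr_eq0 => /eqP.
apply: linear_word0.
  move=> c p q; rewrite /f linearP /= linearP linearP /= scalerBr opprD addrACA.
  by rewrite env_piZ.
move=> s; rewrite /f malg_extU /f_word; apply/eqP; rewrite subr_eq0; apply/eqP.
elim: (s : seq _) => [|x w IH]; first by rewrite big_nil ofFA_1.
rewrite big_cons ofFA_M IH (iota_inh (valP x)).2 inlE /env_in env_piX.
by rewrite wordM.
Qed.

Lemma wordT_inh t : sup (fun w => word_in w) (wordT t).
Proof.
apply: (@sup_ext _ _ _ (fun=> True)) => // s _.
rewrite /f_word; elim: (s : seq _) => [|x w IH].
  by rewrite big_nil -word_nil; apply: supU.
rewrite big_cons; apply: supM (iota_inh (valP x)).1 IH _ => u v uh vh.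
exact/inh_cat.
Qed.

Lemma br_inh u a b v : word_in (u ++ a :: b :: v) ->
  sup (fun w => word_in w) ([:w u] * iota (br (e a) (e b)) * [:w v]).
Proof.
move=> /inh_cat [uh] /= /and3P[ah bh vh].
apply: (@supM _ _ (fun w => word_in w) (fun w => word_in w)); last first.
- by move=> ? ? ? ?; apply/inh_cat.
- exact: supU.
apply: (@supM _ _ (fun w => word_in w) (fun w => word_in w)); last first.
- by move=> ? ? ? ?; apply/inh_cat.
- exact: (iota_inh (h_br ah bh)).1.
- exact: supU.
Qed.

Lemma swap_inh u a b v : word_in (u ++ a :: b :: v) -> word_in (u ++ b :: a :: v).
Proof.
move=> /inh_cat [uh] /= /and3P[ah bh vh]; apply/inh_cat; split=> //.
by rewrite /word_in /= ah bh.
Qed.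

Lemma nf1_inh w : word_in w -> sup (fun w => word_in w /\ normalw w) (nf1 eps br le e dg iota w).
Proof.
move=> wh; have X := sup_nf1 (P := word_in) (ob_two H) (ob_three H) (ob_br H) (ob_total H) (ob_gr H) (ob_span H)
  (ob_iota H) swap_inh br_inh wh.
exact: X.
Qed.

(** Each reduction is an identity of the enveloping algebra, whence normal words span it. In the odd
    case the identity is 2 a a = [a, a] divided by 2. *)
Lemma ofFA_red1 w : word_in w -> ofFA (red1 eps br le e dg iota w) = ofFA [:w w].
Proof.
rewrite /red1; case E: (red _ w) => [[[[u a] b] v]|] //.
have [-> ab _] := redP E => wh.
have [uh /and3P[ah bh vh]] := (inh_cat _ _).1 wh.
have brE c d : e c \in h -> e d \in h -> ofFA ([:w u] * iota (br (e c) (e d)) * [:w v]) =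
    ofFA [:w u] * inl (br (e c) (e d)) * ofFA [:w v].
  by move=> ch dh; rewrite !ofFA_M (iota_inh (h_br ch dh)).2.
have wE c d : ofFA [:w u ++ c :: d :: v] = ofFA [:w u] * (inl (e c) * inl (e d)) * ofFA [:w v].
  by rewrite !ofFA_word big_cat !big_cons /= !mulrA.
have := inl_br ah bh (ob_gr H a) (ob_gr H b).
rewrite wE; case: eqP => [eab|_] R.
  rewrite linearZ /= brE // -eab.
  have odd : eps (dg a) (dg a) = -1.
    by move: ab; rewrite -eab /bad /gt; have /orP[->|->] := ob_total H a a;
      rewrite eqxx => /eqP.
  rewrite -eab odd scaleN1r addrC in R; move/eqP: R; rewrite eq_sym subr_eq => /eqP ->.
  rewrite mulrDr mulrDl -mulr2n -scaler_nat scalerA mulVf ?scale1r //.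
  exact: ob_two H.
rewrite linearD linearZ /= brE // wE R mulrDr mulrDl.
by rewrite -env_scalerAr -env_scalerAl.
Qed.

Lemma red1_inh w : word_in w -> sup (fun w => word_in w) (red1 eps br le e dg iota w).
Proof.
rewrite /red1; case E: (red _ w) => [[[[u a] b] v]|] // wh; last exact: supU.
have [wE ab _] := redP E; rewrite wE in wh.
have [uh /and3P[ah bh vh]] := (inh_cat _ _).1 wh.
have abh c d : e c \in h -> e d \in h ->
    sup (fun w => word_in w) ([:w u] * iota (br (e c) (e d)) * [:w v]).
  by move=> ch dh; apply: br_inh; apply/inh_cat; rewrite /word_in /= ch dh.
case: eqP => _; first by apply: supZ; apply: abh.
apply: supD; last exact: abh.
by apply: supZ; apply: supU; apply: swap_inh.
Qed.

Lemma ofFA_nf1 w : word_in w -> ofFA (nf1 eps br le e dg iota w) = ofFA [:w w].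
Proof.
elim/(nf_ind (ob_two H) (ob_three H) (le := le)): w => w IH wh.
have X := nf1_red (ob_two H) (ob_three H) (ob_br H) (ob_total H) (ob_gr H) (ob_span H) (ob_iota H).
have Y := red1_mu (ob_br H) (ob_total H) (ob_gr H) (ob_span H) (ob_iota H).
have [E|E] := eqVneq (red (bad eps le dg) w) None; first by rewrite nf1_normal.
rewrite X -(ofFA_red1 wh).
apply: (linear_eq_sup (f := fun p => ofFA (nf p)) (P := fun w' => word_in w' /\ (mu le w' < mu le w)%N)).
- by move=> c p q; rewrite linearP; apply: ofFAP.
- exact: ofFAP.
- by move=> w' ww; split; [apply: red1_inh ww|apply: Y ww].
- by move=> w' [wh' w'w]; rewrite malg_extU IH.
Qed.

Lemma ofFA_nf p : sup (fun w => word_in w) p -> ofFA (nf p) = ofFA p.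
Proof.
move=> ph; apply: (linear_eq_sup (f := fun p => ofFA (nf p)) _ ofFAP ph).
- by move=> c q r; rewrite linearP; apply: ofFAP.
- by move=> w wh; rewrite malg_extU ofFA_nf1.
Qed.

Lemma nf_inh p : sup (fun w => word_in w) p -> sup (fun w => word_in w /\ normalw w) (nf p).
Proof. by move=> ph; apply: sup_ext ph _ => w; apply: nf1_inh. Qed.

Lemma toFA_inh u : sup (fun w => word_in w /\ normalw w) (toFA u).
Proof. by apply: nf_inh; apply: wordT_inh. Qed.

Lemma toFAK u : ofFA (toFA u) = u.
Proof. by rewrite /toFA ofFA_nf ?ofFA_wordT ?lreprK //; apply: wordT_inh. Qed.

Lemma inh_letters w : word_in w -> exists s : word (letter h),
  ofFA [:w w] = pi [:w s] /\ wordT [:w s] = [:w w].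
Proof.
elim: w => [|a w IH]; first by exists [::]; rewrite ofFA_word big_nil malg_extU /f_word big_nil.
move=> /andP[ah /IH[s [s1 s2]]]; exists (letterS ah :: s).
rewrite -[_ :: s]cat1s -[a :: w]cat1s -!wordM ofFA_M s1 wordTM s2 malg_extU /f_word big_seq1.
rewrite (ob_iota H) -env_piX; split=> //; congr (_ * _).
by rewrite ofFA_word big_seq1 -[e a]/(val (letterS ah)) inlE.
Qed.

(** When p is supported on normal words, [nf p] is p, and the equation expresses the linear
    independence of the normal words. *)
Lemma ofFAK p : sup (fun w => word_in w) p -> toFA (ofFA p) = nf p.
Proof.
move=> ph; apply: (linear_eq_sup (f := fun p => toFA (ofFA p)) _ _ ph).
- by move=> c q r; rewrite ofFAP; apply: toFA_linear.
- exact: linearP.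
- by move=> w /inh_letters [s [s1 s2]]; rewrite s1 toFA_pi s2.
Qed.
End Env.

Lemma lspan_sum (K : fieldType) (V : lmodType K) (S : set V) (I : eqType) (r : seq I)
    (c : I -> K) (F : I -> V) :
  (forall i, i \in r -> c i != 0 -> S (F i)) -> lspan_spec S (\sum_(i <- r) c i *: F i).
Proof.
elim: r => [|i r IH] h; first by rewrite big_nil; constructor.
rewrite big_cons; have IH' : lspan_spec S (\sum_(j <- r) c j *: F j).
  by apply: IH => j jr; apply: h; rewrite inE jr orbT.
have [->|ci] := eqVneq (c i) 0; first by rewrite scale0r add0r.
by apply: lspan_step => //; apply: h; rewrite ?inE ?eqxx.
Qed.

(** * Coordinates in a homogeneous basis and the order on letters *)

Section Basis.
Context (K : fieldType) (Gam : zmodType) (eps : Gam -> Gam -> K).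
Hypothesis heps : commutation_factor eps.
Context (g : zqColorLie eps).
Context (A : choiceType) (e e' : A -> g) (dg : A -> int * Gam).
Hypotheses (he : is_homogeneous_basis e dg) (he' : is_dual_basis e e').

Local Notation co x a := (form x (e' a)).

Lemma coD c x y a : co (c *: x + y) a = c * co x a + co y a.
Proof. exact: form_linearl. Qed.
Lemma co0 a : co 0 a = 0.
Proof. by have := coD (-1) 0 0 a; rewrite scaler0 addr0 mulN1r addNr. Qed.
Lemma coZ c x a : co (c *: x) a = c * co x a.
Proof. by have := coD c x 0 a; rewrite addr0 co0 addr0. Qed.
Lemma co_sum (I : Type) (r : seq I) (F : I -> g) a :
  co (\sum_(i <- r) F i) a = \sum_(i <- r) co (F i) a.
Proof.
elim: r => [|i r IH]; first by rewrite !big_nil co0.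
by rewrite !big_cons -IH -[F i in LHS]scale1r coD mul1r.
Qed.
Lemma co_e a b : co (e a) b = (a == b)%:R. Proof. exact: he'. Qed.

Lemma sum_delta (W : lmodType K) (E : {fset A}) (c : K) b (F : A -> W) : b \in E ->
  \sum_(a <- E) (c * (b == a)%:R) *: F a = c *: F b.
Proof.
move=> bE; rewrite (big_fsetD1 b bE) /= eqxx mulr1 big1_seq ?addr0 // => a /andP[_].
by rewrite !inE eq_sym => /andP[/negPf -> _]; rewrite mulr0 scale0r.
Qed.

(** The coordinates of x are its pairings with the dual basis. Allowing every larger finite index
    set in the second clause makes it possible to expand several elements over a common one. *)
Lemma basis_expand x : exists2 E : {fset A}, forall a, co x a != 0 -> a \in E &
  forall E' : {fset A}, (forall a, co x a != 0 -> a \in E') ->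
    x = \sum_(a <- E') co x a *: e a.
Proof.
have [_ sp _] := he; suff [E h1 h2] : exists2 E : {fset A}, (forall a, co x a != 0 -> a \in E) &
    x = \sum_(a <- E) co x a *: e a.
  exists E => // E' h'; rewrite {1}h2.
  have k (E1 E2 : {fset A}) : (forall a, co x a != 0 -> a \in E1) ->
      \sum_(a <- E1) co x a *: e a = \sum_(a <- (E1 `|` E2)%fset) co x a *: e a.
    move=> hh; apply: big_fset_incl; first exact: fsubsetUl.
    by move=> a _ aE; apply/eqP; rewrite scaler_eq0; apply/orP; left; apply: contraNT aE => /hh.
  by rewrite (k E E' h1) (k E' E h') fsetUC.
have := sp x; move/lspanP; elim=> [|c y v [b _ <-] _ [E h1 h2]].
  by exists fset0 => [a|]; rewrite ?big_seq_fset0 ?co0 ?eqxx.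
exists (b |` E)%fset => [a|].
  rewrite coD co_e !inE; have [//|ab] := eqVneq b a.
  by rewrite mulr0 add0r => /h1 ->; rewrite orbT.
have -> : \sum_(a <- (b |` E)%fset) co (c *: e b + v) a *: e a =
   \sum_(a <- (b |` E)%fset) (c * (b == a)%:R) *: e a +
   \sum_(a <- (b |` E)%fset) co v a *: e a.
  by rewrite -big_split; apply: eq_bigr => a _; rewrite coD co_e scalerDl.
rewrite sum_delta ?inE ?eqxx //; congr (_ + _); rewrite {1}h2.
apply: big_fset_incl; first exact: fsubsetUr.
by move=> a _ aE; apply/eqP; rewrite scaler_eq0; apply/orP; left; apply: contraNT aE => /h1.
Qed.

Lemma co_eq0 x : (forall a, co x a = 0) -> x = 0.
Proof.
move=> h; have [E _ hE] := basis_expand x.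
rewrite (hE fset0) ?big_seq_fset0 // => a; by rewrite h eqxx.
Qed.

Section Graded.
Context (I : choiceType) (P : I -> {pred g}) (d : A -> I).
Hypothesis (hP : is_direct_sum P).
Hypothesis (eP : forall a, e a \in P (d a)).

(** Projecting the expansion of x to the i-th summand fixes x and removes all basis elements of
    another degree. *)
Lemma co_homog i x a : x \in P i -> co x a != 0 -> d a = i.
Proof.
move=> xi; apply: contraNeq => dai; have [E h1 /(_ _ h1) h2] := basis_expand x.
rewrite -(component_id hP xi) h2 (component_big hP) co_sum big1 // => b _.
rewrite (componentZ hP) coZ (component_hom hP i (eP b)).
have [ib|_] := eqVneq i (d b); last by rewrite co0 mulr0.
by rewrite co_e; case: eqP => [ba|_]; rewrite ?mulr0 // -ba ib eqxx in dai *.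
Qed.

Lemma homog_span i x : x \in P i -> lspan_spec [set y | exists2 a, d a = i & y = e a] x.
Proof.
move=> xi; have [E h1 /(_ _ h1) h2] := basis_expand x.
by rewrite h2; apply: lspan_sum => a _ ca; exists a => //; apply: co_homog xi ca.
Qed.
End Graded.

Lemma e_zq a : e a \in zq_gr (dg a).1.
Proof. by have [/(_ a)/andP[]] := he. Qed.
Lemma e_cl a : e a \in cl_gr (dg a).2.
Proof. by have [/(_ a)/andP[]] := he. Qed.

Definition iota (x : g) : {malg K[word A]} :=
  \sum_(a \in [set: A]) co x a *: [:w [:: a]].

Lemma iotaE x (E : {fset A}) : (forall a, co x a != 0 -> a \in E) ->
  iota x = \sum_(a <- E) co x a *: [:w [:: a]].
Proof.
move=> h; apply: fsum_fset => a; apply: contraNT => /(contraNN (h a)).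
by rewrite negbK => /eqP ->; rewrite scale0r.
Qed.

Lemma iota_linear : linear iota.
Proof.
move=> c x y; have [E hE _] := basis_expand x; have [F hF _] := basis_expand y.
have hx a : co x a != 0 -> a \in (E `|` F)%fset by move=> /hE; rewrite inE => ->.
have hy a : co y a != 0 -> a \in (E `|` F)%fset by move=> /hF; rewrite inE orbC => ->.
rewrite (iotaE hx) (iotaE hy) (@iotaE _ (E `|` F)%fset); last first.
  move=> a; rewrite coD; apply: contraNT => aEF.
  have /eqP -> : co x a == 0 by apply: contraNT aEF => /hx.
  have /eqP -> : co y a == 0 by apply: contraNT aEF => /hy.
  by rewrite mulr0 addr0.
rewrite scaler_sumr -big_split; apply: eq_bigr => a _.
by rewrite coD scalerDl scalerA.
Qed.

Lemma iota_e a : iota (e a) = [:w [:: a]].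
Proof.
rewrite (@iotaE _ [fset a]%fset); last first.
  by move=> b; rewrite co_e inE eq_sym; have [//|_] := eqVneq b a; rewrite eqxx.
by rewrite big_seq_fset1 co_e eqxx scale1r.
Qed.

(* Letters of nonpositive degree precede those of positive degree, so that a
   sorted word is a word in g_- followed by a word in g_+. *)
Definition pos a := 0 < (dg a).1.
Definition wo : rel A := sval (well_ordering_principle A).
Definition wle : rel A := fun a b => (~~ pos a && pos b) || ((pos a == pos b) && wo a b).

Lemma wo_order : [/\ total wo, antisymmetric wo & transitive wo].
Proof.
have wo_wo : well_order wo := svalP (well_ordering_principle A).
have ch : wo_chain wo predT by exact: withinW.
have tot : total wo by move=> x y; apply: (wo_chainW ch).
have anti : antisymmetric wo by move=> x y; apply: (wo_chain_antisymmetric ch).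
split=> // y x z xy yz.
(* Transitivity is obtained from the least element of {x, y, z}, combined with antisymmetry. *)
have [|m [[mxyz hm] _]] := wo_wo [pred t | (t == x) || (t == y) || (t == z)].
  by exists x; rewrite inE eqxx.
have mx : wo m x by apply: hm; rewrite inE eqxx.
have my : wo m y by apply: hm; rewrite inE eqxx orbT.
have mz : wo m z by apply: hm; rewrite inE eqxx orbT.
move: mxyz; rewrite inE -orbA => /or3P[] /eqP E.
- by rewrite -E.
- by rewrite (anti x y) // xy -E.
- by rewrite -(anti y z) // yz -E.
Qed.

Lemma wle_total : total wle.
Proof.
have [t _ _] := wo_order; move=> a b; have := t a b.
by rewrite /wle [pos b == _]eq_sym; case: (pos a) (pos b) => [] [].
Qed.
Lemma wle_anti : antisymmetric wle.
Proof.
have [_ t _] := wo_order; move=> a b; have := t a b.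
by rewrite /wle; case: (pos a) (pos b) => [] [].
Qed.
Lemma wle_trans : transitive wle.
Proof.
have [_ _ t] := wo_order; move=> b a c; have := t b a c.
by rewrite /wle; case: (pos a) (pos b) (pos c) => [] [] [] //= h; rewrite ?andbF ?orbF //; apply: h.
Qed.
End Basis.

(** * Normal ordering *)

Lemma red_sorted (A : eqType) (bad : rel A) w :
  red bad w = None <-> sorted (fun a b => ~~ bad a b) w.
Proof.
elim: w => [|a [|b w] IH] //; rewrite red_cons; move: (red bad (b :: w)) IH => r IH /=.
case: (bad a b) => /=; first by split.
rewrite -[path _ _ _]/(sorted (fun a b => ~~ bad a b) (b :: w)) -IH.
by case: r {IH} => [q|] /=; split.
Qed.

Section TensorTheory.
Context (K : fieldType) (U W : lmodType K).

Lemma tens_linl (w : W) : linear (fun u : U => tens u w).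
Proof.
move=> c u u'; rewrite /tens -lpi_scalable -raddfD; apply/lpiP/mem_lspan.
exact: tensor_relL.
Qed.
Lemma tens_linr (u : U) : linear (@tens K U W u).
Proof.
move=> c w w'; rewrite /tens -lpi_scalable -raddfD; apply/lpiP/mem_lspan.
exact: tensor_relR.
Qed.

Lemma linear_tens0 (Z : lmodType K) (f : tensor U W -> Z) t : linear f ->
  (forall u w, f (tens u w) = 0) -> f t = 0.
Proof.
move=> lf h; rewrite -[t]lreprK.
apply: (linear_word0 (f := fun s => f (lpi (@tensor_rel K U W) s))) => [c p q|[u w]]; last exact: h.
rewrite raddfD /= lpi_scalable; exact: lf.
Qed.

Lemma linear_eq_tens (Z : lmodType K) (f h : tensor U W -> Z) t :
  linear f -> linear h -> (forall u w, f (tens u w) = h (tens u w)) -> f t = h t.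
Proof.
move=> lf lh fh; apply/eqP; rewrite -subr_eq0; apply/eqP.
apply: (linear_tens0 (f := fun t => f t - h t)) => [c p q|u v].
  by rewrite lf lh scalerBr opprD addrACA.
by rewrite fh subrr.
Qed.
End TensorTheory.

Section NormalOrder.
Context (K : fieldType) (charK : forall n, n.+1%:R != 0 :> K).
Context (Gam : zmodType) (eps : Gam -> Gam -> K).
Hypothesis heps : commutation_factor eps.
Context (g : zqColorLie eps).
Context (A : choiceType) (e e' : A -> g) (dg : A -> int * Gam).
Hypotheses (he : is_homogeneous_basis e dg) (he' : is_dual_basis e e').
Context (br : g -> g -> g).
Hypothesis hbr : color_bracket eps (@cl_gr _ _ _ g) br.
Hypothesis br_zq : forall i j x y, x \in zq_gr i -> y \in zq_gr j -> br x y \in zq_gr (i + j).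

Local Notation cdg := (fun a => (dg a).2).
Local Notation le := (wle dg).
Definition iotal : {linear g -> {malg K[word A]}} :=
  HB.pack (iota e') (GRing.isLinear.Build K g {malg K[word A]} *:%R _ (iota_linear he he')).

Lemma obasis : ordered_basis eps (@cl_gr _ _ _ g) br le e cdg iotal.
Proof.
split=> //.
- exact: wle_total.
- exact: wle_anti.
- exact: wle_trans.
- exact: (e_cl he).
- exact: (homog_span he he' (@cl_direct _ _ _ g) (e_cl he)).
- exact: (iota_e he').
Qed.

(** A common form of [gneg] and [gpos], so that closure under the bracket and the adapted spanning
    sets are proved once. *)
Definition gsub (Q : int -> Prop) : {pred g} :=
  lspan [set x | exists2 i, Q i & x \in zq_gr i].

Section Gsub.
Variable Q : int -> Prop.
Lemma gsub_closed : GRing.submod_closed (gsub Q).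
Proof. by split=> [|c x y xh yh]; rewrite ?rpred0 // rpredD // rpredZ. Qed.

Lemma gsub_zq i x : Q i -> x \in zq_gr i -> x \in gsub Q.
Proof. by move=> Qi xi; apply: mem_lspan; exists i. Qed.

Lemma gsub_br : (forall i j, Q i -> Q j -> Q (i + j)) ->
  forall x y, x \in gsub Q -> y \in gsub Q -> br x y \in gsub Q.
Proof.
move=> QD x y /lspanP; elim=> [|c z v [i Qi zi] _ IH] yh.
  have -> : br 0 y = 0; last by rewrite rpred0.
  have := cb_linl hbr y (-1) 0 0; rewrite scaler0 addr0 scaleN1r => ->; exact: addNr.
rewrite (cb_linl hbr) rpredD ?IH ?rpredZ //.
move/lspanP: yh; elim=> [|d t w [j Qj tj] _ IHy].
  have -> : br z 0 = 0; last by rewrite rpred0.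
  have := cb_linr hbr z (-1) 0 0; rewrite scaler0 addr0 scaleN1r => ->; exact: addNr.
rewrite (cb_linr hbr) rpredD ?rpredZ //.
by apply: gsub_zq (QD _ _ Qi Qj) _; apply: br_zq.
Qed.

Lemma gsub_co x a : x \in gsub Q -> form x (e' a) != 0 -> Q (dg a).1.
Proof.
move=> /lspanP; elim=> [|c y v [i Qi yi] _ IH]; first by rewrite (co0 e') eqxx.
rewrite (coD e'); have [E|ya] := eqVneq (form y (e' a)) 0.
  by rewrite E mulr0 add0r => /IH.
by rewrite (co_homog he he' (@zq_direct _ _ _ g) (e_zq he) yi ya).
Qed.

Lemma e_gsub a : e a \in gsub Q <-> Q (dg a).1.
Proof.
split=> [h|Qa]; last exact: gsub_zq Qa (e_zq he a).
by apply: gsub_co h _; rewrite he' eqxx oner_eq0.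
Qed.

Lemma gsub_span x : x \in gsub Q -> lspan_spec [set y | exists2 a, e a \in gsub Q & y = e a] x.
Proof.
move=> xh; have [E h1 /(_ _ h1) ->] := basis_expand he he' x.
apply: lspan_sum => a _ ca; exists a => //; apply/e_gsub.
exact: gsub_co xh ca.
Qed.
End Gsub.

Local Notation F := (env eps (@cl_gr _ _ _ g) br).
Local Notation FA := {malg K[word A]}.
Local Notation gn := (@gneg _ _ _ g).
Local Notation gp := (@gpos _ _ _ g).
Local Notation ga := (@gall _ _ _ g).

Definition neg_sub : GRing.submod_closed gn := gsub_closed _.
Definition pos_sub : GRing.submod_closed gp := gsub_closed _.
Lemma all_sub : GRing.submod_closed ga. Proof. by split. Qed.
Lemma neg_br x y : x \in gn -> y \in gn -> br x y \in gn.
Proof. by apply: gsub_br => i j *; lia. Qed.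
Lemma pos_br x y : x \in gp -> y \in gp -> br x y \in gp.
Proof. by apply: gsub_br => i j *; lia. Qed.
Lemma all_br x y : x \in ga -> y \in ga -> br x y \in ga.
Proof. by []. Qed.
Lemma neg_span x : x \in gn -> lspan_spec [set y | exists2 a, e a \in gn & y = e a] x.
Proof. exact: gsub_span. Qed.
Lemma pos_span x : x \in gp -> lspan_spec [set y | exists2 a, e a \in gp & y = e a] x.
Proof. exact: gsub_span. Qed.
Lemma all_span x : x \in ga -> lspan_spec [set y | exists2 a, e a \in ga & y = e a] x.
Proof.
move=> _; have [E h1 /(_ _ h1) ->] := basis_expand he he' x.
by apply: lspan_sum => a _ ca; exists a.
Qed.
Lemma e_neg a : (e a \in gn) = ~~ pos dg a.
Proof.
rewrite /pos -leNgt; apply/idP/idP => [/(e_gsub (fun i => i <= 0) a)//|h].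
exact/(e_gsub (fun i => i <= 0) a).
Qed.
Lemma e_pos a : (e a \in gp) = pos dg a.
Proof.
by apply/idP/idP => [/(e_gsub (fun i => 0 < i) a)//|h]; apply/(e_gsub (fun i => 0 < i) a).
Qed.

Local Notation toN := (@toFA K Gam eps g (@cl_gr _ _ _ g) br A le e cdg iotal gn).
Local Notation toP := (@toFA K Gam eps g (@cl_gr _ _ _ g) br A le e cdg iotal gp).
Local Notation toA := (@toFA K Gam eps g (@cl_gr _ _ _ g) br A le e cdg iotal ga).
Local Notation ofh h := (@ofFA K Gam eps g (@cl_gr _ _ _ g) br A e h).
Local Notation normalw := (normal_word eps le cdg).
Local Notation inh h := (word_in e h).

Local Notation inclh h := (@env_incl K Gam eps g br h).
Local Notation incl := (@env_incl K Gam eps g br _).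

Lemma inclP h : [/\ linear (inclh h), incl (1 : F h) = 1,
  forall u v : F h, incl (u * v) = incl u * incl v &
  forall x : letter h, incl (env_in eps (@cl_gr _ _ _ g) br x) =
     env_in eps (@cl_gr _ _ _ g) br (full_letter (val x))].
Proof.
apply: env_liftP => [c x y z E|a b x y z xa yb E].
  by apply: env_in_lin.
apply/eqP; rewrite subr_eq; apply/eqP.
rewrite [RHS]addrC; apply: (env_in_br (x := full_letter (val x)) (y := full_letter (val y))
  (z := full_letter (val z)) eps xa yb E).
Qed.

Lemma incl_inl h (x : g) : x \in h ->
  incl (inl eps (@cl_gr _ _ _ g) br h x) = inl eps (@cl_gr _ _ _ g) br ga x.
Proof.
move=> xh; have [_ _ _ iE] := inclP h.
have E : inl eps (@cl_gr _ _ _ g) br h x = env_in eps (@cl_gr _ _ _ g) br (letterS xh).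
  exact: (inlE eps (@cl_gr _ _ _ g) br (letterS xh)).
rewrite E iE; apply: esym; exact: (inlE eps (@cl_gr _ _ _ g) br (full_letter x)).
Qed.

Lemma incl_ofFA h p : GRing.submod_closed h -> sup (fun w => inh h w) p ->
  incl (ofh h p) = ofh ga p.
Proof.
move=> hsub ph; have [il i1 iM iE] := inclP h.
apply: (linear_eq_sup (f := fun p => incl (ofh h p)) (h := fun p => ofh ga p) _ _ ph).
- by move=> c q r; rewrite ofFAP; apply: il.
- exact: ofFAP.
move=> w wh.
rewrite !ofFA_word; elim: w wh => [|a w IH]; first by rewrite !big_nil.
move=> /andP[ah wh]; rewrite big_cons iM (IH wh) (incl_inl ah) [RHS]big_cons.
reflexivity.
Qed.
Lemma inclM h (u v : F h) : incl (u * v) = incl u * incl v.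
Proof. by have [_ _ ->] := inclP h. Qed.
Lemma incl_lin h : linear (inclh h).
Proof. by have [] := inclP h. Qed.

Definition negw (w : word A) : Prop := all (fun a => ~~ pos dg a) w.
Definition posw (w : word A) : Prop := all (pos dg) w.

Lemma negwE w : negw w <-> inh gn w.
Proof. by rewrite /negw /word_in; under [in X in _ <-> X]eq_all => a do rewrite e_neg. Qed.
Lemma poswE w : posw w <-> inh gp w.
Proof. by rewrite /posw /word_in; under [in X in _ <-> X]eq_all => a do rewrite e_pos. Qed.

(** At the junction a letter of g_- is followed by one of g_+, which is neither an inversion nor a
    repetition. *)
Lemma normalw_cat u v : negw u -> posw v -> normalw u -> normalw v -> normalw (u ++ v).
Proof.
rewrite /normal_word !red_sorted; elim: u => [|a u IH] // /andP[an un] vp au vn.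
case: u un IH au => [|b u] un IH au.
  case: v vp vn {IH} => [|b v] //= /andP[bp _] ->; rewrite andbT.
  rewrite /bad /gt /wle an bp /=; apply: contraL bp => /andP[/eqP <- _]; exact: an.
by move: au => /= /andP[-> h] /=; apply: IH.
Qed.

Lemma normalw_split (w : word A) : normalw w ->
  exists u v : word A, [/\ w = u ++ v, negw u & posw v].
Proof.
rewrite /normal_word red_sorted; elim: w => [|a w IH] //=; first by exists [::], [::].
move=> aw; have [u [v [wE un vp]]] := IH (path_sorted aw).
have [an|ap] := boolP (~~ pos dg a); first by exists (a :: u), v; rewrite wE /negw /= an.
rewrite negbK in ap; case: u wE un => [|b u] wE un.
  by exists [::], (a :: v); rewrite wE /posw /= ap.
move: aw un; rewrite wE /= => /andP[nb _] /andP[bn _].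
by move: nb; rewrite /bad /gt /wle ap (negPf bn).
Qed.

(** Filtering is a total substitute for cutting a word at the boundary between g_- and g_+. The two
    agree on normal words, the only ones for which the value is meaningful. *)
Definition psi1 (w : word A) : normal br :=
  tens (ofh gn [:w filter (fun a => ~~ pos dg a) w]) (ofh gp [:w filter (pos dg) w]).
Definition Psi : FA -> normal br := malg_ext psi1.
Definition Phi (t : normal br) : FA := toA (normal_mul t).

Lemma Psi_linear : linear Psi. Proof. exact: malg_ext_linear. Qed.

Lemma psi1_cat (u v : word A) : negw u -> posw v ->
  psi1 (u ++ v) = tens (ofh gn [:w u]) (ofh gp [:w v]).
Proof.
move=> un vp.
have E1 : filter (fun a => ~~ pos dg a) (u ++ v) = u.
  rewrite filter_cat; move/all_filterP: un => ->; rewrite (_ : filter _ v = [::]) ?cats0 //.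
  apply/eqP; rewrite -[_ == _]negbK -has_filter -all_predC.
  by apply: sub_all vp => a /=; rewrite negbK.
have E2 : filter (pos dg) (u ++ v) = v.
  rewrite filter_cat; move/all_filterP: vp => ->; rewrite (_ : filter _ u = [::]) //.
  by apply/eqP; rewrite -[_ == _]negbK -has_filter -all_predC.
by rewrite /psi1 E1 E2.
Qed.

Lemma Psi_mul p q : sup negw p -> sup posw q -> Psi (p * q) = tens (ofh gn p) (ofh gp q).
Proof.
move=> pn qp; apply: (linear_eq_sup (f := fun p => Psi (p * q))
  (h := fun p => tens (ofh gn p) (ofh gp q)) _ _ pn) => [c r s|c r s|u un].
- by rewrite mulrDl -scalerAl; apply: Psi_linear.
- by rewrite ofFAP; apply: tens_linl.
apply: (linear_eq_sup (f := fun q => Psi ([:w u] * q))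
  (h := fun q => tens (ofh gn [:w u]) (ofh gp q)) _ _ qp) => [c r s|c r s|v vp].
- by rewrite mulrDr -free_scalerAr; apply: Psi_linear.
- by rewrite ofFAP; apply: tens_linr.
by rewrite wordM /Psi malg_extU psi1_cat.
Qed.

Lemma normal_mulP : linear (@normal_mul _ _ _ _ br) /\ 
  forall u v, normal_mul (tens u v : normal br) = incl u * incl v.
Proof.
apply: tensor_liftP => [w c u v|u c v w]; first by rewrite incl_lin mulrDl -env_scalerAl.
by rewrite incl_lin mulrDr -env_scalerAr.
Qed.

Lemma toN_sup u : sup (fun w => negw w /\ normalw w) (toN u).
Proof.
by apply: supW _ (toFA_inh obasis neg_sub neg_br neg_span (u := u)) => w [/negwE].
Qed.
Lemma toP_sup u : sup (fun w => posw w /\ normalw w) (toP u).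
Proof.
by apply: supW _ (toFA_inh obasis pos_sub pos_br pos_span (u := u)) => w [/poswE].
Qed.
Lemma toA_sup u : sup (fun w => normalw w) (toA u).
Proof.
by apply: supW _ (toFA_inh obasis all_sub all_br all_span (u := u)) => w [].
Qed.
Lemma toNK u : ofh gn (toN u) = u.
Proof. exact: (toFAK obasis neg_sub neg_br neg_span u). Qed.
Lemma toPK u : ofh gp (toP u) = u.
Proof. exact: (toFAK obasis pos_sub pos_br pos_span u). Qed.
Lemma toAK u : ofh ga (toA u) = u.
Proof. exact: (toFAK obasis all_sub all_br all_span u). Qed.
Lemma inh_all w : inh ga w. Proof. by rewrite /word_in; apply/allP. Qed.
Lemma ofAK p : toA (ofh ga p) = malg_ext (nf1 eps br le e cdg iotal) p.
Proof. by apply: (ofFAK obasis) => w _; apply: inh_all. Qed.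
Lemma ofAK_normal p : sup (fun w => normalw w) p -> toA (ofh ga p) = p.
Proof. by move=> pn; rewrite ofAK nf_normal. Qed.

Lemma normal_mul_tens u v : normal_mul (tens u v : normal br) = ofh ga (toN u * toP v).
Proof.
rewrite normal_mulP.2 -[u in LHS]toNK -[v in LHS]toPK !incl_ofFA ?ofFA_M //.
- exact: pos_sub.
- by apply: supW _ (@toP_sup v) => w [/poswE].
- exact: neg_sub.
- by apply: supW _ (@toN_sup u) => w [/negwE].
Qed.

Lemma Phi_tens u v : Phi (tens u v) = toN u * toP v.
Proof.
rewrite /Phi normal_mul_tens ofAK_normal //.
apply: supM (@toN_sup u) (@toP_sup v) _ => w w' [wn wnn] [w'p w'n].
exact: normalw_cat.
Qed.

Lemma Phi_linear : linear Phi.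
Proof. by move=> c s t; rewrite /Phi normal_mulP.1 toFA_linear //; apply: obasis. Qed.

Lemma PhiK t : Psi (Phi t) = t.
Proof.
apply: (linear_eq_tens (f := fun t => Psi (Phi t)) (h := id)) => [c p q|c p q|u v] //.
  by rewrite Phi_linear; apply: Psi_linear.
rewrite Phi_tens Psi_mul ?toNK ?toPK //.
- by apply: supW _ (@toN_sup u) => w [].
- by apply: supW _ (@toP_sup v) => w [].
Qed.

Lemma normal_mul_Psi p : sup (fun w => normalw w) p -> normal_mul (Psi p) = ofh ga p.
Proof.
move=> pn; apply: (linear_eq_sup (f := fun p => normal_mul (Psi p)) (h := ofh ga) _ _ pn).
- by move=> c r s; rewrite Psi_linear; apply: normal_mulP.1.
- exact: ofFAP.
move=> w /normalw_split [u [v [-> un vp]]].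
rewrite /Psi malg_extU psi1_cat // normal_mulP.2 !incl_ofFA; first last.
- by apply: supU; apply/negwE.
- exact: neg_sub.
- by apply: supU; apply/poswE.
- exact: pos_sub.
by rewrite -ofFA_M wordM.
Qed.

Lemma PsiK p : sup (fun w => normalw w) p -> Phi (Psi p) = p.
Proof. by move=> pn; rewrite /Phi normal_mul_Psi // ofAK_normal. Qed.

(* Poincare-Birkhoff-Witt in the form needed here: normal_mul is bijective. *)
Lemma normal_formE (u : F ga) : normal_form u = Psi (toA u).
Proof.
have E : normal_mul (Psi (toA u)) = u by rewrite normal_mul_Psi ?toAK //; apply: toA_sup.
rewrite /normal_form; case: xgetP => [t _ /= tE|/(_ _ E)//].
by rewrite -[t]PhiK /Phi tE.
Qed.

Lemma normal_mulK (t : normal br) : normal_form (normal_mul t) = t.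
Proof. by rewrite normal_formE -/(Phi t) PhiK. Qed.

Lemma normal_formK (u : F ga) : normal_mul (normal_form u) = u.
Proof. by rewrite normal_formE normal_mul_Psi ?toAK //; apply: toA_sup. Qed.

(** * Bidegrees, the decomposition of normal tensors and the filtration *)

Definition wdeg (w : word A) : int * Gam := \sum_(a <- (w : seq A)) dg a.
Definition pdeg (w : word A) : int := \sum_(a <- (w : seq A) | pos dg a) (dg a).1.
(** For a normal word this is the index of the summand of the completion that contains it: the total
    bidegree and the degree of the factor in F(g_+). *)
Definition wtype (w : word A) : int * Gam * nat := (wdeg w, `|pdeg w|%N).

Lemma wdeg_cat (u v : word A) : wdeg (u ++ v) = wdeg u + wdeg v.
Proof. exact: big_cat. Qed.
Lemma pdeg_cat (u v : word A) : pdeg (u ++ v) = pdeg u + pdeg v.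
Proof. exact: big_cat. Qed.
Lemma pdeg_ge0 w : 0 <= pdeg w.
Proof. by apply: sumr_ge0 => a /ltW. Qed.
Lemma wtypeE w : (wtype w).2%:Z = pdeg w.
Proof. by rewrite /wtype /= gez0_abs // pdeg_ge0. Qed.
Lemma pdeg_neg w : negw w -> pdeg w = 0.
Proof.
by move=> /allP wn; rewrite /pdeg big_seq_cond big1 // => a /andP[/wn /negPf ->].
Qed.
Lemma wdeg1 (w : word A) : (wdeg w).1 = \sum_(a <- (w : seq A)) (dg a).1.
Proof. by rewrite /wdeg (raddf_sum (fst : int * Gam -> int)). Qed.
Lemma pdeg_pos w : posw w -> pdeg w = (wdeg w).1.
Proof.
move=> /allP wp; rewrite wdeg1 /pdeg big_mkcond /=.
by apply: eq_big_seq => a /wp ->.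
Qed.
Lemma wdeg_le w : (wdeg w).1 <= pdeg w.
Proof.
rewrite wdeg1 /pdeg [leRHS]big_mkcond /=; apply: ler_sum => a _.
by rewrite /pos; case: ltP.
Qed.

Lemma iota_sup x : sup (fun w => exists2 c, form x (e' c) != 0 & w = [:: c]) (iota e' x).
Proof.
have [E hE _] := basis_expand he he' x; rewrite (iotaE hE); apply: sup_sum_seq => a _.
have [->|n] := eqVneq (form x (e' a)) 0; first by rewrite scale0r; apply: sup0.
by apply: supZ; apply: supU; exists a.
Qed.

Lemma co_dg d x c : x \in bihom d -> form x (e' c) != 0 -> dg c = d.
Proof.
move=> /andP[xz xc] n; rewrite [dg c]surjective_pairing [d]surjective_pairing; congr pair.
  exact: (co_homog he he' (d := fun a => (dg a).1) (@zq_direct _ _ _ g) (e_zq he) xz n).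
exact: (co_homog he he' (d := fun a => (dg a).2) (@cl_direct _ _ _ g) (e_cl he) xc n).
Qed.

Lemma e_bihom a : e a \in bihom (dg a).
Proof. by rewrite inE /= e_zq ?e_cl. Qed.

Lemma iota_bihom d x : x \in bihom d -> sup (fun w => wdeg w = d) (iota e' x).
Proof.
move=> xd; apply: supW _ (@iota_sup x) => w [c n ->].
by rewrite /wdeg big_seq1 (co_dg xd n).
Qed.

Lemma br_bihom d d' x y : x \in bihom d -> y \in bihom d' -> br x y \in bihom (d + d').
Proof.
move=> /andP[xz xc] /andP[yz yc]; rewrite inE /=.
by apply/andP; split; [apply: br_zq|apply: (cb_gr hbr)].
Qed.

Local Notation nf1 := (nf1 eps br le e cdg iotal).

Lemma nf1_wdeg w : sup (fun w' => wdeg w' = wdeg w) (nf1 w).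
Proof.
apply: supW _ (sup_nf1 (P := fun w' => wdeg w' = wdeg w) (charK 1) (charK 2) hbr
  (@wle_total _ _ dg) (e_cl he) (homog_span he he' (@cl_direct _ _ _ g) (e_cl he))
  (iota_e he' : forall a, iotal (e a) = [:w [:: a]]) _ _ _) => //.
- by move=> w' [].
- move=> u a b v <-; rewrite -![_ ++ _]/((u : word A) ++ _) !wdeg_cat /wdeg !big_cons.
  by congr (_ + _); rewrite addrCA.
- move=> u a b v <-.
  apply: (@supM _ _ (fun w' => wdeg w' = wdeg u + (dg a + dg b)) (fun w' => w' = v)).
  + apply: (@supM _ _ (fun w' => w' = u) (fun w' => wdeg w' = dg a + dg b)).
    * exact: supU.
    * by apply: iota_bihom; apply: br_bihom; apply: e_bihom.
    * by move=> _ w' -> w'E; rewrite wdeg_cat w'E.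
  + exact: supU.
  + move=> w' _ w'E ->; rewrite wdeg_cat w'E -addrA wdeg_cat; congr (_ + _).
    by rewrite /wdeg !big_cons addrA.
Qed.

Lemma nf_wdeg d p : sup (fun w => wdeg w = d) p -> sup (fun w => wdeg w = d) (malg_ext nf1 p).
Proof. by move=> pd; apply: sup_ext pd _ => w <-; apply: nf1_wdeg. Qed.

Section Sub.
Variables (h : {pred g}).
Hypotheses (h_sub : GRing.submod_closed h)
  (h_br : forall x y, x \in h -> y \in h -> br x y \in h)
  (h_span : forall x, x \in h -> lspan_spec [set y | exists2 a, e a \in h & y = e a] x).
Local Notation toh := (@toFA K Gam eps g (@cl_gr _ _ _ g) br A le e cdg iotal h).

Lemma prod_env_in k (x : 'I_k -> letter h) :
  \prod_(i < k) env_in eps (@cl_gr _ _ _ g) br (x i) = ofh h (\prod_(i < k) iotal (val (x i))).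
Proof.
elim/big_rec2: _ => [|i p u _ ->]; first by rewrite ofFA_1.
rewrite ofFA_M; congr (_ * _).
rewrite (iota_inh obasis h_sub h_span (valP (x i))).2.
by apply/esym; exact: (inlE eps (@cl_gr _ _ _ g) br (x i)).
Qed.

Lemma prod_iota_inh k (x : 'I_k -> letter h) :
  sup (fun w => inh h w) (\prod_(i < k) iotal (val (x i))).
Proof.
elim/big_ind: _ => [|p q ph qh|i _]; first exact: supU.
  by apply: supM ph qh _ => u v uh vh; apply/inh_cat.
exact: (iota_inh obasis h_sub h_span (valP (x i))).1.
Qed.

Lemma toFA_gr d u : u \in @env_gr _ _ _ _ br h d -> sup (fun w => wdeg w = d) (toh u).
Proof.
move=> /lspanP; elim=> [|c v u' [k [x [dx [xd <- ->]]]] _ IH].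
  have -> : toh 0 = 0; last exact: sup0.
  by apply: lin0; apply: toFA_linear; apply: obasis.
rewrite toFA_linear; last exact: obasis.
apply: supD IH; apply: supZ.
rewrite prod_env_in (ofFAK obasis); last exact: prod_iota_inh.
apply: nf_wdeg; apply: (big_rec2 (fun d p => sup (fun w => wdeg w = d) p)) => [|i d' p _ IHp].
  by apply: supU; rewrite /wdeg big_nil.
apply: (@supM _ _ (fun w => wdeg w = dx i) (fun w => wdeg w = d')).
- by apply: iota_bihom; apply: xd.
- exact: IHp.
- by move=> w w' wE w'E; rewrite wdeg_cat wE w'E.
Qed.

Lemma ofFA_gr w : inh h w -> ofh h [:w w] \in @env_gr _ _ _ _ br h (wdeg w).
Proof.
move=> wh; apply: mem_lspan.
have wi (i : 'I_(size w)) : e (tnth (in_tuple w) i) \in h.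
  by move/allP: wh; apply; apply: mem_tnth.
exists (size w), (fun i => letterS (wi i)), (fun i => dg (tnth (in_tuple w) i)).
split.
- by move=> i; apply: e_bihom.
- by rewrite /wdeg [RHS](big_tnth _ _ (w : seq A)).
- rewrite ofFA_word [LHS](big_tnth _ _ (w : seq A)); apply: eq_bigr => i _.
  exact: (inlE eps (@cl_gr _ _ _ g) br (letterS (wi i))).
Qed.
End Sub.

Local Notation ngr := (@normal_gr _ _ _ _ br).

Lemma Phi_gr p t : t \in ngr p -> sup (fun w => normalw w /\ wtype w = p) (Phi t).
Proof.
move=> /lspanP; elim=> [|c x t' [a [b [u [v [ab ua vb ->]]]]] _ IH].
  by rewrite (lin0 Phi_linear); apply: sup0.
rewrite Phi_linear; apply: supD IH; apply: supZ; rewrite Phi_tens.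
apply: (@supM _ _ (fun w => (negw w /\ normalw w) /\ wdeg w = (p.1.1 - p.2%:Z, a))
   (fun w => (posw w /\ normalw w) /\ wdeg w = (p.2%:Z, b))).
- move=> w wu; split; first exact: toN_sup wu.
  exact: (toFA_gr neg_sub neg_span ua wu).
- move=> w wv; split; first exact: toP_sup wv.
  exact: (toFA_gr pos_sub pos_span vb wv).
move=> w w' [[wn wnn] wd] [[w'p w'n] w'd]; split; first exact: normalw_cat.
rewrite /wtype wdeg_cat pdeg_cat pdeg_neg // pdeg_pos // wd w'd add0r /=.
case: p ab {ua vb wd w'd} => [[d1 d2] r] /= <-; congr (_, _); congr (_, _).
by rewrite /= subrK.
Qed.

Lemma Psi_gr w : normalw w -> Psi [:w w] \in ngr (wtype w).
Proof.
move=> /normalw_split [u [v [wE un vp]]].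
rewrite wE /Psi malg_extU psi1_cat //; apply: mem_lspan.
exists (wdeg u).2, (wdeg v).2, (ofh gn [:w u]), (ofh gp [:w v]).
have E : (wtype (u ++ v)).2%:Z = (wdeg v).1.
  by rewrite wtypeE pdeg_cat pdeg_neg // pdeg_pos // add0r.
split=> //.
- by rewrite /wtype wdeg_cat.
- rewrite E (_ : (_, _) = wdeg u); first by apply: ofFA_gr; apply/negwE.
  by rewrite /wtype /= wdeg_cat [RHS]surjective_pairing /= addrK.
- rewrite E (_ : (_, _) = wdeg v); first by apply: ofFA_gr; apply/poswE.
  by rewrite [RHS]surjective_pairing.
Qed.

Definition restr (k : int * Gam * nat) : FA -> FA :=
  malg_ext (fun w => if wtype w == k then [:w w] else 0).
Lemma restr_linear k : linear (restr k). Proof. exact: malg_ext_linear. Qed.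

Lemma restr_id k p : sup (fun w => wtype w = k) p -> restr k p = p.
Proof.
move=> pk; rewrite -[RHS]malg_ext_id; apply: eq_malg_ext_sup pk _ => w ->.
by rewrite eqxx.
Qed.
Lemma restr_0 k p : sup (fun w => wtype w <> k) p -> restr k p = 0.
Proof.
move=> pk; apply: (linear_sup0 (@restr_linear k) pk) => w wk.
by rewrite /restr malg_extU; case: eqP.
Qed.
Lemma restr_sup (Q : word A -> Prop) k p : sup Q p -> sup (fun w => Q w /\ wtype w = k) (restr k p).
Proof.
move=> pQ; apply: sup_ext pQ _ => w Qw; case: eqP => wk; last exact: sup0.
by apply: supU.
Qed.

Definition npr k t := Psi (restr k (Phi t)).

Lemma Phi_sup t : sup (fun w => normalw w) (Phi t).
Proof. exact: toA_sup. Qed.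

Lemma Psi_sum_gr k p : sup (fun w => normalw w /\ wtype w = k) p -> Psi p \in ngr k.
Proof.
move=> pk; rewrite /Psi /malg_ext big_seq; apply: rpred_sum => w wp.
have [wn <-] := pk _ wp; apply: rpredZ; have := Psi_gr wn.
by rewrite /Psi malg_extU.
Qed.

(** Under [Phi] the summand of index k becomes the span of the normal words of type k, so that the
    projection simply discards the words of other types. *)
Lemma normal_gr_direct : is_direct_sum ngr /\ forall k t, component ngr k t = npr k t.
Proof.
apply: direct_sum_proj.
- by move=> k; split=> [|c x y xk yk]; rewrite ?rpred0 // rpredD // rpredZ.
- by move=> k c x y; rewrite /npr Phi_linear restr_linear; apply: Psi_linear.
- by move=> k t; apply: Psi_sum_gr; apply: restr_sup; apply: Phi_sup.
- move=> k t /Phi_gr tk; rewrite /npr restr_id ?PhiK //.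
  by apply: supW _ tk => w [].
- move=> k l t /Phi_gr tk kl; rewrite /npr restr_0 ?(lin0 Psi_linear) //.
  by apply: supW _ tk => w [_ wk] wl; move: kl; rewrite -wl wk eqxx.
move=> t; pose E := [fset wtype w | w in msupp (Phi t)]%fset.
exists E => [k|].
  apply: contraNT => kE; rewrite /npr restr_0 ?(lin0 Psi_linear) //.
  move=> w wt wk; move/negP: kE; apply; apply/imfsetP; exists w => //.
rewrite -[LHS]PhiK /npr -(lin_sum Psi_linear); congr Psi.
rewrite -[LHS]malg_ext_id /restr /malg_ext exchange_big /=.
apply: eq_big_seq => w wt; rewrite -scaler_sumr; congr (_ *: _).
have wE : wtype w \in E by apply/imfsetP; exists w.
rewrite (big_fsetD1 _ wE) /= eqxx big1_seq ?addr0 // => k /andP[_].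
by rewrite !inE eq_sym => /andP[/negPf -> _].
Qed.

Definition bidegree_part k (u : F ga) : normal br := component ngr k (normal_form u).

Lemma cmpE k u : bidegree_part k u = Psi (restr k (toA u)).
Proof.
by rewrite /bidegree_part normal_gr_direct.2 /npr normal_formE PsiK //; apply: toA_sup.
Qed.

Lemma toA_linear : linear (fun u : F ga => toA u).
Proof. by apply: toFA_linear; apply: obasis. Qed.

Lemma cmp_linear k : linear (bidegree_part k).
Proof.
by move=> c u v; rewrite !cmpE toA_linear restr_linear; apply: Psi_linear.
Qed.

(* The filtration by the degree of the factor in F(g_+), which defines the
   topology of the completion. *)
Definition Jfil (N : int) (u : F ga) : Prop := sup (fun w => N <= pdeg w) (toA u).

Lemma Jfil0 N : Jfil N 0.
Proof. by rewrite /Jfil (lin0 toA_linear); apply: sup0. Qed.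
Lemma JfilP N c u v : Jfil N u -> Jfil N v -> Jfil N (c *: u + v).
Proof. by move=> hu hv; rewrite /Jfil toA_linear; apply: supD hv; apply: supZ. Qed.
Lemma JfilD N u v : Jfil N u -> Jfil N v -> Jfil N (u + v).
Proof. by move=> hu hv; rewrite -[u]scale1r; apply: JfilP. Qed.
Lemma JfilZ N c u : Jfil N u -> Jfil N (c *: u).
Proof. by move=> hu; rewrite -[_ *: _]addr0; apply: JfilP (Jfil0 N). Qed.
Lemma JfilN N u : Jfil N u -> Jfil N (- u).
Proof. by move=> hu; rewrite -scaleN1r; apply: JfilZ. Qed.
Lemma Jfil_sum N (I : eqType) (r : seq I) (G : I -> F ga) :
  (forall i, i \in r -> Jfil N (G i)) -> Jfil N (\sum_(i <- r) G i).
Proof.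
by move=> h; rewrite big_seq; apply: (big_ind (Jfil N) (Jfil0 N) (@JfilD N)).
Qed.
Lemma JfilW N M u : (N <= M)%R -> Jfil M u -> Jfil N u.
Proof. by move=> NM; apply: supW => w; apply: le_trans. Qed.
Lemma Jfil_le0 N u : (N <= 0)%R -> Jfil N u.
Proof. by move=> N0 w _; apply: le_trans N0 (pdeg_ge0 w). Qed.

Lemma u_expand u (Q : F ga -> Prop) : Q 0 -> (forall c x y, Q x -> Q y -> Q (c *: x + y)) ->
  (forall w, w \in msupp (toA u) -> Q (ofh ga [:w w])) -> Q u.
Proof.
move=> Q0 QP h; rewrite -[u]toAK -[toA u]malg_ext_id /malg_ext (lin_sum (@ofFAP _ _ _ _ _ _ _ _ _)).
rewrite big_seq; apply: (big_ind Q Q0) => [x y Qx Qy|w wu].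
  by rewrite -[x]scale1r; apply: QP.
rewrite (linZ (@ofFAP _ _ _ _ _ _ _ _ _)) -[_ *: _]addr0; apply: QP Q0; exact: h.
Qed.

(** Normalizing q and s separately suffices: s stays inside F(g_+) and keeps its degree there. *)
Lemma pdeg_np (q s : word A) : negw q -> posw s ->
  Jfil (wdeg s).1 (ofh ga [:w q] * ofh ga [:w s]).
Proof.
move=> qn sp; have qE : ofh ga [:w q] = incl (ofh gn [:w q]).
  by rewrite incl_ofFA //; [apply: neg_sub|apply: supU; apply/negwE].
have sE : ofh ga [:w s] = incl (ofh gp [:w s]).
  by rewrite incl_ofFA //; [apply: pos_sub|apply: supU; apply/poswE].
rewrite qE sE -normal_mulP.2 /Jfil -/(Phi _) Phi_tens.
apply: (supM (@toN_sup _) (P := fun w => negw w /\ normalw w)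
  (Q := fun w => posw w /\ wdeg w = wdeg s)) => [w ws|u v [un _] [vp vs]].
  split; first by have [] := toP_sup ws.
  move: ws; rewrite (ofFAK obasis); last by apply: supU; apply/poswE.
  by apply: nf_wdeg; apply: supU.
by rewrite pdeg_cat pdeg_neg // pdeg_pos // vs add0r.
Qed.

Lemma Jfil_left_pos x (s : word A) : posw s -> Jfil (wdeg s).1 (x * ofh ga [:w s]).
Proof.
move=> sp; apply: (u_expand (u := x) (Q := fun x => Jfil _ (x * _))).
- by rewrite mul0r; apply: Jfil0.
- by move=> c y z hy hz; rewrite mulrDl -env_scalerAl; apply: JfilP.
move=> w /toA_sup /normalw_split [q1 [q2 [-> q1n q2p]]].
rewrite -wordM ofFA_M -mulrA -ofFA_M wordM.
apply: (@JfilW _ (wdeg (q2 ++ s)).1); last first.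
  by apply: pdeg_np => //; rewrite /posw all_cat q2p.
by rewrite wdeg_cat /= lerDr -(pdeg_pos q2p) pdeg_ge0.
Qed.

(** Write a normal word of u as q1 q2 with q2 in F(g_+). Normal ordering x q1 can only put further
    letters of positive degree in front of q2, so the degree in F(g_+) does not drop. *)
Lemma Jfil_left N x u : Jfil N u -> Jfil N (x * u).
Proof.
move=> hu; apply: (u_expand (u := u) (Q := fun u => Jfil _ (x * u))).
- by rewrite mulr0; apply: Jfil0.
- by move=> c y z hy hz; rewrite mulrDr -env_scalerAr; apply: JfilP.
move=> w wu; have wN := hu _ wu.
have /normalw_split [q1 [q2 [wE q1n q2p]]] := toA_sup wu.
rewrite wE -wordM ofFA_M mulrA; apply: (@JfilW _ (wdeg q2).1); last exact: Jfil_left_pos.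
by move: wN; rewrite wE pdeg_cat pdeg_neg // add0r pdeg_pos.
Qed.

Definition homog (d : int * Gam) (u : F ga) : Prop := sup (fun w => wdeg w = d) (toA u).

Lemma homog_word w : homog (wdeg w) (ofh ga [:w w]).
Proof. by rewrite /homog ofAK; apply: nf_wdeg; apply: supU. Qed.

Lemma homogM d d' u v : homog d u -> homog d' v -> homog (d + d') (u * v).
Proof.
move=> hu hv; rewrite -[u]toAK -[v]toAK -ofFA_M /homog ofAK; apply: nf_wdeg.
by apply: supM hu hv _ => w w' <- <-; rewrite wdeg_cat.
Qed.

Lemma homog_Jfil d u : homog d u -> Jfil d.1 u.
Proof. by apply: supW => w <-; apply: wdeg_le. Qed.

(** With q1 q2 as before, q2 v is homogeneous of degree deg q2 + deg v. The degree in F(g_+) of a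
    homogeneous element is at least its total degree, since letters of g_- contribute
    nonpositively. *)
Lemma Jfil_right N d u v : Jfil N u -> homog d v -> Jfil (N + d.1) (u * v).
Proof.
move=> hu hv; apply: (u_expand (u := u) (Q := fun u => Jfil _ (u * v))).
- by rewrite mul0r; apply: Jfil0.
- by move=> c y z hy hz; rewrite mulrDl -env_scalerAl; apply: JfilP.
move=> w wu; have wN := hu _ wu.
have /normalw_split [q1 [q2 [wE q1n q2p]]] := toA_sup wu.
rewrite wE -wordM ofFA_M -mulrA; apply: Jfil_left.
apply: (@JfilW _ (wdeg q2 + d).1).
  by move: wN; rewrite wE pdeg_cat pdeg_neg // add0r pdeg_pos // => wN; rewrite lerD2r.
exact: (homog_Jfil (homogM (@homog_word q2) hv)).
Qed.

Lemma Jfil_sep u : (forall N, Jfil N u) -> u = 0.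
Proof.
move=> h; rewrite -[u]toAK (_ : toA u = 0) ?(lin0 (@ofFAP _ _ _ _ _ _ _ _ _)) //.
apply: supI_eq0 => w wu; have := h (pdeg w + 1) _ wu.
by rewrite gerDl ler10.
Qed.

Lemma cmp_Jfil N d t u : Jfil N u -> (t%:Z < N)%R -> bidegree_part (d, t) u = 0.
Proof.
move=> hu tN; rewrite cmpE restr_0 ?(lin0 Psi_linear) //.
move=> w wu wE; have := hu _ wu; rewrite -wtypeE wE /= leNgt; exact/negP/negPn.
Qed.

Lemma cmp_homog d d' t u : homog d u -> d != d' -> bidegree_part (d', t) u = 0.
Proof.
move=> hu dd; rewrite cmpE restr_0 ?(lin0 Psi_linear) //.
by move=> w wu wE; move: dd; rewrite -(hu _ wu) -[wdeg w]/((wtype w).1) wE eqxx.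
Qed.

Lemma Jfil_cmp N u : (forall d t, (t%:Z < N)%R -> bidegree_part (d, t) u = 0) -> Jfil N u.
Proof.
move=> h w wu; rewrite leNgt; apply/negP => wN.
have := h (wdeg w) (wtype w).2; rewrite wtypeE => /(_ wN).
rewrite cmpE => /(congr1 Phi); rewrite (lin0 Phi_linear) PsiK; last first.
  by move=> w' /(restr_sup (@toA_sup u)) [].
move/(congr1 (fun p => p@_w)); rewrite mcoeff0 /restr /malg_ext raddf_sum /=.
rewrite (big_fsetD1 w wu) /= eqxx mcoeffZ mcoeffUU mulr1.
rewrite big1_seq ?addr0; last first.
  move=> w' /andP[_]; rewrite !inE => /andP[w'w _]; rewrite mcoeffZ.
  case: ifP => _; last by rewrite mcoeff0 mulr0.
  by rewrite mcoeffU (negPf w'w) mulr0.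
by move=> /eqP; rewrite mcoeff_eq0 wu.
Qed.
End NormalOrder.

(** * Symmetrization *)

Section Symmetrize.
Context (K : fieldType) (Gam : zmodType) (eps : Gam -> Gam -> K).
Hypothesis heps : commutation_factor eps.
Context (B : lalgType K).

Definition symV k (x : 'I_k -> B) (d : 'I_k -> Gam) : B :=
  (k`!%:R)^-1 *: \sum_(s : 'S_k) perm_factor eps s d *: \prod_(i < k) x (s i).

Lemma perm_factor_pair k (s : 'S_k) (d : 'I_k -> Gam) :
  perm_factor eps s d = \prod_(p : 'I_k * 'I_k)
    (if (p.1 < p.2)%N && (s^-1%g p.2 < s^-1%g p.1)%N then eps (d p.1) (d p.2) else 1).
Proof.
rewrite /perm_factor; under eq_bigr do rewrite big_mkcond.
by rewrite pair_bigA.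
Qed.

(** Reindexing the pairs by an adjacent transposition leaves all factors in place except that of the
    pair {i0, i1}, which is inverted by exactly one of the two permutations; [epsC] accounts for the
    difference. *)
Lemma perm_factor_swap k (t : 'S_k) (d : 'I_k -> Gam) (i0 i1 : 'I_k) :
  i1 = i0.+1 :> nat ->
  eps (d i0) (d i1) * perm_factor eps (t * tperm i0 i1)%g (fun i => d (tperm i0 i1 i))
    = perm_factor eps t d.
Proof.
move=> i01; set tau := tperm i0 i1.
have n01 : i0 != i1 by rewrite -val_eqE /= i01 neq_ltn ltnSn.
rewrite !perm_factor_pair.
have tinv : {on predT, bijective (fun p : 'I_k * 'I_k => (tau p.1, tau p.2))}.
  by apply: onW_bij; exists (fun p => (tau p.1, tau p.2)) => -[a b] /=; rewrite !tpermK.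
rewrite [X in _ * X](reindex _ tinv) /=.
have F p : ((t * tau)^-1%g (tau p)) = t^-1%g p.
  by apply: (@perm_inj _ (t * tau)%g); rewrite permKV permM permKV.
under [X in _ * X]eq_bigr do rewrite !F /tau !tpermK -/tau.
have t0 : tau i0 = i1 by rewrite /tau tpermL.
have t1 : tau i1 = i0 by rewrite /tau tpermR.
rewrite (bigD1 (i0, i1)) //= (bigD1 (i1, i0)) /=; last first.
  by rewrite xpair_eqE eq_sym (negPf n01).
rewrite [RHS](bigD1 (i0, i1)) //= [in RHS](bigD1 (i1, i0)) /=; last first.
  by rewrite xpair_eqE eq_sym (negPf n01).
rewrite t0 t1 i01 ltnSn ltnNge leqnSn /= !mul1r mulrA; congr (_ * _).
  have nt : (t^-1%g i0 : nat) != t^-1%g i1 by rewrite val_eqE (inj_eq perm_inj).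
  by case: ltngtP nt => //= _ _; rewrite ?mulr1 // epsC.
apply: eq_bigr => -[a b] /andP[/= ab0 ab1].
have [->//|nab] := eqVneq a b; first by rewrite !ltnn.
(* An adjacent transposition preserves the order of any other pair of indices. *)
suff -> : (tau a < tau b)%N = (a < b)%N by [].
have v (p q : 'I_k) : p != q -> (p : nat) <> q by move=> pq /val_inj/eqP; rewrite (negPf pq).
have nab' := v _ _ nab.
move: ab0 ab1; rewrite !xpair_eqE /tau.
have [->|a0] := eqVneq a i0; [|have [->|a1] := eqVneq a i1];
  (have [->|b0] := eqVneq b i0; [|have [->|b1] := eqVneq b i1]) => //= _ _;
  rewrite ?tpermL ?tpermR ?ltnn // ?[tperm _ _ a]tpermD ?[tperm _ _ b]tpermD //;
  try (by rewrite eq_sym); rewrite ?i01;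
  repeat match goal with H : is_true (_ != _) |- _ => move: (v _ _ H); clear H end; lia.
Qed.

Lemma symV_swap k (x : 'I_k -> B) (d : 'I_k -> Gam) (i0 i1 : 'I_k) :
  i1 = i0.+1 :> nat ->
  symV x d = eps (d i0) (d i1) *:
    symV (fun i => x (tperm i0 i1 i)) (fun i => d (tperm i0 i1 i)).
Proof.
move=> i01; rewrite /symV scalerA mulrC -scalerA; congr (_ *: _).
rewrite scaler_sumr [RHS](reindex_inj (mulIg (tperm i0 i1))) /=.
apply: eq_bigr => t _; rewrite scalerA perm_factor_swap //; congr (_ *: _).
by apply: eq_bigr => i _; rewrite permM tpermK.
Qed.

Lemma eq_symV k (x y : 'I_k -> B) (d d' : 'I_k -> Gam) : x =1 y -> d =1 d' ->
  symV x d = symV y d'.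
Proof. by move=> /funext -> /funext ->. Qed.

Section Words.
Context (A : choiceType) (X : A -> B) (D : A -> Gam).
Local Notation wx w := (fun i => oapp X 0 (onth w i)).
Local Notation wd w := (fun i => oapp D 0 (onth w i)).

(** Letters are read with [onth], whose default no index below [size w] meets. The same functions
    then serve on any ['I_k] with k equal to the size, avoiding casts between ordinals ([sym1E]). *)
Definition sym1 (w : word A) : B :=
  symV (fun i : 'I_(size w) => wx w i) (fun i : 'I_(size w) => wd w i).

Lemma sym1E k (w : word A) : size w = k ->
  sym1 w = symV (fun i : 'I_k => wx w i) (fun i : 'I_k => wd w i).
Proof. by move=> <-. Qed.

Lemma sym1_swap (u : word A) a b (v : word A) :
  sym1 (u ++ a :: b :: v) = eps (D a) (D b) *: sym1 (u ++ b :: a :: v).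
Proof.
set k := size (u ++ a :: b :: v).
have kE : k = (size u + (size v).+2)%N by rewrite /k size_cat.
have k0 : (size u < k)%N by rewrite kE; lia.
have k1 : ((size u).+1 < k)%N by rewrite kE; lia.
rewrite (@sym1E k) // (@sym1E k (u ++ b :: a :: v)); last by rewrite kE size_cat.
rewrite (@symV_swap _ _ _ (Ordinal k0) (Ordinal k1)) //.
have oth (i : 'I_k) : onth (u ++ a :: b :: v) (tperm (Ordinal k0) (Ordinal k1) i) =
    onth (u ++ b :: a :: v) i.
  rewrite !onth_cat; case: tpermP => [->|->|/eqP ni0 /eqP ni1] /=.
  - by rewrite ltnn ltnNge leqnSn /= subnn subSnn.
  - by rewrite ltnn ltnNge leqnSn /= subnn subSnn.
  have n0 : (i : nat) != size u by apply: contraNneq ni0 => E; apply/eqP/val_inj.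
  have n1 : (i : nat) != (size u).+1 by apply: contraNneq ni1 => E; apply/eqP/val_inj.
  case: ltnP => // ui; case E : (i - size u)%N => [|[|n]] //=; exfalso; lia.
have -> : oapp D 0 (onth (u ++ a :: b :: v) (Ordinal k0)) = D a.
  by rewrite /= onth_cat ltnn subnn.
have -> : oapp D 0 (onth (u ++ a :: b :: v) (Ordinal k1)) = D b.
  by rewrite onth_cat [nat_of_ord _]/= ltnNge leqnSn /= subSnn.
by congr (_ *: _); apply: eq_symV => i; rewrite oth.
Qed.

Local Notation FA := {malg K[word A]}.
Hypothesis scalAr : forall (c : K) (x y : B), c *: (x * y) = x * (c *: y).

Lemma scaled_prod (C : lalgType K) (I : Type) (r : seq I) (c : I -> K) (F : I -> C) :
  (forall (c : K) (x y : C), c *: (x * y) = x * (c *: y)) ->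
  \prod_(i <- r) (c i *: F i) = (\prod_(i <- r) c i) *: \prod_(i <- r) F i.
Proof.
move=> sAr; elim: r => [|i r IH]; first by rewrite !big_nil scale1r.
by rewrite !big_cons IH -scalerAl -sAr scalerA.
Qed.

Lemma prod_words (I : Type) (r : seq I) (t : I -> A) :
  \prod_(i <- r) ([:w [:: t i]] : FA) = [:w map t r].
Proof. by elim: r => [|i r IH]; rewrite ?big_nil // big_cons IH wordM. Qed.

Lemma prod_expand (C : lalgType K) k (E : {fset A}) (c : 'I_k -> A -> K) (F : A -> C) :
  (forall (c : K) (x y : C), c *: (x * y) = x * (c *: y)) ->
  \prod_(i < k) (\sum_(a <- E) c i a *: F a) =
  \sum_(f : {ffun 'I_k -> E}) (\prod_i c i (val (f i))) *: \prod_(i < k) F (val (f i)).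
Proof.
move=> sAr; under eq_bigr do rewrite big_seq_fsetE /=.
by rewrite bigA_distr_bigA; apply: eq_bigr => f _; rewrite scaled_prod.
Qed.

(** Multilinearity of the symmetrization. It is compatible with the degree-dependent factors because
    every letter that occurs in the i-th argument has degree d i, so all words of the expansion
    carry the same factors. *)
Lemma sym1_expand k (E : {fset A}) (c : 'I_k -> A -> K) (d : 'I_k -> Gam) :
  (forall i a, c i a != 0 -> D a = d i) ->
  malg_ext sym1 (\prod_(i < k) (\sum_(a <- E) c i a *: ([:w [:: a]] : FA))) =
  symV (fun i => \sum_(a <- E) c i a *: X a) d.
Proof.
move=> cd; rewrite (prod_expand _ _ _ (@free_scalerAr A K)) (lin_sum (@malg_ext_linear _ _ _ _)).
have wE (f : {ffun 'I_k -> E}) :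
  malg_ext sym1 ((\prod_i c i (val (f i))) *: \prod_(i < k) ([:w [:: val (f i)]] : FA)) =
  (\prod_i c i (val (f i))) *: symV (fun i => X (val (f i))) d.
  rewrite (linZ (@malg_ext_linear _ _ _ _)).
  have -> : \prod_(i < k) ([:w [:: val (f i)]] : FA) = [:w map (fun i => val (f i)) (enum 'I_k)].
    by rewrite -(prod_words (enum 'I_k) (fun i => val (f i))) enumT [index_enum _]unlock.
  rewrite malg_extU (@sym1E k); last by rewrite size_map size_enum_ord.
  have [->|n] := eqVneq (\prod_i c i (val (f i))) 0; first by rewrite !scale0r.
  congr (_ *: _).
  have oth (i : 'I_k) : onth (map (fun i => val (f i)) (enum 'I_k)) i = Some (val (f i)).
    by rewrite onth_map onthE (nth_map i) ?size_enum_ord //= nth_ord_enum.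
  apply: eq_symV => i; rewrite oth //=; apply: cd.
  by apply: contraNneq n => ci; rewrite (bigD1 i) //= ci mul0r.
under eq_bigr do rewrite wE.
rewrite /symV; under eq_bigr do rewrite scalerA mulrC -scalerA.
rewrite -scaler_sumr; congr (_ *: _).
under eq_bigr do rewrite scaler_sumr.
rewrite exchange_big; apply: eq_bigr => s _.
rewrite (prod_expand E (fun i => c (s i)) X scalAr) scaler_sumr.
have hb : {on predT, bijective (fun h : {ffun 'I_k -> E} => [ffun i => h (s i)])}.
  by apply: onW_bij; exists (fun h : {ffun 'I_k -> E} => [ffun i => h (s^-1%g i)]) => h;
    apply/ffunP => i; rewrite !ffunE ?permK ?permKV.
rewrite [RHS](reindex _ hb) /=; apply: eq_bigr => h _.
rewrite !scalerA mulrC; congr ((_ * _) *: _).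
  by rewrite [LHS](reindex_inj (@perm_inj _ s)); apply: eq_bigr => i _; rewrite ffunE.
by apply: eq_bigr => i _; rewrite ffunE.
Qed.
End Words.
End Symmetrize.

Section Symmetrization.
Context (K : fieldType) (charK : forall n, n.+1%:R != 0 :> K).
Context (Gam : zmodType) (eps : Gam -> Gam -> K).
Hypothesis heps : commutation_factor eps.
Context (g : zqColorLie eps).
Context (A : choiceType) (e e' : A -> g) (dg : A -> int * Gam).
Hypotheses (he : is_homogeneous_basis e dg) (he' : is_dual_basis e e').

Definition br0 (x y : g) : g := 0.

Lemma br0_color : color_bracket eps (@cl_gr _ _ _ g) br0.
Proof.
split.
- by move=> y c u v; rewrite /br0 scaler0 addr0.
- by move=> y c u v; rewrite /br0 scaler0 addr0.
- by move=> a b x y _ _; apply: (ds0 (@cl_direct _ _ _ g)).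
- by move=> a b x y _ _; rewrite /br0 scaler0 oppr0.
- by move=> a b c x y z _ _ _; rewrite /br0 scaler0 addr0.
Qed.
Lemma br0_zq i j x y : x \in @zq_gr _ _ _ g i -> y \in @zq_gr _ _ _ g j ->
  br0 x y \in @zq_gr _ _ _ g (i + j).
Proof. by move=> _ _; apply: (ds0 (@zq_direct _ _ _ g)). Qed.

Lemma bracket_color : color_bracket eps (@cl_gr _ _ _ g) (@bracket _ _ _ g).
Proof.
split.
- exact: bracket_linearl.
- exact: bracket_linearr.
- exact: bracket_gr.
- exact: bracket_skew.
- exact: bracket_jacobi.
Qed.

Local Notation br := (@bracket _ _ _ g).
Local Notation cdg := (fun a => (dg a).2).
Local Notation le := (wle dg).
Local Notation iotal := (iotal he he').

Section Sub.
Variables (h : {pred g}).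
Hypotheses (h_sub : GRing.submod_closed h)
  (h_span : forall x, x \in h -> lspan_spec [set y | exists2 a, e a \in h & y = e a] x).

Local Notation obr := (obasis charK heps he he' bracket_color).
Local Notation ob0 := (obasis charK heps he he' br0_color).
Local Notation X := (fun a => inl eps (@cl_gr _ _ _ g) br h (e a)).
Local Notation sy1 := (sym1 eps X cdg).

Lemma sym1_odd (u : word A) a (v : word A) : eps (dg a).2 (dg a).2 = -1 ->
  sy1 (u ++ a :: a :: v) = 0.
Proof.
move=> o; have := sym1_swap heps X cdg u a a v; rewrite o scaleN1r => /eqP.
rewrite -addr_eq0 -mulr2n -scaler_nat scaler_eq0 => /orP[/eqP/eqP E|/eqP //].
by move: (charK 1); rewrite E.
Qed.

(** For the zero bracket a reduction exchanges two letters with their factor or deletes a word with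
    a repeated odd letter. The symmetrization respects both, hence it is well defined on the color
    symmetric algebra. *)
Lemma sym1_nf1 w : malg_ext sy1 (nf1 eps br0 le e cdg iotal w) = sy1 w.
Proof.
elim/(nf_ind (charK 1) (charK 2) (le := le)): w => w IH.
have tot := @wle_total _ _ dg.
have sp := homog_span he he' (@cl_direct _ _ _ g) (e_cl he).
have io : forall a, iotal (e a) = [:w [:: a]] := iota_e he'.
case E : (red (bad eps le cdg) w) => [[[[u a] b] v]|]; last first.
  by rewrite nf1_normal // malg_extU.
have [wE ab _] := redP E.
rewrite (nf1_red (charK 1) (charK 2) br0_color tot (e_cl he) sp io).
rewrite /red1 E /br0 linear0 mulr0 mul0r scaler0 addr0.
have [eab|nab] := eqVneq a b.
  rewrite (lin0 (@malg_ext_linear _ _ _ _)) (lin0 (@malg_ext_linear _ _ _ _)).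
  rewrite wE -eab sym1_odd //; move: ab; rewrite -eab /bad /gt.
  by have /orP[->|->] := tot a a; rewrite eqxx => /eqP.
rewrite (linZ (@malg_ext_linear _ _ _ _)) (linZ (@malg_ext_linear _ _ _ _)) malg_extU.
rewrite IH; last first.
  have ab' : gt le a b by move: ab; rewrite /bad (negPf nab) orbF.
  by rewrite wE (mu_swap tot _ _ ab').
by rewrite wE -(sym1_swap heps X cdg).
Qed.

Definition symQ (u : env eps (@cl_gr _ _ _ g) br0 h) : env eps (@cl_gr _ _ _ g) br h :=
  malg_ext sy1 (toFA le e cdg iotal u).

Lemma symQP : @is_symmetrization _ _ _ g h symQ.
Proof.
split=> [c u v|k x d xd].
  by rewrite /symQ toFA_linear ?malg_ext_linear //; apply: ob0.
rewrite /symQ (prod_env_in charK heps he he' br0_color h_sub h_span).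
rewrite (ofFAK ob0); last exact: (prod_iota_inh charK heps br0_color h_sub h_span (x := x)).
have -> p : malg_ext sy1 (malg_ext (nf1 eps br0 le e cdg iotal) p) = malg_ext sy1 p.
  apply: (linear_eq_sup (f := fun p => malg_ext sy1 (malg_ext _ p)) (P := fun=> True)).
  - by move=> c q r; rewrite malg_ext_linear; apply: malg_ext_linear.
  - exact: malg_ext_linear.
  - by [].
  - by move=> w _; rewrite !malg_extU sym1_nf1.
have ex i : exists E : {fset A}, forall a, form (val (x i)) (e' a) != 0 -> a \in E.
  by have [E hE _] := basis_expand he he' (val (x i)); exists E.
have [f hf] := boolp.choice ex.
pose E := (\bigcup_(i <- enum 'I_k) f i)%fset.
have hE i a : form (val (x i)) (e' a) != 0 -> a \in E.
  by move/hf => ai; apply/bigfcupP; exists i => //; rewrite mem_enum.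
have xE i : iotal (val (x i)) = \sum_(a <- E) form (val (x i)) (e' a) *: [:w [:: a]].
  exact: (iotaE (hE i)).
have yE i : env_in eps (@cl_gr _ _ _ g) br (x i) = \sum_(a <- E) form (val (x i)) (e' a) *: X a.
  have -> : env_in eps (@cl_gr _ _ _ g) br (x i) = inl eps (@cl_gr _ _ _ g) br h (val (x i)).
    by apply/esym; exact: (inlE eps (@cl_gr _ _ _ g) br (x i)).
  rewrite -(iota_inh obr h_sub h_span (valP (x i))).2 xE (lin_sum (@ofFAP _ _ _ _ _ _ _ _ _)).
  apply: eq_bigr => a _; rewrite (linZ (@ofFAP _ _ _ _ _ _ _ _ _)).
  by rewrite ofFA_word big_seq1.
under eq_bigr do rewrite xE.
have sAr : forall (c : K) (x y : env eps (@cl_gr _ _ _ g) br h), c *: (x * y) = x * (c *: y).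
  exact: env_scalerAr.
have cE i a : form (val (x i)) (e' a) != 0 -> (dg a).2 = d i.
  exact: (co_homog he he' (d := cdg) (@cl_direct _ _ _ g) (e_cl he) (xd i)).
rewrite (@sym1_expand K Gam eps _ A X cdg sAr k E (fun i a => form (val (x i)) (e' a)) d cE).
rewrite /symV; congr (_ *: _); apply: eq_bigr => s _; congr (_ *: _).
by apply: eq_bigr => i _; rewrite yE.
Qed.

(** The map is chosen by [xget], so its properties depend on exhibiting one symmetrization, namely
    [symQ]. *)
Lemma symmetrizationP : is_symmetrization (@symmetrization _ _ _ g h).
Proof.
by rewrite /symmetrization; case: xgetP => [Q _ //|/(_ symQ)[]]; apply: symQP.
Qed.
End Sub.
End Symmetrization.

(** * Dual bases *)

Section DualBasis.
Context (K : fieldType) (Gam : zmodType) (eps : Gam -> Gam -> K).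
Hypothesis heps : commutation_factor eps.
Context (g : zqColorLie eps).
Context (A : choiceType) (e e' : A -> g) (dg : A -> int * Gam).
Hypotheses (he : is_homogeneous_basis e dg) (he' : is_dual_basis e e').
Local Notation zdg := (fun a => (dg a).1).

Lemma form_linl (y : g) : linear (fun x : g => form x y : K^o).
Proof. exact: form_linearl. Qed.
Lemma form_linr (x : g) : linear (form x : g -> K^o).
Proof. exact: form_linearr. Qed.
Lemma formZl c (x y : g) : form (c *: x) y = c * form x y.
Proof. exact: (linZ (form_linl y)). Qed.
Lemma formZr c (x y : g) : form x (c *: y) = c * form x y.
Proof. exact: (linZ (form_linr x)). Qed.
Lemma formNl (x y : g) : form (- x) y = - form x y.
Proof. exact: (linN (form_linl y)). Qed.
Lemma form0l (y : g) : form 0 y = 0. Proof. exact: (lin0 (form_linl y)). Qed.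
Lemma form_suml (I : Type) (r : seq I) (P : pred I) (F : I -> g) y :
  form (\sum_(i <- r | P i) F i) y = \sum_(i <- r | P i) form (F i) y.
Proof. exact: (lin_sum (form_linl y)). Qed.
Lemma form_sumr (I : Type) (r : seq I) (P : pred I) (F : I -> g) x :
  form x (\sum_(i <- r | P i) F i) = \sum_(i <- r | P i) form x (F i).
Proof. exact: (lin_sum (form_linr x)). Qed.

Lemma bihom_form d d' (x y : g) : x \in bihom d -> y \in bihom d' -> form x y != 0 -> d' = - d.
Proof.
move=> /andP[xz xc] /andP[yz yc] /(form_deg xz xc yz yc) [/eqP E1 /eqP E2].
rewrite [d']surjective_pairing [d]surjective_pairing; congr pair; apply/eqP.
  by rewrite -addr_eq0 addrC.
by rewrite -addr_eq0 addrC.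
Qed.

Lemma bihom0 d : 0 \in @bihom _ _ _ g d.
Proof. by rewrite inE /= (ds0 (@zq_direct _ _ _ g)) (ds0 (@cl_direct _ _ _ g)). Qed.
Lemma bihomP d c (x y : g) : x \in bihom d -> y \in bihom d -> c *: x + y \in bihom d.
Proof.
move=> /andP[xz xc] /andP[yz yc]; rewrite inE /=.
by rewrite (dsP (@zq_direct _ _ _ g)) // (dsP (@cl_direct _ _ _ g)).
Qed.
Lemma bihomD d (x y : g) : x \in bihom d -> y \in bihom d -> x + y \in bihom d.
Proof. by move=> xd yd; rewrite -[x]scale1r bihomP. Qed.
Lemma bihomZ d c (x : g) : x \in bihom d -> c *: x \in bihom d.
Proof. by move=> xd; rewrite -[_ *: _]addr0 bihomP // bihom0. Qed.
Lemma bihom_sum d (I : Type) (r : seq I) (P : pred I) (F : I -> g) :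
  (forall i, P i -> F i \in bihom d) -> \sum_(i <- r | P i) F i \in bihom d.
Proof. by move=> h; elim/big_ind: _ => //; [apply: bihom0|move=> *; apply: bihomD]. Qed.
Lemma bihom_br d d' (x y : g) : x \in bihom d -> y \in bihom d' -> bracket x y \in bihom (d + d').
Proof.
move=> /andP[xz xc] /andP[yz yc]; rewrite inE /=.
by apply/andP; split; [apply: zq_bracket|apply: bracket_gr].
Qed.

Local Notation eb := (e_bihom he).

Lemma form_e_eq0 (x : g) : (forall b, form x (e b) = 0) -> x = 0.
Proof.
move=> h; apply: form_nondegl => y; have [E hE /(_ _ hE) ->] := basis_expand he he' y.
by rewrite form_sumr big1 // => a _; rewrite formZr h mulr0.
Qed.
Lemma form_e_eq0r (x : g) : (forall b, form (e b) x = 0) -> x = 0.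
Proof.
move=> h; apply: form_nondegr => y; have [E hE /(_ _ hE) ->] := basis_expand he he' y.
by rewrite form_suml big1 // => a _; rewrite formZl h mulr0.
Qed.

(** Homogeneity of the dual basis follows from duality. If dg b differs from -dg a, let y be the
    part of e' a of degree dg b. It pairs to zero with e c, by degree when dg c is not -dg b, and
    otherwise because c differs from a. Nondegeneracy gives y = 0, in particular its b-th
    coordinate. *)
Lemma dual_co a b : form (e' a) (e' b) != 0 -> dg b = - dg a.
Proof.
move=> n; apply/eqP; apply: contraNT n => dba.
have [E hE /(_ _ hE) xE] := basis_expand he he' (e' a).
pose y := \sum_(c <- E | dg c == dg b) form (e' a) (e' c) *: e c.
have y0 : y = 0.
  apply: form_e_eq0r => c; have [dcb|dcb] := eqVneq (dg b) (- dg c); last first.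
    have yb : y \in bihom (dg b).
      by apply: bihom_sum => k /eqP <-; apply: bihomZ; apply: eb.
    by apply/eqP; apply: contraNT dcb => n; rewrite (bihom_form (eb c) yb n).
  have : form (e c) (e' a) = 0.
    by rewrite he'; have [ca|//] := eqVneq c a; rewrite -ca dcb eqxx in dba.
  rewrite {1}xE form_sumr (bigID (fun k => dg k == dg b)) /= [X in _ + X]big1 ?addr0.
    by move=> <-; rewrite /y form_sumr.
  move=> k kb; rewrite formZr; apply/eqP; rewrite mulf_eq0; apply/orP; right.
  by apply: contraNT kb => /(bihom_form (eb c) (eb k)); rewrite -dcb => ->.
have := congr1 (fun x => form x (e' b)) y0; rewrite form0l /y form_suml.
have [bE|bE] := boolP (b \in E); last by move=> _; apply: contraNT bE => /hE.
rewrite -big_filter (bigD1_seq b) ?filter_uniq ?fset_uniq ?mem_filter ?eqxx //=.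
rewrite formZl he' eqxx mulr1 big1 => [|k kb]; first by rewrite addr0 => /eqP.
by rewrite formZl he' (negPf kb) mulr0.
Qed.

Lemma dual_bihom a : e' a \in bihom (- dg a).
Proof.
have [E hE /(_ _ hE) ->] := basis_expand he he' (e' a); apply: bihom_sum => b _.
have [->|/dual_co <-] := eqVneq (form (e' a) (e' b)) 0; first by rewrite scale0r bihom0.
by apply: bihomZ; apply: eb.
Qed.

(** A basis element of degree m lies in the span of the finite set s, so its index occurs among the
    finitely many coordinates of some member of s. *)
Lemma finite_deg m : finite_set [set a | (dg a).1 = m].
Proof.
have [s hs] := zq_findim g m.
have [E hE] : exists E : {fset A}, forall x, x \in s -> forall a, form x (e' a) != 0 -> a \in E.
  elim: s {hs} => [|x s [E hE]]; first by exists fset0.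
  have [F hF _] := basis_expand he he' x; exists (F `|` E)%fset => y.
  rewrite inE => /orP[/eqP -> a /hF|/hE h a /h]; rewrite inE => -> //.
  by rewrite orbT.
apply: sub_finite_set (finite_fset E) => a /= am.
have : e a \in lspan [set x | x \in s] by apply: hs; rewrite -am; apply: e_zq.
have : form (e a) (e' a) != 0 by rewrite he' eqxx oner_eq0.
move=> n /lspanP es; move: es n; elim=> [|c x v xs _ IH]; first by rewrite form0l eqxx.
rewrite form_linearl; have [E0|n _] := eqVneq (form x (e' a)) 0; last exact: hE xs _ n.
by rewrite E0 mulr0 add0r => /IH.
Qed.

Definition degree_basis m : {fset A} := fset_set [set a | (dg a).1 = m].
Lemma in_Am a m : (a \in degree_basis m) = ((dg a).1 == m).
Proof.
rewrite /degree_basis in_fset_set; last exact: finite_deg.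
by apply/idP/idP; rewrite inE => /eqP.
Qed.

Lemma expand m (x : g) : x \in zq_gr m -> x = \sum_(a <- degree_basis m) form x (e' a) *: e a.
Proof.
move=> xm; have [E hE h] := basis_expand he he' x; apply: h => a na.
by rewrite in_Am (co_homog he he' (d := zdg) (@zq_direct _ _ _ g) (e_zq he) xm na).
Qed.

Local Notation ep a := (eps (dg a).2 (dg a).2).

Lemma ep_sqr a : ep a * ep a = 1.
Proof. exact: epsC. Qed.
Lemma epV a : (ep a)^-1 = ep a.
Proof. by rewrite -(epsV heps). Qed.

(** The factor is eps(-deg b, deg b), the inverse of eps(deg b, deg b), which is its own inverse. *)
Lemma form_dual_e a b : form (e' a) (e b) = ep b * (a == b)%:R.
Proof.
have /andP[_ ac] := dual_bihom a; rewrite (form_sym ac (e_cl he b)) he' eq_sym.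
by case: eqP => [->|_]; rewrite ?mulr0 // !mulr1 (epsNl heps) epV.
Qed.

Lemma form_zq_e m (x : g) b : x \in zq_gr m -> (dg b).1 != - m -> form x (e b) = 0.
Proof.
move=> xm bm; rewrite (expand xm) form_suml big_seq big1 // => a; rewrite in_Am => /eqP am.
rewrite formZl; apply/eqP; rewrite mulf_eq0; apply/orP; right.
by apply: contraNT bm => /(bihom_form (eb a) (eb b)) ->; rewrite /= am.
Qed.

Lemma dual_expand m (x : g) : x \in zq_gr m ->
  x = \sum_(a <- degree_basis (- m)) (ep a * form x (e a)) *: e' a.
Proof.
move=> xm; apply/eqP; rewrite -subr_eq0; apply/eqP/form_e_eq0 => b.
rewrite (linB (form_linl (e b))) form_suml.
have [bm|bm] := boolP (b \in degree_basis (- m)).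
  rewrite (bigD1_seq b) ?fset_uniq //= big1 => [|a ab]; last first.
    by rewrite formZl form_dual_e (negPf ab) !mulr0.
  by rewrite formZl form_dual_e eqxx mulr1 addr0 mulrAC ep_sqr mul1r subrr.
rewrite big_seq big1 => [|a am]; last first.
  rewrite formZl form_dual_e; case: eqP => [ab|_]; last by rewrite !mulr0.
  by rewrite -ab am in bm.
by rewrite subr0 (form_zq_e xm) //; move: bm; rewrite in_Am.
Qed.

Section Bilinear.
Context (W : lmodType K) (f : g -> g -> W).
Hypotheses (fl : forall y, linear (f^~ y)) (fr : forall x, linear (f x)).

Lemma bilin_sum (I J : Type) (r : seq I) (s : seq J) (c : I -> K) (d : J -> K) F G :
  f (\sum_(i <- r) c i *: F i) (\sum_(j <- s) d j *: G j) =
  \sum_(i <- r) \sum_(j <- s) (c i * d j) *: f (F i) (G j).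
Proof.
rewrite (lin_sum (fl _)); apply: eq_bigr => i _; rewrite (linZ (fl _)) (lin_sum (fr _)).
by rewrite scaler_sumr; apply: eq_bigr => j _; rewrite (linZ (fr _)) scalerA.
Qed.
Lemma sum_l (I : Type) (r : seq I) (c : I -> K) F y :
  f (\sum_(i <- r) c i *: F i) y = \sum_(i <- r) c i *: f (F i) y.
Proof. by rewrite (lin_sum (fl _)); apply: eq_bigr => i _; rewrite (linZ (fl _)). Qed.
Lemma sum_r (I : Type) (r : seq I) (c : I -> K) F x :
  f x (\sum_(i <- r) c i *: F i) = \sum_(i <- r) c i *: f x (F i).
Proof. by rewrite (lin_sum (fr _)); apply: eq_bigr => i _; rewrite (linZ (fr _)). Qed.

(** Color symmetry of the tensor sum_a e^a (x) e_a: both sides are expansions with the coefficients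
    B(e^a, e^b). The weight k is evaluated at the color degree of the left factor on either side;
    [bracket_casimir_sum] needs it for the signs of x. *)
Lemma dual_swap (k : Gam -> K) m :
  \sum_(a <- degree_basis m) k (- (dg a).2) *: f (e' a) (e a) =
  \sum_(b <- degree_basis (- m)) (ep b * k (dg b).2) *: f (e b) (e' b).
Proof.
have -> : \sum_(a <- degree_basis m) k (- (dg a).2) *: f (e' a) (e a) =
   \sum_(a <- degree_basis m) \sum_(b <- degree_basis (- m)) (k (- (dg a).2) * form (e' a) (e' b)) *: f (e b) (e a).
  apply: eq_big_seq => a; rewrite in_Am => /eqP am.
  have /andP[az _] := dual_bihom a; rewrite /= am in az.
  rewrite {1}(expand az) sum_l scaler_sumr.
  by apply: eq_bigr => b _; rewrite scalerA.
rewrite exchange_big; apply: eq_big_seq => b; rewrite in_Am => /eqP bm /=.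
have /andP[bz _] := dual_bihom b; rewrite /= bm opprK in bz.
rewrite {2}(expand bz) sum_r scaler_sumr; apply: eq_bigr => a _; rewrite scalerA; congr (_ *: _).
have /andP[_ ac] := dual_bihom a; have /andP[_ bc] := dual_bihom b.
rewrite (form_sym ac bc).
have [->|n] := eqVneq (form (e' b) (e' a)) 0; first by rewrite !mulr0.
rewrite (dual_co n) /= opprK (epsNr heps) epV.
by rewrite mulrA [k _ * _]mulrC.
Qed.

(** Both sides expand to combinations of the f (e' b) (e a) with b of degree m and a of degree m +
    deg x, whose coefficients agree by invariance of the form. This matching of degrees is the
    source of the shift by [d.1]. *)
Lemma invariance x d m : x \in bihom d ->
  \sum_(a <- degree_basis (m + d.1)) f (bracket x (e' a)) (e a) =
  - \sum_(b <- degree_basis m) eps d.2 (- (dg b).2) *: f (e' b) (bracket x (e b)).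
Proof.
move=> xd.
have -> : \sum_(a <- degree_basis (m + d.1)) f (bracket x (e' a)) (e a) =
    \sum_(a <- degree_basis (m + d.1)) \sum_(b <- degree_basis m)
      (ep b * form (bracket x (e' a)) (e b)) *: f (e' b) (e a).
  apply: eq_big_seq => a; rewrite in_Am => /eqP am.
  have /andP[xz _] := bihom_br xd (dual_bihom a).
  rewrite /= am opprD addrCA subrr addr0 in xz.
  by rewrite {1}(dual_expand xz) sum_l opprK.
rewrite exchange_big -sumrN; apply: eq_big_seq => b; rewrite in_Am => /eqP bm /=.
have /andP[xz _] := bihom_br xd (eb b); rewrite /= bm addrC in xz.
rewrite {1}(expand xz) sum_r scaler_sumr -sumrN.
apply: eq_bigr => a _; rewrite scalerA -scaleNr; congr (_ *: _).
have /andP[_ xc] := xd.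
have E : form (e b) (bracket x (e' a)) = ep b * form (bracket x (e' a)) (e b).
  have yb := bihom_br xd (dual_bihom a); have /andP[_ yc] := yb.
  have [E0|n] := eqVneq (form (bracket x (e' a)) (e b)) 0.
    by rewrite (form_sym (e_cl he b) yc) E0 !mulr0.
  have bE : d - dg a = - dg b by rewrite (bihom_form yb (eb b) n) opprK.
  rewrite (form_sym (e_cl he b) yc); congr (_ * _); rewrite bE /=.
  by rewrite (epsNr heps) epV.
rewrite (bracket_skew xc (e_cl he b)) formNl formZl (form_inv (e b)) E (epsNr heps).
by rewrite mulrN opprK !mulrA mulVf ?eps_neq0 // mul1r.
Qed.
End Bilinear.
End DualBasis.

(** * Commutators with the homogeneous parts of the Casimir element *)

(** Near 0 the terms combine into the pairs G (n - r) + G r, the shape to which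
    [bracket_casimir_sum] applies; what is left is a tail of n terms beyond N. *)
Lemma telescope_sum (W : zmodType) (G : nat -> W) n N :
  (G 0 - G n) + (\sum_(1 <= r < N.+1) (G r - G (r + n)%N)) *+ 2 =
  \sum_(1 <= r < n.+1) (G (n - r)%N + G r) - (\sum_(N.+1 <= r < (N + n).+1) G r) *+ 2.
Proof.
pose T a b := \sum_(a <= r < b) G r.
have E : \sum_(1 <= r < N.+1) G (r + n)%N = T n.+1 (N + n).+1.
  by rewrite /T -[n.+1]add1n big_addn -addSn addnK.
have E1 : T 1 N.+1 - T n.+1 (N + n).+1 = T 1 n.+1 - T N.+1 (N + n).+1.
  apply/eqP; rewrite subr_eq addrAC eq_sym subr_eq; apply/eqP.
  by rewrite /T -!big_cat_nat //=; lia.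
have E2 : \sum_(1 <= r < n.+1) G (n - r)%N = T 0 n.
  by rewrite /T [RHS]big_nat_rev big_add1 /=; apply: eq_bigr => i _; rewrite add0n.
have E3 : T 0 n = G 0 + T 1 n.+1 - G n.
  apply/eqP; rewrite eq_sym subr_eq; apply/eqP.
  by rewrite /T -(@big_nat_recr _ _ _ n 0 G) // big_ltn.
rewrite sumrB E -/(T 1 N.+1) E1 big_split /= E2 E3 -/(T _ _) -/(T _ _).
rewrite mulrnBl mulr2n !addrA; congr (_ - _).
by rewrite -!addrA; congr (_ + _); rewrite addrCA.
Qed.

(** The factors k^-1 and k picked up by X at two elements of opposite color degree cancel, which
    leaves an ordinary commutator. *)
Lemma commutator_mul (K : fieldType) (B : lalgType K) (X P Q R S : B) (k : K) :
  (forall (c : K) (x y : B), c *: (x * y) = x * (c *: y)) -> k != 0 ->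
  X * P = k^-1 *: (P * X) + R -> X * Q = k *: (Q * X) + S ->
  X * (P * Q) - (P * Q) * X = R * Q + k^-1 *: (P * S).
Proof.
move=> sAr k0 XP XQ; rewrite mulrA XP mulrDl -scalerAl -[P * X * Q]mulrA XQ.
rewrite mulrDr -sAr scalerDr scalerA mulVf // scale1r mulrA addrAC [X in X + _]addrAC.
by rewrite subrr add0r addrC.
Qed.

Lemma commutator_sum (B : pzRingType) (I : Type) (r : seq I) (X : B) (P R S : I -> B) :
  (forall i, X * P i - P i * X = R i + S i) ->
  X * (\sum_(i <- r) P i) - (\sum_(i <- r) P i) * X = \sum_(i <- r) R i - - \sum_(i <- r) S i.
Proof.
move=> h; rewrite opprK mulr_sumr mulr_suml -sumrB -big_split /=.
by apply: eq_bigr => i _.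
Qed.

Lemma swap_sum (W : zmodType) (p q r : W) : p = q + r -> p - q = r.
Proof. by move=> ->; rewrite addrC addKr. Qed.

Lemma swap_bigsum (W : zmodType) (I : Type) (r : seq I) (P Q R : I -> W) :
  (forall i, P i = Q i + R i) ->
  \sum_(i <- r) P i - \sum_(i <- r) Q i = \sum_(i <- r) R i.
Proof.
by move=> h; rewrite -sumrB; apply: eq_bigr => i _; apply: swap_sum.
Qed.

Section Commutators.
Context (K : fieldType) (charK : forall n, n.+1%:R != 0 :> K).
Context (Gam : zmodType) (eps : Gam -> Gam -> K).
Hypothesis heps : commutation_factor eps.
Context (g : zqColorLie eps).
Context (A : choiceType) (e e' : A -> g) (dg : A -> int * Gam).
Hypotheses (he : is_homogeneous_basis e dg) (he' : is_dual_basis e e').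

Local Notation br := (@bracket _ _ _ g).
Local Notation U := (env eps (@cl_gr _ _ _ g) br (@gall _ _ _ g)).
Local Notation Am := (degree_basis dg).

Definition Ein (x : g) : U := env_in eps (@cl_gr _ _ _ g) br (full_letter x).

Lemma Ein_linear : linear Ein.
Proof. by move=> c x y; apply: env_in_lin. Qed.

Lemma Ein_inl x : Ein x = inl eps (@cl_gr _ _ _ g) br (@gall _ _ _ g) x.
Proof. by apply/esym; exact: (inlE eps (@cl_gr _ _ _ g) br (full_letter x)). Qed.

Lemma Ein_br d d' x y : x \in bihom d -> y \in bihom d' ->
  Ein x * Ein y = eps d.2 d'.2 *: (Ein y * Ein x) + Ein (bracket x y).
Proof.
move=> /andP[_ xc] /andP[_ yc].
exact: (env_in_br (x := full_letter x) (y := full_letter y) (z := full_letter (bracket x y)) eps xc yc erefl).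
Qed.

Local Notation JJ := (@Jfil _ _ _ _ _ _ _ _ he he' br).
Local Notation bzq := (@zq_bracket _ _ _ g).
Local Notation bco := (bracket_color g).
Local Notation eb := (e_bihom he).
Local Notation dbi := (dual_bihom he he').

Lemma toA_Ein x : toFA (wle dg) e (fun a => (dg a).2) (iotal he he') (Ein x) = iota e' x.
Proof.
have ob := obasis charK heps he he' bco.
have [i1 i2] := iota_inh ob (@all_sub _ _ _ g) (all_span he he') (x := x) isT.
rewrite Ein_inl -i2 (ofFAK ob i1) nf_normal //.
apply: supW _ (iota_sup he he' (x := x)) => w [c _ ->]; by [].
Qed.

(** One-letter words are normal, so the coordinates of x can be read off the normal form of its
    image. *)
Lemma Ein_inj x : Ein x = 0 -> x = 0.
Proof.
move=> E; have := toA_Ein x; rewrite E.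
rewrite (lin0 (toA_linear charK heps he he' bco)) => i0.
apply: (co_eq0 he he') => a; have [F hF _] := basis_expand he he' x.
have := congr1 (fun p => p@_([:: a] : word A)) i0; rewrite mcoeff0 (iotaE hF) raddf_sum /=.
have [aF|aF] := boolP (a \in F); last by move=> _; apply/eqP; apply: contraNT aF => /hF.
rewrite (big_fsetD1 a aF) /= mcoeffZ mcoeffUU mulr1 big1_seq ?addr0 // => b /andP[_].
rewrite !inE => /andP[ba _]; rewrite mcoeffZ mcoeffU (_ : _ == _ = false) ?mulr0 //.
by apply/eqP => -[]; apply/eqP.
Qed.

Local Notation ep a := (eps (dg a).2 (dg a).2).
Local Notation hom := (@homog _ _ _ _ _ _ _ _ he he' br).

Lemma Ein_homog d x : x \in bihom d -> hom d (Ein x).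
Proof.
by move=> xd; rewrite /homog toA_Ein; exact: (iota_bihom he he' xd).
Qed.

(** This and the next two definitions are the elements c_m, t_m and b_m of the overview. *)
Definition casimir_part m : U := \sum_(a <- Am m) Ein (e' a) * Ein (e a).
Definition bracket_casimir x m : U := \sum_(a <- Am m) Ein (bracket x (e' a)) * Ein (e a).
Definition double_bracket_sum x m : g := \sum_(a <- Am m) bracket (bracket x (e' a)) (e a).

Lemma Ein_fl (T : g -> g) : linear T -> forall y, linear (fun x => Ein x * Ein (T y)).
Proof. by move=> lT y c u v; rewrite Ein_linear mulrDl -env_scalerAl. Qed.
Lemma Ein_fr (T : g -> g) : linear T -> forall x, linear (fun y => Ein x * Ein (T y)).
Proof. by move=> lT x c u v; rewrite lT Ein_linear mulrDr -env_scalerAr. Qed.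

Lemma cas_swap m : casimir_part m = \sum_(b <- Am (- m)) eps (dg b).2 (dg b).2 *: (Ein (e b) * Ein (e' b)).
Proof.
have idl : linear (id : g -> g) by [].
have := dual_swap heps he he' (Ein_fl idl) (Ein_fr idl) (fun=> 1) m.
rewrite /casimir_part; under eq_bigr do rewrite scale1r; move=> ->.
by apply: eq_bigr => b _; rewrite mulr1.
Qed.

Lemma comm_cas x d m : x \in bihom d ->
  Ein x * casimir_part m - casimir_part m * Ein x = bracket_casimir x m - bracket_casimir x (m + d.1).
Proof.
move=> xd.
have E : bracket_casimir x (m + d.1) =
    - \sum_(b <- Am m) eps d.2 (- (dg b).2) *: (Ein (e' b) * Ein (bracket x (e b))).
  have idl : linear (id : g -> g) by [].
  exact: (invariance heps he he' (Ein_fl idl) (Ein_fr idl) m xd).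
rewrite E; apply: commutator_sum => a.
rewrite (epsNr heps); apply: commutator_mul.
- exact: env_scalerAr.
- exact: eps_neq0.
- by have := Ein_br xd (dbi a); rewrite /= (epsNr heps).
- exact: (Ein_br xd (eb a)).
Qed.

(** Invariance followed by [dual_swap] turns t_(deg x - m) into minus the sum t_m with its two
    factors color-exchanged; the commutation relation then leaves only brackets. *)
Lemma bracket_casimir_sum x d m : x \in bihom d -> bracket_casimir x m + bracket_casimir x (d.1 - m) = Ein (double_bracket_sum x m).
Proof.
move=> xd; have brl : linear (bracket x : g -> g) by exact: bracket_linearr.
have E1 : bracket_casimir x (d.1 - m) = - \sum_(b <- Am (- m)) eps d.2 (- (dg b).2) *:
    (Ein (e' b) * Ein (bracket x (e b))).
  have idl : linear (id : g -> g) by [].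
  by rewrite addrC; exact: (invariance heps he he' (Ein_fl idl) (Ein_fr idl) (- m) xd).
rewrite (dual_swap heps he he' (Ein_fl brl) (Ein_fr brl) (eps d.2) (- m)) opprK in E1.
rewrite E1 /bracket_casimir /double_bracket_sum (lin_sum Ein_linear); apply: swap_bigsum => a.
have h := Ein_br (bihom_br xd (dbi a)) (eb a).
have k : eps (d - dg a).2 (dg a).2 = ep a * eps d.2 (dg a).2.
  by rewrite /= (epsDl heps) (epsNl heps) (epV heps) mulrC.
by rewrite k in h.
Qed.

Lemma beta_bihom x d m : x \in bihom d -> double_bracket_sum x m \in bihom d.
Proof.
move=> xd; apply: bihom_sum => a _.
by have := bihom_br (bihom_br xd (dbi a)) (eb a); rewrite subrK.
Qed.

Lemma tau_Jfil x m : 0 < m -> JJ m (bracket_casimir x m).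
Proof.
move=> m0; apply: (Jfil_sum charK heps (he := he) (he' := he') bco) => a.
rewrite (in_Am he he') => /eqP am.
have -> : Ein (e a) = ofFA eps (@cl_gr _ _ _ g) br e (@gall _ _ _ g) [:w [:: a]].
  by rewrite ofFA_word big_seq1 Ein_inl.
have ap : posw dg [:: a] by rewrite /posw /= /pos am m0.
have := Jfil_left_pos charK heps (he := he) (he' := he') bco bzq (x := Ein (bracket x (e' a))) ap.
by rewrite {1}/wdeg big_seq1 am.
Qed.
End Commutators.

(** * The Kac-Peterson cocycle *)

Lemma fsum_linear (K : fieldType) (I : choiceType) (V W : lmodType K) (f : I -> V -> W) :
  (forall i, linear (f i)) ->
  (forall x, exists E : {fset I}, forall i, i \notin E -> f i x = 0) ->
  linear (fun x => \sum_(i \in [set: I]) f i x).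
Proof.
move=> fl fs c x y; have [E hE] := fs x; have [F hF] := fs y.
have out i : i \notin (E `|` F)%fset -> (i \notin E) && (i \notin F) by rewrite inE negb_or.
rewrite !(@fsbigTE _ _ _ _ (E `|` F)%fset); last first.
- by move=> i /out /andP[/hE xi /hF yi]; rewrite fl xi yi scaler0 addr0.
- by move=> i /out /andP[/hE].
- by move=> i /out /andP[_ /hF].
by rewrite scaler_sumr -big_split; apply: eq_bigr => i _; apply: fl.
Qed.

Section Traces.
Context (K : fieldType) (charK : forall n, n.+1%:R != 0 :> K).
Context (Gam : zmodType) (eps : Gam -> Gam -> K).
Hypothesis heps : commutation_factor eps.
Context (g : zqColorLie eps).
Context (A : choiceType) (e e' : A -> g) (dg : A -> int * Gam).
Hypotheses (he : is_homogeneous_basis e dg) (he' : is_dual_basis e e').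

Local Notation Am := (degree_basis dg).
Local Notation ep a := (eps (dg a).2 (dg a).2).
Local Notation eb := (e_bihom he).
Local Notation dbi := (dual_bihom he he').
Local Notation zqd := (@zq_direct _ _ _ g).
Local Notation cld := (@cl_direct _ _ _ g).
Local Notation beta := (double_bracket_sum e e' dg).

Section Projection.
Context (P : pred int).
Definition proj (x : g) : g :=
  \sum_(i \in [set: int]) if P i then component (@zq_gr _ _ _ g) i x else 0.

Lemma proj_linear : linear proj.
Proof.
apply: fsum_linear => [i c x y|x].
  by case: (P i); [apply: (component_linear zqd)|rewrite scaler0 addr0].
have [E hE] := component_supp zqd x; exists E => i iE; case: ifP => // _.
by apply/eqP; apply: contraNT iE => /hE.
Qed.

Lemma proj_zq i x : x \in zq_gr i -> proj x = if P i then x else 0.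
Proof.
move=> xi; rewrite /proj (@fsbigTE _ _ _ _ [fset i]%fset) => [|j].
  by rewrite big_seq_fset1 (component_id zqd).
by rewrite inE (component_hom zqd j xi) => /negPf ->; case: ifP.
Qed.
End Projection.

Lemma proj_posE (x : g) : proj_pos x = proj (fun i => 0 < i) x.
Proof.
rewrite /proj_pos fsbig_mkcond /proj; apply: eq_fsbigr => i _; rewrite /patch.
by rewrite mem_setE.
Qed.
Lemma proj_negE (x : g) : proj_neg x = proj (fun i => i <= 0) x.
Proof.
rewrite /proj_neg fsbig_mkcond /proj; apply: eq_fsbigr => i _; rewrite /patch.
by rewrite mem_setE.
Qed.

Definition proj_bracket (y z : g) : g := proj_neg (bracket y (proj_pos z)).

Lemma np_linear z : linear (proj_bracket^~ z).
Proof.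
by move=> c x y; rewrite /proj_bracket bracket_linearl !proj_negE; apply: proj_linear.
Qed.

Lemma np_e y a j : y \in zq_gr j ->
  proj_bracket y (e a) = if (0 < (dg a).1) && (j + (dg a).1 <= 0) then bracket y (e a) else 0.
Proof.
move=> yj; rewrite /proj_bracket proj_posE (proj_zq _ (e_zq he a)).
case: ifP => /= _; last by rewrite (lin0 (bracket_linearr y)) proj_negE (lin0 (proj_linear _)).
by rewrite proj_negE (proj_zq _ (zq_bracket yj (e_zq he a))).
Qed.

Definition degrees_upto (n : nat) : {fset A} := fset_set (\bigcup_(r in `I_n.+1) [set a | (dg a).1 = r%:Z]).

Lemma in_Sm n a : (a \in degrees_upto n) = (0 <= (dg a).1 <= n%:Z).
Proof.
rewrite /degrees_upto in_fset_set; last first.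
  by apply: bigcup_finite; [apply: finite_II|move=> r _; apply: (finite_deg he he')].
apply/idP/idP; rewrite inE.
  by case=> r /= rn ->; lia.
by move=> an; exists `|(dg a).1|%N => /=; lia.
Qed.

(** Finiteness of the rank of pi_- ad_y pi_+, which makes the trace sums finite and the traces
    bilinear. *)
Lemma np_supp y : exists n, forall a, a \notin degrees_upto n -> proj_bracket y (e a) = 0.
Proof.
have [E _ hE] := basis_expand he he' y.
have [E' hE' /(_ _ hE') yE] := basis_expand he he' y.
(* A crude bound: a nonzero term forces 0 < deg a <= -deg b for some b in the expansion of y. *)
exists (\sum_(b <- E') `|(dg b).1|%N)%N => a; rewrite in_Sm => an.
rewrite yE (lin_sum (np_linear _)) big_seq big1 // => b bE.
rewrite (linZ (np_linear _)) (np_e _ (e_zq he b)) ifF ?scaler0 //.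
apply: contraNF an => /andP[a0 ba].
have : (`|(dg b).1| <= \sum_(b <- E') `|(dg b).1|)%N.
  by rewrite (big_fsetD1 b bE) leq_addr.
move: (\sum_(b <- E') _)%N => N; lia.
Qed.

Definition half_trace x y := color_trace e e' dg (bracket x \o @proj_neg _ _ _ g \o bracket y \o @proj_pos _ _ _ g).

Lemma trE x y : half_trace x y = \sum_(a \in [set: A]) ep a * form (bracket x (proj_bracket y (e a))) (e' a).
Proof. by []. Qed.

Lemma br0r (x : g) : bracket x 0 = 0.
Proof. exact: (lin0 (bracket_linearr x)). Qed.

Lemma tr_linl y : linear (fun x => half_trace x y : K^o).
Proof.
apply: (@fsum_linear K A g K^o (fun a x => ep a * form (bracket x (proj_bracket y (e a))) (e' a))).
  move=> a c u v; rewrite bracket_linearl form_linearl /GRing.scale /=; ring.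
move=> x; have [n hn] := np_supp y; exists (degrees_upto n) => a /hn ->.
by rewrite br0r form0l mulr0.
Qed.
Lemma tr_linr x : linear (fun y => half_trace x y : K^o).
Proof.
apply: (@fsum_linear K A g K^o (fun a y => ep a * form (bracket x (proj_bracket y (e a))) (e' a))).
  move=> a c u v; rewrite np_linear bracket_linearr form_linearl /GRing.scale /=; ring.
move=> y; have [n hn] := np_supp y; exists (degrees_upto n) => a /hn ->.
by rewrite br0r form0l mulr0.
Qed.

Lemma tr_deg d d' x y : x \in bihom d -> y \in bihom d' -> d' != - d -> half_trace x y = 0.
Proof.
move=> xd yd dd; rewrite trE fsbig1 // => a _; have /andP[yz _] := yd; rewrite (np_e _ yz).
case: ifP => _; last by rewrite br0r form0l mulr0.
have [->|] := eqVneq (form (bracket x (bracket y (e a))) (e' a)) 0; first by rewrite mulr0.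
move=> /(bihom_form (bihom_br xd (bihom_br yd (eb a))) (dbi a)) /eqP.
rewrite eqr_opp addrA -{1}[dg a]add0r => /eqP /addIr /esym /eqP.
by rewrite addrC addr_eq0 (negPf dd).
Qed.

(** A nonzero trace needs deg y = -deg x >= 0, but then ad_y cannot lead from g_+ to g_-. *)
Lemma tr_nonpos d d' x y : x \in bihom d -> y \in bihom d' -> d.1 <= 0 -> half_trace x y = 0.
Proof.
move=> xd yd d0; have [dd|dd] := eqVneq d' (- d); last exact: tr_deg xd yd dd.
rewrite trE fsbig1 // => a _; have /andP[yz _] := yd; rewrite (np_e _ yz).
case: ifP => [|_]; last by rewrite br0r form0l mulr0.
by rewrite dd /=; lia.
Qed.

(** Invariance isolates x on both sides, and two uses of skew symmetry reorder the inner brackets;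
    their signs cancel eps(e_a, e_a). *)
Lemma trace_term d d' x y a : x \in bihom d -> y \in bihom d' ->
  ep a * form (bracket x (bracket y (e a))) (e' a) =
  form (bracket (bracket x (e' a)) (e a)) y.
Proof.
move=> xd yd; have /andP[_ yc] := yd; have /andP[_ ac] := dbi a.
have /andP[_ yac] := bihom_br yd (eb a).
rewrite !form_inv (bracket_skew yac ac) (bracket_skew yc (e_cl he a)).
rewrite (linN (bracket_linearr _)) (linZ (bracket_linearr _)) scalerN opprK scalerA formZr.
rewrite mulrA /= (epsNr heps) (epsDl heps) [X in X * form _ _](_ : _ = 1) ?mul1r //.
have := eps_neq0 heps d'.2 (dg a).2; have := eps_neq0 heps (dg a).2 (dg a).2.
by move=> h1 h2; rewrite invfM; field; rewrite h1 h2.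
Qed.

Lemma sum_degrees (W : zmodType) (F : A -> W) n :
  (forall a, F a != 0 -> (0 < (dg a).1) && ((dg a).1 <= n%:Z)) ->
  \sum_(a \in [set: A]) F a = \sum_(1 <= r < n.+1) \sum_(a <- Am r%:Z) F a.
Proof.
move=> h; rewrite (@fsum_fset _ _ _ (degrees_upto n)); last first.
  by move=> a /h; rewrite in_Sm; lia.
transitivity (\sum_(1 <= r < n.+1) \sum_(a <- degrees_upto n | (dg a).1 == r%:Z) F a); last first.
  apply: eq_big_nat => r rn; rewrite -big_filter; apply: perm_big.
  apply: uniq_perm; rewrite ?filter_uniq ?fset_uniq // => a.
  rewrite mem_filter in_Sm (in_Am he he'); lia.
under [RHS]eq_bigr do rewrite big_mkcond.
rewrite exchange_big; apply: eq_bigr => a _ /=.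
have [F0|/h an] := eqVneq (F a) 0; first by rewrite big1 // => r _; rewrite F0 if_same.
rewrite (bigD1_seq `|(dg a).1|%N) ?iota_uniq //=; last by rewrite mem_index_iota; lia.
rewrite ifT; last by apply/eqP; lia.
by rewrite big1 ?addr0 // => r rn; rewrite ifF //; apply/negP => /eqP rE; lia.
Qed.

(** As deg y = -n, the operator pi_- ad_y pi_+ retains exactly the basis elements of degree 1, ...,
    n. *)
Lemma tr_pos d (n : nat) x y : x \in bihom d -> y \in bihom (- d) -> d.1 = n%:Z ->
  half_trace x y = form (\sum_(1 <= r < n.+1) beta x r%:Z) y.
Proof.
move=> xd yd dn; rewrite form_suml trE (sum_degrees (n := n)).
  apply: eq_big_nat => r rn; rewrite form_suml; apply: eq_big_seq => a.
  rewrite (in_Am he he') => /eqP ar; have /andP[yz _] := yd.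
  by rewrite (np_e _ yz) ifT ?(trace_term _ xd yd) //= dn ar; lia.
move=> a; have /andP[yz _] := yd; rewrite (np_e _ yz) /= dn.
by case: ifP => [h _|_]; [move: h; lia|rewrite br0r form0l mulr0 eqxx].
Qed.

Lemma form_sym_bihom d d' (x y : g) : x \in bihom d -> y \in bihom d' ->
  form x y = eps d.2 d'.2 * form y x.
Proof. by move=> /andP[_ xc] /andP[_ yc]; rewrite (form_sym xc yc). Qed.

(** Follows from color symmetry of the Casimir tensor. It lets the case deg x < 0 be read off the
    trace with x and y exchanged. *)
Lemma beta_skew d x y m : x \in bihom d -> y \in bihom (- d) ->
  form (beta x (- m)) y = eps d.2 (- d).2 * form (beta y m) x.
Proof.
move=> xd yd; rewrite /double_bracket_sum !form_suml.
pose f (u w : g) : K^o := form (bracket x u) (bracket w y).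
have fl w : linear (f^~ w).
  by move=> c u v; rewrite /f bracket_linearr form_linearl.
have fr u : linear (f u).
  by move=> c v w; rewrite /f bracket_linearl form_linearr.
have E := dual_swap heps he he' fl fr (fun=> 1) (- m).
rewrite opprK in E; transitivity (\sum_(b <- Am m) (ep b * 1) *: f (e b) (e' b)).
  by rewrite -E; apply: eq_bigr => a _; rewrite scale1r /f form_inv.
rewrite mulr_sumr; apply: eq_bigr => b _; rewrite mulr1 /f.
have xe := bihom_br xd (eb b); have ey := bihom_br (dbi b) yd.
have /andP[_ xc] := xd; have /andP[_ yc] := yd.
have /andP[_ bc] := dbi b.
rewrite (form_inv (bracket y (e' b))).
rewrite (form_sym_bihom xe ey) (bracket_skew xc (e_cl he b)) (bracket_skew bc yc).
rewrite formNl formZl (linN (form_linr _)) formZr /GRing.scale /=.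
rewrite !(epsDl heps, epsDr heps) !(epsNl heps, epsNr heps).
rewrite [eps (dg b).2 d.2](epsV heps).
have h1 := eps_neq0 heps d.2 (dg b).2; have h2 := eps_neq0 heps (dg b).2 (dg b).2.
have h3 := eps_neq0 heps d.2 d.2; field.
by rewrite h1 h2 h3 oner_eq0.
Qed.

(* The element of degree d = deg x with B(casimir_defect, y) = 2 psiKP(x, y). *)
Definition casimir_defect x (j : int) : g :=
  match j with
  | Posz n => \sum_(1 <= r < n.+1) beta x r%:Z
  | Negz n => - \sum_(1 <= r < n.+2) beta x (- r%:Z)
  end.

Lemma vx_bihom d x : x \in bihom d -> casimir_defect x d.1 \in bihom d.
Proof.
move=> xd; rewrite /casimir_defect; case: d.1 => n; last rewrite -scaleN1r; last apply: bihomZ.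
  by apply: bihom_sum => r _; apply: (beta_bihom he he').
by apply: bihom_sum => r _; apply: (beta_bihom he he').
Qed.

(** At most one of the two traces survives: the first when deg x > 0, the second when deg x < 0. Off
    opposite degrees both sides vanish. *)
Lemma psi_hom d d' x y : x \in bihom d -> y \in bihom d' ->
  2 * psiKP_hom e e' dg d.2 d'.2 x y = form (casimir_defect x d.1) y.
Proof.
move=> xd yd; have n2 : 2 != 0 :> K := charK 1.
have -> : 2 * psiKP_hom e e' dg d.2 d'.2 x y = half_trace x y - eps d.2 d'.2 * half_trace y x.
  rewrite /psiKP_hom -/(half_trace x y) -/(half_trace y x); field; exact: n2.
have [dd|dd] := eqVneq d' (- d); last first.
  rewrite (tr_deg xd yd dd) (tr_deg yd xd); last by rewrite -eqr_oppLR eq_sym.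
  rewrite mulr0 subr0; apply/esym/eqP; apply: contraNT dd.
  by move=> /(bihom_form (vx_bihom xd) yd) ->.
move: yd; rewrite dd => yd; have xd' : x \in bihom (- - d) by rewrite opprK.
rewrite /casimir_defect; case dn : d.1 => [n|n].
  by rewrite (tr_pos xd yd dn) (tr_nonpos yd xd') ?mulr0 ?subr0 //= dn; lia.
(* [Negz n] denotes -(n + 1), so y has degree n + 1. *)
rewrite (tr_nonpos xd yd) ?dn // add0r (tr_pos (n := n.+1) yd xd') /= ?dn //.
rewrite formNl !form_suml mulr_sumr; congr (- _); apply: eq_bigr => r _.
by rewrite (beta_skew _ xd yd).
Qed.

Local Notation clc := (component (@cl_gr _ _ _ g)).

Lemma psiKP_hom_linl a b y : linear (fun x => psiKP_hom e e' dg a b x y : K^o).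
Proof.
move=> c u v; rewrite /psiKP_hom -!/(half_trace _ _) tr_linl (tr_linr y) /GRing.scale /=; ring.
Qed.
Lemma psiKP_hom_linr a b x : linear (fun y => psiKP_hom e e' dg a b x y : K^o).
Proof.
move=> c u v; rewrite /psiKP_hom -!/(half_trace _ _) (tr_linr x) tr_linl /GRing.scale /=; ring.
Qed.

Lemma clc_out x : exists E : {fset Gam}, forall a, a \notin E -> clc a x = 0.
Proof.
have [E hE] := component_supp cld x; exists E => a aE.
by apply/eqP; apply: contraNT aE => /hE.
Qed.

Lemma psiKP_linl y : linear (fun x => psiKP e e' dg x y : K^o).
Proof.
apply: (@fsum_linear K Gam g K^o (fun a x =>
  \sum_(b \in [set: Gam]) psiKP_hom e e' dg a b (clc a x) (clc b y))).
  move=> a c u v; have [E hE] := clc_out y.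
  rewrite !(@fsbigTE _ _ _ _ E) ?scaler_sumr -?big_split /=; last first.
  - by move=> b /hE ->; exact: (lin0 (psiKP_hom_linr _ _ _)).
  - by move=> b /hE ->; exact: (lin0 (psiKP_hom_linr _ _ _)).
  - by move=> b /hE ->; exact: (lin0 (psiKP_hom_linr _ _ _)).
  by apply: eq_bigr => b _; rewrite (component_linear cld) psiKP_hom_linl.
move=> x; have [E hE] := clc_out x; exists E => a /hE ->; rewrite fsbig1 // => b _.
exact: (lin0 (psiKP_hom_linl _ _ _)).
Qed.
Lemma psiKP_linr x : linear (fun y => psiKP e e' dg x y : K^o).
Proof.
have [E hE] := clc_out x.
have l a : linear (fun y => \sum_(b \in [set: Gam]) psiKP_hom e e' dg a b (clc a x) (clc b y) : K^o).
  apply: (@fsum_linear K Gam g K^o (fun b y => psiKP_hom e e' dg a b (clc a x) (clc b y))).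
    by move=> b c u v; rewrite (component_linear cld) psiKP_hom_linr.
  move=> y; have [F hF] := clc_out y; exists F => b /hF ->.
  exact: (lin0 (psiKP_hom_linr _ _ _)).
apply: (@fsum_linear K Gam g K^o (fun a y =>
  \sum_(b \in [set: Gam]) psiKP_hom e e' dg a b (clc a x) (clc b y))) => // y.
exists E => a /hE ->; rewrite fsbig1 // => b _; exact: (lin0 (psiKP_hom_linl _ _ _)).
Qed.

Lemma psiKP_bihom d d' x y : x \in bihom d -> y \in bihom d' ->
  psiKP e e' dg x y = psiKP_hom e e' dg d.2 d'.2 x y.
Proof.
move=> /andP[_ xc] /andP[_ yc]; rewrite /psiKP (@fsbigTE _ _ _ _ [fset d.2]%fset); last first.
  move=> a; rewrite inE (component_hom cld a xc) => /negPf ->; rewrite fsbig1 // => b _.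
  exact: (lin0 (psiKP_hom_linl _ _ _)).
rewrite big_seq_fset1 (@fsbigTE _ _ _ _ [fset d'.2]%fset); last first.
  move=> b; rewrite inE (component_hom cld b yc) => /negPf ->.
  exact: (lin0 (psiKP_hom_linr _ _ _)).
by rewrite big_seq_fset1 (component_id cld xc) (component_id cld yc).
Qed.

Section Sharp.
Context (rho : {scalar g}) (hrho : in_restricted_dual 0 rho).

Lemma rho_sum (I : Type) (r : seq I) (c : I -> K) (F : I -> g) :
  rho (\sum_(i <- r) c i *: F i) = \sum_(i <- r) c i * rho (F i).
Proof. by rewrite linear_sum; apply: eq_bigr => i _; rewrite linearZ. Qed.

(** The expansion of rho in the dual basis; only degree 0 occurs, so the sum is finite. The factor
    [ep a] undoes the sign in [form_dual_e]. *)
Lemma sharp_exists : exists2 v, v \in bihom 0 & forall y, form v y = rho y.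
Proof.
pose v := \sum_(a <- Am 0) (ep a * rho (e a)) *: e' a.
have rho0 a : dg a != 0 -> rho (e a) = 0.
  by move=> a0; apply: (hrho (d' := dg a)); [rewrite oppr0|apply: eb].
exists v => [|y].
  apply: bihom_sum => a _; have [a0|/rho0 ->] := eqVneq (dg a) 0.
    by apply: bihomZ; have := dbi a; rewrite a0 oppr0.
  by rewrite mulr0 scale0r bihom0.
have [E hE /(_ _ hE) ->] := basis_expand he he' y.
rewrite form_sumr rho_sum; apply: eq_bigr => b _; rewrite formZr; congr (_ * _).
rewrite /v form_suml; have [bm|bm] := boolP (b \in Am 0).
  rewrite (bigD1_seq b) ?fset_uniq //= big1 => [|a ab]; last first.
    by rewrite formZl (form_dual_e heps he he') (negPf ab) !mulr0.
  by rewrite formZl (form_dual_e heps he he') eqxx mulr1 addr0 mulrAC (ep_sqr heps) mul1r.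
rewrite big_seq big1 => [|a am].
  by rewrite rho0 //; apply: contraNneq bm => b0; rewrite (in_Am he he') b0.
rewrite formZl (form_dual_e heps he he'); case: eqP => [ab|_]; last by rewrite !mulr0.
by rewrite -ab am in bm.
Qed.

Lemma sharpP : sharp rho \in bihom 0 /\ forall y, form (sharp rho) y = rho y.
Proof.
have [v v0 vP] := sharp_exists; rewrite /sharp; case: xgetP => [w _ /= wP|/(_ v)]; last by [].
split=> //; rewrite (_ : w = v) //; apply/eqP; rewrite -subr_eq0; apply/eqP.
apply: form_nondegl => y; by rewrite (linB (form_linl y)) wP vP subrr.
Qed.

(** The element of g to which the commutator of x with long partial sums of Omega reduces, up to
    deep terms. *)
Definition central_defect x j := casimir_defect x j + 2 *: bracket x (sharp rho).

Lemma wx_bihom d x : x \in bihom d -> central_defect x d.1 \in bihom d.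
Proof.
move=> xd; apply: bihomD; first exact: vx_bihom.
by apply: bihomZ; have := bihom_br xd sharpP.1; rewrite addr0.
Qed.

Lemma form_wx d d' x y : x \in bihom d -> y \in bihom d' ->
  form (central_defect x d.1) y = 2 * (psiKP e e' dg x y - coboundary rho x y).
Proof.
move=> xd yd; rewrite /central_defect (linD (form_linl y)) -(psi_hom xd yd) (psiKP_bihom xd yd).
have /andP[_ xc] := xd; have /andP[_ sc] := sharpP.1.
rewrite formZl (bracket_skew xc sc) formNl formZl (eps0r heps) mul1r form_inv sharpP.2.
by rewrite -mulrDr.
Qed.

Lemma psi_coboundary : psiKP e e' dg =2 coboundary rho <->
  forall a, central_defect (e a) (dg a).1 = 0.
Proof.
split=> [h a|h x y].
  apply: (form_e_eq0 he he') => b.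
  by rewrite (form_wx (eb a) (eb b)) h subrr mulr0.
have hab a b : psiKP e e' dg (e a) (e b) = coboundary rho (e a) (e b).
  have /eqP := form_wx (eb a) (eb b); rewrite h form0l eq_sym mulf_eq0.
  by rewrite (negPf (charK 1)) subr_eq0 => /eqP.
have [E hE /(_ _ hE) ->] := basis_expand he he' x.
have [F hF /(_ _ hF) ->] := basis_expand he he' y.
rewrite (bilin_sum (f := fun x y => psiKP e e' dg x y : K^o) psiKP_linl psiKP_linr).
have cl y' : linear (fun x' => coboundary rho x' y' : K^o).
  by move=> c u v; rewrite /coboundary bracket_linearl linearP.
have cr x' : linear (fun y' => coboundary rho x' y' : K^o).
  by move=> c u v; rewrite /coboundary bracket_linearr linearP.
rewrite (bilin_sum (f := fun x y => coboundary rho x y : K^o) cl cr).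
by apply: eq_bigr => a _; apply: eq_bigr => b _; rewrite hab.
Qed.
End Sharp.
End Traces.

(** * Commutators with partial sums of the Casimir element *)

Lemma commutator_split (B : pzRingType) (X c0 C : B) :
  X * (c0 + C *+ 2) - (c0 + C *+ 2) * X = (X * c0 - c0 * X) + (X * C - C * X) *+ 2.
Proof.
by rewrite mulrDr mulrDl mulrnAr mulrnAl opprD addrACA mulrnBl.
Qed.

Lemma commutator_sum_eq (B : pzRingType) (I : Type) (r : seq I) (X : B) (P R : I -> B) :
  (forall i, X * P i - P i * X = R i) ->
  X * (\sum_(i <- r) P i) - (\sum_(i <- r) P i) * X = \sum_(i <- r) R i.
Proof.
by move=> h; rewrite mulr_sumr mulr_suml -sumrB; apply: eq_bigr => i _.
Qed.

Lemma sub_eq_opp (W : zmodType) (p q r : W) : p = q - r -> p - q = - r.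
Proof. by move=> ->; rewrite addrAC subrr add0r. Qed.

Section CasimirCommutator.
Context (K : fieldType) (charK : forall n, n.+1%:R != 0 :> K).
Context (Gam : zmodType) (eps : Gam -> Gam -> K).
Hypothesis heps : commutation_factor eps.
Context (g : zqColorLie eps).
Context (A : choiceType) (e e' : A -> g) (dg : A -> int * Gam).
Hypotheses (he : is_homogeneous_basis e dg) (he' : is_dual_basis e e').

Local Notation br := (@bracket _ _ _ g).
Local Notation U := (env eps (@cl_gr _ _ _ g) br (@gall _ _ _ g)).
Local Notation JJ := (@Jfil _ _ _ _ _ _ _ _ he he' br).
Local Notation bco := (bracket_color g).
Local Notation cas := (casimir_part e e' dg).
Local Notation tau := (bracket_casimir e e' dg).
Local Notation vx := (casimir_defect e e' dg).

(* cas r and cas (- r) agree up to reordering the factors, hence the factor 2. *)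
Definition csum (N : nat) : U := cas 0 + (\sum_(1 <= r < N.+1) cas r%:Z) *+ 2.

Lemma comm_cas_sum (G H : nat -> U) x d N :
  x \in bihom d -> (forall r : nat, Ein x * cas r%:Z - cas r%:Z * Ein x = G r - H r) ->
  Ein x * csum N - csum N * Ein x = (G 0 - H 0) + (\sum_(1 <= r < N.+1) (G r - H r)) *+ 2.
Proof.
move=> xd h; apply: etrans (commutator_split _ _ _) _; rewrite (h 0).
congr (_ + _ *+ 2); exact: commutator_sum_eq.
Qed.

Lemma Jfil_tail (F : nat -> U) M m n :
  (forall r, (m <= r)%N -> JJ M (F r)) -> JJ M (- ((\sum_(m <= r < n) F r) *+ 2)).
Proof.
move=> h; apply: (JfilN charK heps (he := he) (he' := he') bco).
have hs : JJ M (\sum_(m <= r < n) F r).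
  apply: (Jfil_sum charK heps (he := he) (he' := he') bco) => r.
  by rewrite mem_index_iota => /andP[/h].
exact: (JfilD charK heps (he := he) (he' := he') bco hs hs).
Qed.

(* The sum telescopes because [x, cas m] = tau x m - tau x (m + d.1); the terms
   near r = 0 combine to casimir_defect by bracket_casimir_sum, those near r = N lie deep
   in the filtration. *)
Lemma comm_csum x d N : x \in bihom d ->
  JJ (N%:Z + 1 - `|d.1|) (Ein x * csum N - csum N * Ein x - Ein (vx x d.1)).
Proof.
move=> xd; have cx := comm_cas heps he he'; have tJ r : 0 < r -> JJ r (tau x r) by exact: tau_Jfil.
case dn : d.1 => [n|n].
- pose G r := tau x r%:Z.
  have h (r : nat) : Ein x * cas r%:Z - cas r%:Z * Ein x = G r - G (r + n)%N.
    by rewrite (cx _ _ r xd) dn.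
  have E : Ein (vx x n) = \sum_(1 <= r < n.+1) (G (n - r)%N + G r).
    rewrite /casimir_defect (lin_sum (@Ein_linear _ _ _ g)); apply: eq_big_nat => r rn.
    rewrite -(bracket_casimir_sum heps he he' r xd) dn addrC; congr (tau x _ + _); lia.
  rewrite (comm_cas_sum N xd h) add0n telescope_sum E.
  rewrite (sub_eq_opp (erefl _)); apply: Jfil_tail => r Nr.
  apply: (JfilW (M := r%:Z)); [lia|apply: tJ; lia].
(* For deg x = -(n + 1) the sign and the shifted index restore the shape G r - G (r + n + 1). A tail
   index r > N now stands for t_(r - n - 1), which is why the depth is only N + 1 - |deg x|. *)
- pose G (k : nat) := - tau x (k%:Z - n.+1%:Z).
  have h (r : nat) : Ein x * cas r%:Z - cas r%:Z * Ein x = G r - G (r + n.+1)%N.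
    rewrite (cx _ _ r xd) dn opprK addrC; congr (- tau x _ + tau x _); lia.
  have E : Ein (vx x (Negz n)) = \sum_(1 <= r < n.+2) (G (n.+1 - r)%N + G r).
    rewrite /casimir_defect (linN (@Ein_linear _ _ _ g)) (lin_sum (@Ein_linear _ _ _ g)) -sumrN.
    apply: eq_big_nat => r rn.
    rewrite -(bracket_casimir_sum heps he he' _ xd) dn opprD; congr (- tau x _ - tau x _); lia.
  rewrite (comm_cas_sum N xd h) add0n telescope_sum E.
  rewrite (sub_eq_opp (erefl _)); apply: Jfil_tail => r Nr.
  apply: (JfilN charK heps (he := he) (he' := he') bco).
  (* [tau_Jfil] speaks of positive indices; at a nonpositive level the filtration is the whole
     algebra. *)
  have [rn|rn] := lerP (r%:Z - n.+1%:Z) 0.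
    by apply: Jfil_le0; lia.
  by apply: (JfilW (M := r%:Z - n.+1%:Z)); [lia|apply: tJ].
Qed.
End CasimirCommutator.

(** * Products in the completion *)

Section StripSums.
Context (W : zmodType) (I : choiceType).

Lemma fsum_strip (f : I * nat -> W) i N :
  (forall p, f p != 0 -> (p.1 == i) && (p.2 <= N)%N) ->
  \sum_(p \in [set: I * nat]) f p = \sum_(0 <= r < N.+1) f (i, r).
Proof.
move=> h; have us : uniq [seq (i, r) | r <- index_iota 0 N.+1].
  by rewrite map_inj_uniq ?iota_uniq // => r s [].
rewrite (@fsum_fset _ _ _ [fset p in [seq (i, r) | r <- index_iota 0 N.+1]]%fset).
  rewrite (perm_big [seq (i, r) | r <- index_iota 0 N.+1]) ?big_map //.
  apply: uniq_perm; [exact: fset_uniq|exact: us|move=> p].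
  by rewrite !inE.
move=> p fp; have /andP[/eqP pi pN] := h p fp.
rewrite in_fset; apply/mapP; exists p.2.
  by rewrite mem_index_iota.
by rewrite [LHS]surjective_pairing pi.
Qed.

Lemma fsum_strip2 (c : I * nat -> I * nat -> W) i j N M :
  (forall p q, c p q != 0 -> [&& p.1 == i, q.1 == j, p.2 <= N & q.2 <= M]%N) ->
  \sum_(p \in [set: I * nat]) \sum_(q \in [set: I * nat]) c p q =
  \sum_(0 <= r < N.+1) \sum_(0 <= s < M.+1) c (i, r) (j, s).
Proof.
move=> h; rewrite (fsum_strip (i := i) (N := N)).
  by apply: eq_bigr => r _; apply: fsum_strip => q /h /and4P[_ -> _ ->].
move=> p; apply: contraNT => pN; rewrite fsbig1 // => q _.
by apply/eqP; apply: contraNT pN => /h /and4P[-> _ ->].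
Qed.
End StripSums.

Section NormalComponents.
Context (K : fieldType) (charK : forall n, n.+1%:R != 0 :> K).
Context (Gam : zmodType) (eps : Gam -> Gam -> K).
Hypothesis heps : commutation_factor eps.
Context (g : zqColorLie eps).
Context (A : choiceType) (e e' : A -> g) (dg : A -> int * Gam).
Hypotheses (he : is_homogeneous_basis e dg) (he' : is_dual_basis e e').
Context (br : g -> g -> g).
Hypothesis hbr : color_bracket eps (@cl_gr _ _ _ g) br.
Hypothesis br_zq : forall i j x y, x \in zq_gr i -> y \in zq_gr j -> br x y \in zq_gr (i + j).

Local Notation U := (env eps (@cl_gr _ _ _ g) br (@gall _ _ _ g)).
Local Notation ngr := (@normal_gr _ _ _ _ br).
Local Notation JJ := (@Jfil _ _ _ _ _ _ _ _ he he' br).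
Local Notation hom := (@homog _ _ _ _ _ _ _ _ he he' br).
Local Notation nm := (@normal_mul _ _ _ _ br).
Local Notation cmp := (@bidegree_part _ _ _ _ br).
Local Notation ngrd := (normal_gr_direct charK heps he he' hbr br_zq).

Lemma nm_gr t p : t \in ngr p -> JJ p.2%:Z (nm t) /\ hom p.1 (nm t).
Proof.
move=> /(Phi_gr charK heps (he := he) (he' := he') hbr br_zq) h.
split; apply: supW _ h => w [_ wp]; last by rewrite -wp.
by rewrite -wtypeE wp.
Qed.

Lemma cmp_nm t p k : t \in ngr p -> cmp k (nm t) = if k == p then t else 0.
Proof.
move=> tp; rewrite /bidegree_part (normal_mulK charK heps he he' hbr br_zq).
exact: (component_hom ngrd.1 k tp).
Qed.

Lemma cmp_in k u : cmp k u \in ngr k.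
Proof. exact: (component_in ngrd.1). Qed.

Lemma cmp_sum d u : hom d u ->
  exists R, forall N, (R <= N)%N -> u = \sum_(0 <= r < N.+1) nm (cmp (d, r) u).
Proof.
move=> ud; have [E hE] := component_supp ngrd.1 (normal_form u).
exists (\sum_(k <- E) k.2)%N => N RN.
have EN k : component ngr k (normal_form u) != 0 -> (k.1 == d) && (k.2 <= N)%N.
  move=> nk; apply/andP; split.
    apply: contraNT nk => kd; case: k kd => d' r /= dd.
    by apply/eqP; apply: (cmp_homog charK heps hbr br_zq r ud); rewrite eq_sym.
  by apply: leq_trans RN; rewrite (big_fsetD1 k (hE _ nk)) leq_addr.
have := normal_formK charK heps he he' hbr br_zq u.
have [_ _ nE] := componentP ngrd.1 (normal_form u).
rewrite {1}nE (fsum_strip EN) => {1}<-; exact: (lin_sum (normal_mulP br).1).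
Qed.

Section Products.
Context (z u : series br) (zgr : forall d r, z d r \in ngr (d, r)).
Context (ugr : forall d r, u d r \in ngr (d, r)).
Hypothesis z0 : forall d, d != 0 -> z d = 0.

Definition partial (w : series br) d N : U := \sum_(0 <= r < N.+1) nm (w d r).

Lemma prod_cmp k N M (c : nat -> nat -> U) :
  \sum_(0 <= r < N.+1) \sum_(0 <= s < M.+1) cmp k (c r s) =
  cmp k (\sum_(0 <= r < N.+1) \sum_(0 <= s < M.+1) c r s).
Proof.
rewrite (lin_sum (cmp_linear charK heps he he' hbr br_zq k)); apply: eq_bigr => r _.
by rewrite (lin_sum (cmp_linear charK heps he he' hbr br_zq k)).
Qed.

Lemma cmp0 k : cmp k 0 = 0.
Proof. exact: (lin0 (cmp_linear charK heps he he' hbr br_zq k)). Qed.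
Lemma nm0 : nm 0 = 0.
Proof. exact: (lin0 (normal_mulP br).1). Qed.

Lemma cmp_mul_neq0 d t s s' v v' : s \in ngr v -> s' \in ngr v' ->
  cmp (d, t) (nm s * nm s') != 0 ->
  [/\ v.1 + v'.1 = d, (v'.2 <= t)%N & v.2%:Z + v'.1.1 <= t%:Z].
Proof.
move=> sv sv'; have [Js hs] := nm_gr sv; have [Js' hs'] := nm_gr sv'.
have hss := homogM charK heps hbr br_zq hs hs'.
have J1 := Jfil_left charK heps hbr br_zq (x := nm s) Js'.
have J2 := Jfil_right charK heps hbr br_zq Js hs'.
move: (nm s * nm s') hss J1 J2 => w hw J1 J2 nz; split.
- have [//|vd] := eqVneq (v.1 + v'.1) d.
  by rewrite (cmp_homog charK heps hbr br_zq t hw vd) eqxx in nz.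
- rewrite leqNgt; apply: contraNN nz => tq; apply/eqP.
  by apply: (cmp_Jfil charK heps hbr br_zq _ J1); rewrite ltz_nat.
- rewrite leNgt; apply: contraNN nz => tq; apply/eqP.
  exact: (cmp_Jfil charK heps hbr br_zq _ J2).
Qed.

Lemma distr_nm N M d d' (v w : series br) :
  partial v d N * partial w d' M =
  \sum_(0 <= r < N.+1) \sum_(0 <= s < M.+1) nm (v d r) * nm (w d' s).
Proof. by rewrite /partial mulr_suml; apply: eq_bigr => r _; rewrite mulr_sumr. Qed.

Lemma z_neq0 k p w : cmp k (nm (z p.1 p.2) * w) != 0 -> p.1 = 0.
Proof.
apply: contraNeq => /z0 zp; have -> : nm (z p.1 p.2) = 0 by rewrite zp; exact: nm0.
by rewrite mul0r cmp0.
Qed.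
Lemma z_neq0r k p w : cmp k (w * nm (z p.1 p.2)) != 0 -> p.1 = 0.
Proof.
apply: contraNeq => /z0 zp; have -> : nm (z p.1 p.2) = 0 by rewrite zp; exact: nm0.
by rewrite mulr0 cmp0.
Qed.

(** A term z_r u_s reaches the component t only if s <= t and r + d.1 <= t, whence the two
    bounds. *)
Lemma series_mul_left d t N M : (t + `|d.1| <= N)%N -> (t <= M)%N ->
  series_mul z u d t = cmp (d, t) (partial z 0 N * partial u d M).
Proof.
move=> tN tM; rewrite distr_nm -prod_cmp.
pose c (p q : int * Gam * nat) := cmp (d, t) (nm (z p.1 p.2) * nm (u q.1 q.2)).
apply: (@fsum_strip2 (normal br) _ c) => p q pq.
have p0 := z_neq0 pq; have [qd q2 p2] := cmp_mul_neq0 (zgr p.1 p.2) (ugr q.1 q.2) pq.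
rewrite /= p0 add0r in qd; rewrite /= qd in q2 p2.
by rewrite p0 qd !eqxx /=; lia.
Qed.

Lemma series_mul_right d t N M : (t <= N)%N -> (t <= M)%N ->
  series_mul u z d t = cmp (d, t) (partial u d M * partial z 0 N).
Proof.
move=> tN tM; rewrite distr_nm -prod_cmp.
apply: (fsum_strip2 (c := fun p q => cmp (d, t) (nm (u p.1 p.2) * nm (z q.1 q.2)))) => q p pq.
have p0 := z_neq0r pq; have [qd q2 p2] := cmp_mul_neq0 (ugr q.1 q.2) (zgr p.1 p.2) pq.
rewrite /= p0 addr0 in qd; rewrite /= p0 in q2 p2.
rewrite p0 qd !eqxx /=; move: p2 => /=; lia.
Qed.
End Products.

Lemma series_mul0l (u : series br) : series_mul 0 u = 0.
Proof.
apply: funext => d; apply: funext => t; rewrite /series_mul fsbig1 // => p _; rewrite fsbig1 // => q _.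
have -> : nm ((0 : series br) p.1 p.2) = 0 by exact: nm0.
by rewrite mul0r; exact: cmp0.
Qed.
Lemma series_mul0r (u : series br) : series_mul u 0 = 0.
Proof.
apply: funext => d; apply: funext => t; rewrite /series_mul fsbig1 // => p _; rewrite fsbig1 // => q _.
have -> : nm ((0 : series br) q.1 q.2) = 0 by exact: nm0.
by rewrite mulr0; exact: cmp0.
Qed.

Lemma cmp_sub_eq k (x y : normal br) P Q : x = cmp k P -> y = cmp k Q ->
  cmp k (P - Q) = 0 -> x = y.
Proof.
move=> -> -> h; apply/eqP; rewrite -subr_eq0; apply/eqP.
by rewrite -(linB (cmp_linear charK heps he he' hbr br_zq k)).
Qed.
Lemma eq_cmp_sub k (x y : normal br) P Q : x = cmp k P -> y = cmp k Q ->
  x = y -> cmp k (P - Q) = 0.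
Proof.
move=> -> -> h; rewrite (linB (cmp_linear charK heps he he' hbr br_zq k)) h.
exact: subrr.
Qed.

Section Central.
Context (z : series br) (zgr : forall d r, z d r \in ngr (d, r)).
Hypothesis z0 : forall d, d != 0 -> z d = 0.

Lemma z_component a : series_component a z = if a == 0 then z else 0.
Proof.
apply: funext => d; apply: funext => r; rewrite /series_component.
have [->|a0] := eqVneq a 0; case: eqP => // da; rewrite z0 //.
  by apply/eqP => d0; apply: da; rewrite d0.
by apply: contraNneq a0 => d0; rewrite -da d0.
Qed.

Lemma z_completion : in_completion z.
Proof.
split=> //; apply: sub_finite_set (finite_set1 (0 : int * Gam)) => d /=.
by apply: contra_neq_eq => /z0.
Qed.

(* The partial sums of z commute with u up to terms deep in the filtration. *)
Definition asym_central (u : U) := forall t : int, exists N0, forall N, (N0 <= N)%N ->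
  JJ t (partial z 0 N * u - u * partial z 0 N).

Lemma central_suff : (forall u, asym_central u) -> in_center z.
Proof.
move=> zc; split=> [|a b u [ugr ufin] ub]; first exact: z_completion.
rewrite z_component; case: eqP => [->|_]; last by rewrite series_mul0l series_mul0r scaler0.
rewrite (eps0l heps) scale1r; apply: funext => d; apply: funext => t.
(* The component of index t sees only the terms of u up to t, and it vanishes on the filtration from
   level t + 1 on. *)
have [N0 hN] := zc (partial u d t) (t%:Z + 1).
pose N := (N0 + (t + `|d.1|))%N.
have E1 : series_mul z u d t = cmp (d, t) (partial z 0 N * partial u d t).
  by apply: (series_mul_left zgr ugr z0); rewrite ?leq_addl.
have E2 : series_mul u z d t = cmp (d, t) (partial u d t * partial z 0 N).
  by apply: (series_mul_right zgr ugr z0) => //; rewrite /N; lia.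
apply: (cmp_sub_eq E1 E2); apply: (cmp_Jfil charK heps hbr br_zq _ (hN N _)).
  exact: leq_addr.
by rewrite ltrDl.
Qed.

Lemma series_of_completion d w : hom d w -> in_completion (series_of w) /\
  series_component d.2 (series_of w) = series_of w.
Proof.
move=> wd; have out d' r : d' != d -> series_of w d' r = 0.
  move=> dd; apply: (cmp_homog charK heps hbr br_zq r wd); by rewrite eq_sym.
split; first split.
- by move=> d' r; apply: cmp_in.
- apply: sub_finite_set (finite_set1 d) => d' /=; apply: contra_neq_eq => dd.
  by apply: funext => r; exact: out.
apply: funext => d'; apply: funext => r; rewrite /series_component.
by case: eqP => // dd; rewrite out //; apply: contra_notN dd => /eqP ->.
Qed.

(** Elements of the enveloping algebra itself, read as series, are admissible test elements for
    centrality. *)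
Lemma central_nec : in_center z -> forall d w, hom d w -> forall t : nat,
  exists N0, forall N, (N0 <= N)%N ->
    cmp (d, t) (partial z 0 N * w - w * partial z 0 N) = 0.
Proof.
move=> [_ zc] d w wd t; have [wc wd2] := series_of_completion wd.
have [R hR] := cmp_sum wd; exists (t + `|d.1|)%N => N tN.
have := zc 0 d.2 _ wc wd2; rewrite z_component eqxx (eps0l heps) scale1r.
move/(congr1 (fun f : series br => f d t)).
(* At least R terms recover w exactly, and at least t terms determine the component t of the
   products. *)
have pw : partial (series_of w) d (R + t) = w by apply/esym/hR/leq_addr.
have E1 : series_mul z (series_of w) d t = cmp (d, t) (partial z 0 N * partial (series_of w) d (R + t)).
  by apply: (series_mul_left zgr wc.1 z0) => //; apply: leq_addl.
have E2 : series_mul (series_of w) z d t = cmp (d, t) (partial (series_of w) d (R + t) * partial z 0 N).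
  by apply: (series_mul_right zgr wc.1 z0); [lia|apply: leq_addl].
rewrite pw in E1 E2; exact: eq_cmp_sub E1 E2.
Qed.
End Central.
End NormalComponents.

(** * Components of the normal-ordered Casimir element *)

Lemma prod2 (B : pzSemiRingType) (f : 'I_2 -> B) : \prod_(i < 2) f i = f ord0 * f ord_max.
Proof. by rewrite big_ord_recl big_ord1; congr (_ * f _); apply: val_inj. Qed.
Lemma sum2 (B : nmodType) (f : 'I_2 -> B) : \sum_(i < 2) f i = f ord0 + f ord_max.
Proof. by rewrite big_ord_recl big_ord1; congr (_ + f _); apply: val_inj. Qed.

Lemma mul_eq1 (B : pzSemiRingType) (p q r : B) : p = r -> q = 1 -> p * q = r.
Proof. by move=> -> ->; rewrite mulr1. Qed.

Lemma addr_eq0_r (B : zmodType) (p q r : B) : p = q + r -> r = 0 -> p = q.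
Proof. by move=> -> ->; rewrite addr0. Qed.

Section Letters.
Context (K : fieldType) (Gam : zmodType) (eps : Gam -> Gam -> K).
Context (g : zqColorLie eps) (br : g -> g -> g).
Local Notation inl := (inl eps (@cl_gr _ _ _ g) br).
Local Notation nm := (@normal_mul _ _ _ _ br).
Local Notation ngr := (@normal_gr _ _ _ _ br).

Lemma inl_env_gr (h : {pred g}) d x : x \in h -> x \in bihom d ->
  inl h x \in env_gr (br := br) (h := h) d.
Proof.
move=> xh xd; apply: mem_lspan; exists 1%N, (fun=> letterS xh), (fun=> d).
by rewrite !big_ord1 -(inlE eps (@cl_gr _ _ _ g) br (letterS xh)).
Qed.

Lemma inl2_env_gr (h : {pred g}) d d' x y :
  x \in h -> y \in h -> x \in bihom d -> y \in bihom d' ->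
  inl h x * inl h y \in env_gr (br := br) (h := h) (d + d').
Proof.
move=> xh yh xd yd; apply: mem_lspan.
exists 2%N, (fun i => if i == ord0 then letterS xh else letterS yh),
  (fun i => if i == ord0 then d else d').
split=> [i||]; first by case: eqP.
  exact: sum2.
apply: etrans (esym (prod2 _)); rewrite /=.
rewrite -(inlE eps (@cl_gr _ _ _ g) br (letterS xh)).
by rewrite -(inlE eps (@cl_gr _ _ _ g) br (letterS yh)).
Qed.

Lemma env_gr1 (h : {pred g}) : 0 \in h -> 1 \in env_gr (br := br) (h := h) 0.
Proof.
move=> h0; apply: mem_lspan; exists 0, (fun=> letterS h0), (fun=> 0).
by split=> [[]//||]; [apply: big_ord0|apply/esym; apply: big_ord0].
Qed.

Lemma bihom_gneg d (x : g) : d.1 <= 0 -> x \in bihom d -> x \in @gneg _ _ _ g.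
Proof. by move=> d0 /andP[xz _]; apply: mem_lspan; exists d.1. Qed.
Lemma bihom_gpos d (x : g) : 0 < d.1 -> x \in bihom d -> x \in @gpos _ _ _ g.
Proof. by move=> d0 /andP[xz _]; apply: mem_lspan; exists d.1. Qed.

Lemma tens_gr d d' x y : d.1 <= 0 -> 0 < d'.1 -> x \in bihom d -> y \in bihom d' ->
  tens (inl _ x) (inl _ y) \in ngr (d + d', `|d'.1|%N).
Proof.
move=> d0 d'0 xd yd; apply: mem_lspan; exists d.2, d'.2, (inl _ x), (inl _ y); split=> //.
  have := inl_env_gr (bihom_gneg d0 xd) xd; congr (_ \in env_gr _).
  by rewrite [LHS]surjective_pairing /= gtz0_abs // addrK.
have := inl_env_gr (bihom_gpos d'0 yd) yd; congr (_ \in env_gr _).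
by rewrite [LHS]surjective_pairing /= gtz0_abs.
Qed.

Lemma tens_gr1 d d' x y : d.1 = 0 -> d'.1 = 0 -> x \in bihom d -> y \in bihom d' ->
  tens (inl _ x * inl _ y) 1 \in ngr (d + d', 0).
Proof.
move=> d0 d'0 xd yd; apply: mem_lspan; exists (d + d').2, 0, (inl _ x * inl _ y), 1; split=> //.
- by rewrite addr0.
- have := inl2_env_gr (bihom_gneg _ xd) (bihom_gneg _ yd) xd yd; rewrite d0 d'0 => /(_ _ _).
  by rewrite subr0; apply.
- by apply: env_gr1; rewrite rpred0.
Qed.

Lemma nm_tens x y : x \in @gneg _ _ _ g -> y \in @gpos _ _ _ g ->
  nm (tens (inl _ x) (inl _ y)) = inl (@gall _ _ _ g) x * inl (@gall _ _ _ g) y.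
Proof. by move=> xn yp; rewrite (normal_mulP br).2 !incl_inl. Qed.

Lemma nm_tens1 x y : x \in @gneg _ _ _ g -> y \in @gneg _ _ _ g ->
  nm (tens (inl _ x * inl _ y) 1) = inl (@gall _ _ _ g) x * inl (@gall _ _ _ g) y.
Proof.
move=> xn yn; apply: etrans ((normal_mulP br).2 _ _) _; apply: mul_eq1.
  by apply: etrans (inclM _ _) _; congr (_ * _); apply: incl_inl.
by have [_ i1 _ _] := inclP br (@gpos _ _ _ g); exact: i1.
Qed.
End Letters.

(** * Symmetrization of at most two letters *)

Lemma perm0 (s : 'S_0) : s = 1%g.
Proof. by apply/permP => -[]. Qed.
Lemma perm1E (s : 'S_1) : s = 1%g.
Proof. by apply/permP => i; rewrite !ord1. Qed.
Lemma ord2 (i : 'I_2) : i = ord0 \/ i = ord_max.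
Proof. by case: i => -[|[|//]] i; [left|right]; apply: val_inj. Qed.
Lemma perm2 (s : 'S_2) : s = 1%g \/ s = tperm ord0 ord_max.
Proof.
have h : s ord0 <> s ord_max by move/perm_inj.
have [h0|h0] := ord2 (s ord0); have [h1|h1] := ord2 (s ord_max).
- by rewrite h0 h1 in h.
- by left; apply/permP => i; case: (ord2 i) => ->; rewrite perm1.
- by right; apply/permP => i; case: (ord2 i) => ->; rewrite ?tpermL ?tpermR.
- by rewrite h0 h1 in h.
Qed.

Section SmallSymmetrizations.
Context (K : fieldType) (Gam : zmodType) (eps : Gam -> Gam -> K) (B : lalgType K).

Lemma symV0 (x : 'I_0 -> B) d : symV eps x d = 1.
Proof.
rewrite /symV invr1 scale1r (big_pred1 (1%g : 'S_0)) => [|s]; last by rewrite [s]perm0 /= eqxx.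
by rewrite big_ord0 /perm_factor big_ord0 scale1r.
Qed.

Lemma symV1 (x : 'I_1 -> B) d : symV eps x d = x ord0.
Proof.
rewrite /symV invr1 scale1r (big_pred1 (1%g : 'S_1)) => [|s]; last by rewrite [s]perm1E /= eqxx.
rewrite big_ord1 perm1 /perm_factor big_ord1 big1 ?scale1r // => i.
by rewrite (ord1 i) ltnn.
Qed.

Lemma symV2 (x : 'I_2 -> B) d : symV eps x d =
  2^-1 *: (x ord0 * x ord_max + eps (d ord0) (d ord_max) *: (x ord_max * x ord0)).
Proof.
have t1 : tperm ord0 (ord_max : 'I_2) != 1%g.
  apply/eqP => /permP/(_ ord0); rewrite tpermL perm1 => /(congr1 val); by [].
rewrite /symV (bigD1 (1%g : 'S_2)) // (bigD1 (tperm ord0 (ord_max : 'I_2))) //=. rewrite [X in _ + (_ + X)]big1 => [|s /andP[s1 s2]].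
  rewrite addr0 !prod2 !perm1 tpermL tpermR; congr (_ *: (_ + _ *: _)).
    rewrite -[RHS]scale1r; congr (_ *: _); rewrite /perm_factor big1 // => i _.
    by rewrite big1 // => j /andP[ij]; rewrite invg1 !perm1 ltnNge (ltnW ij).
  rewrite /perm_factor big_ord_recl big_ord1 tpermV.
  rewrite [X in _ * X]big1 => [|j /andP[]]; last first.
    by case: (ord2 j) => ->.
  rewrite mulr1 (big_pred1 ord_max) // => j.
  by case: (ord2 j) => -> //=; rewrite tpermL tpermR.
by case: (perm2 s) s1 s2 => ->; rewrite eqxx.
Qed.
End SmallSymmetrizations.

Section SymmetrizationValues.
Context (K : fieldType).
Context (Gam : zmodType) (eps : Gam -> Gam -> K).
Context (g : zqColorLie eps) (h : {pred g}) (Q : env eps (@cl_gr _ _ _ g) (fun _ _ => 0) h ->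
  env eps (@cl_gr _ _ _ g) (@bracket _ _ _ g) h).
Hypothesis hQ : is_symmetrization Q.
Local Notation inlz := (inl eps (@cl_gr _ _ _ g) (fun _ _ => 0) h).
Local Notation inlb := (inl eps (@cl_gr _ _ _ g) (@bracket _ _ _ g) h).

Lemma sym_one : 0 \in h -> Q 1 = 1.
Proof.
move=> h0; have E := hQ.2 0%N (fun=> letterS h0) (fun=> 0).
have z : forall i : 'I_0, val (letterS h0) \in @cl_gr _ _ _ g 0 by case.
apply: etrans (etrans (E z) _); first by congr Q; apply/esym; apply: big_ord0.
exact: (@symV0 K Gam eps _ (fun i => env_in eps (@cl_gr _ _ _ g) (@bracket _ _ _ g) (letterS h0)) (fun=> 0)).
Qed.

Lemma sym_inl d x : x \in h -> x \in bihom d -> Q (inlz x) = inlb x.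
Proof.
move=> xh /andP[_ xc]; have E := hQ.2 1%N (fun=> letterS xh) (fun=> d.2) (fun=> xc).
apply: etrans (etrans E _).
  by rewrite big_ord1 -(inlE eps (@cl_gr _ _ _ g) (fun _ _ => 0) (letterS xh)).
apply: etrans; first exact: (@symV1 K Gam eps _ (fun i => env_in eps (@cl_gr _ _ _ g) (@bracket _ _ _ g) (letterS xh)) (fun=> d.2)).
by rewrite -(inlE eps (@cl_gr _ _ _ g) (@bracket _ _ _ g) (letterS xh)).
Qed.

Lemma sym_inl2 d d' x y : x \in h -> y \in h -> x \in bihom d -> y \in bihom d' ->
  Q (inlz x * inlz y) = 2^-1 *: (inlb x * inlb y + eps d.2 d'.2 *: (inlb y * inlb x)).
Proof.
move=> xh yh /andP[_ xc] /andP[_ yc].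
pose xs (i : 'I_2) := if i == ord0 then letterS xh else letterS yh.
pose ds (i : 'I_2) := if i == ord0 then d.2 else d'.2.
have z i : val (xs i) \in @cl_gr _ _ _ g (ds i) by rewrite /xs /ds; case: eqP.
apply: etrans (etrans (hQ.2 2%N xs ds z) _).
  congr Q; apply: etrans (esym (prod2 _)); rewrite /xs /=.
  rewrite -(inlE eps (@cl_gr _ _ _ g) (fun _ _ => 0) (letterS xh)).
  by rewrite -(inlE eps (@cl_gr _ _ _ g) (fun _ _ => 0) (letterS yh)).
apply: etrans; first exact: (@symV2 K Gam eps _ (fun i => env_in eps (@cl_gr _ _ _ g) (@bracket _ _ _ g) (xs i)) ds).
rewrite /xs /ds /=.
rewrite -(inlE eps (@cl_gr _ _ _ g) (@bracket _ _ _ g) (letterS xh)).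
by rewrite -(inlE eps (@cl_gr _ _ _ g) (@bracket _ _ _ g) (letterS yh)).
Qed.
End SymmetrizationValues.

Section CasimirTerms.
Context (K : fieldType) (charK : forall n, n.+1%:R != 0 :> K).
Context (Gam : zmodType) (eps : Gam -> Gam -> K).
Hypothesis heps : commutation_factor eps.
Context (g : zqColorLie eps).
Context (A : choiceType) (e e' : A -> g) (dg : A -> int * Gam).
Hypotheses (he : is_homogeneous_basis e dg) (he' : is_dual_basis e e').
Local Notation eb := (e_bihom he).
Local Notation dbi := (dual_bihom he he').
Local Notation ep a := (eps (dg a).2 (dg a).2).
Local Notation Am := (degree_basis dg).
Local Notation brk := (@bracket _ _ _ g).
Local Notation brz := (fun _ _ : g => 0 : g).
Local Notation brz_color := (@br0_color _ _ _ g : color_bracket eps (@cl_gr _ _ _ g) brz).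
Local Notation brz_zq := (@br0_zq _ _ _ g : forall i j x y, x \in @zq_gr _ _ _ g i ->
  y \in @zq_gr _ _ _ g j -> brz x y \in @zq_gr _ _ _ g (i + j)).
Local Notation inl br := (inl eps (@cl_gr _ _ _ g) br).
Local Notation gn := (@gneg _ _ _ g).
Local Notation gp := (@gpos _ _ _ g).
Local Notation ga := (@gall _ _ _ g).

(** The normally ordered tensor of e^a e_a: the letter of positive degree goes to the right, with
    the factor eps(e^a, e_a) if the letters are exchanged. In degree 0 both letters belong to g_-,
    and the factor in F(g_+) is 1. *)
Definition symbol_part (br : g -> g -> g) a : normal br :=
  if 0 < (dg a).1 then tens (inl br gn (e' a)) (inl br gp (e a))
  else if (dg a).1 < 0 then ep a *: tens (inl br gn (e a)) (inl br gp (e' a))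
  else tens (inl br gn (e' a) * inl br gn (e a)) 1.

Lemma normT_gr br a : symbol_part br a \in normal_gr (br := br) (0, `|(dg a).1|%N).
Proof.
rewrite /symbol_part; case: (ltrgt0P (dg a).1) => a0.
- have := tens_gr br _ a0 (dbi a) (eb a); rewrite addNr; apply.
  by rewrite /= oppr_le0 ltW.
- have := tens_gr br (ltW a0) _ (eb a) (dbi a); rewrite subrr /= oppr_gt0 abszN => h.
  by apply: rpredZ; apply: h.
- have := tens_gr1 br _ a0 (dbi a) (eb a); rewrite addNr a0; apply.
  by rewrite /= a0 oppr0.
Qed.

Lemma inl_swapz x y c d : x \in @cl_gr _ _ _ g c -> y \in @cl_gr _ _ _ g d ->
  inl brz ga x * inl brz ga y = eps c d *: (inl brz ga y * inl brz ga x).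
Proof.
move=> xc yd.
have h0 : inl brz ga 0 = 0 by apply: inl0; exact: all_sub.
apply: (addr_eq0_r _ h0); apply: (@inl_br _ _ eps _ _ brz ga _ c d x y) => //.
Qed.

Local Notation El x := (env_in eps (@cl_gr _ _ _ g) brz (full_letter x)).

(** The equality is exact because the letters color-commute in the symmetric algebra; in the
    enveloping algebra an exchange would leave a bracket. *)
Lemma symbol_term a : El (e' a) * El (e a) = normal_mul (symbol_part brz a).
Proof.
rewrite -!(inlE eps (@cl_gr _ _ _ g) brz (full_letter _)) /=.
have /andP[_ ac] := dbi a; have sw := inl_swapz ac (e_cl he a).
rewrite /symbol_part; case: (ltrgt0P (dg a).1) => a0.
- apply/esym/nm_tens; last exact: (bihom_gpos a0 (eb a)).
  by apply: (bihom_gneg _ (dbi a)); rewrite /= oppr_le0 ltW.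
- apply: etrans sw _; rewrite (linZ (normal_mulP brz).1).
  rewrite /= (epsNl heps) (epV heps); congr (_ *: _); apply/esym/nm_tens.
    exact: (bihom_gneg (ltW a0) (eb a)).
  by apply: (bihom_gpos _ (dbi a)); rewrite /= oppr_gt0.
- apply/esym/nm_tens1; last by apply: (bihom_gneg _ (eb a)); rewrite a0.
  by apply: (bihom_gneg _ (dbi a)); rewrite /= a0 oppr0.
Qed.

Local Notation cmpz := (@bidegree_part _ _ _ _ brz).

(** In nonzero degree exactly one of e_a and e^a lies in g_+, and its degree is |deg a|; thus
    degrees r and -r feed the same component. *)
Lemma symbol_cmp a d r : series_of (El (e' a) * El (e a)) d r =
  if (d, r) == (0, `|(dg a).1|%N) then symbol_part brz a else 0.
Proof.
have E : series_of (El (e' a) * El (e a)) d r = cmpz (d, r) (normal_mul (symbol_part brz a)).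
  by rewrite -symbol_term.
by rewrite E (cmp_nm charK heps he he' brz_color brz_zq _ (normT_gr brz a)).
Qed.

Lemma symbol_deg d : d != 0 -> casimir_symbol e e' d = 0.
Proof.
move=> d0; apply: funext => r; rewrite /casimir_symbol fsbig1 // => a _.
by rewrite symbol_cmp xpair_eqE (negPf d0).
Qed.

Lemma symbol0 : casimir_symbol e e' 0 0%N = \sum_(a <- Am 0) symbol_part brz a.
Proof.
rewrite /casimir_symbol (fsum_fset (E := Am 0)) => [|a].
  by apply: eq_big_seq => a; rewrite (in_Am he he') symbol_cmp => /eqP ->; rewrite eqxx.
rewrite symbol_cmp (in_Am he he'); case: ifP => [/eqP[a0] _|_]; last by rewrite eqxx.
by rewrite -absz_eq0 -a0.
Qed.

Lemma symbolS r : (0 < r)%N -> casimir_symbol e e' 0 r =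
  \sum_(a <- Am r%:Z) symbol_part brz a + \sum_(a <- Am (- r%:Z)) symbol_part brz a.
Proof.
move=> r0; rewrite /casimir_symbol (fsum_fset (E := (Am r%:Z `|` Am (- r%:Z))%fset)) => [|a].
  rewrite -big_cat; apply: etrans (perm_big _ _) _; last first.
    apply: eq_big_seq => a; rewrite mem_cat !(in_Am he he') symbol_cmp => ar.
    by rewrite ifT //; apply/eqP; congr (_, _); lia.
  apply: uniq_perm; first exact: fset_uniq.
    rewrite cat_uniq !fset_uniq /= andbT; apply/hasPn => a.
    by rewrite !(in_Am he he') => /eqP ->; lia.
  by move=> a; rewrite mem_cat; exact: in_fsetU.
rewrite symbol_cmp in_fsetU !(in_Am he he'); case: ifP => [/eqP[ar] _|_]; last by rewrite eqxx.
by lia.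
Qed.

Local Notation Theta := (tensor_lift (fun u v =>
  tens (@symmetrization _ _ _ g gn u) (@symmetrization _ _ _ g gp v) : normal brk)).

(** In nonzero degree each tensor factor is a single letter, which the symmetrization fixes. In
    degree 0 both letters lie in the left factor and are averaged over their two orders. *)
Definition casimir_normal_part a : normal brk :=
  if (dg a).1 == 0 then
    2^-1 *: (tens (inl brk gn (e' a) * inl brk gn (e a)) 1 +
             ep a *: tens (inl brk gn (e a) * inl brk gn (e' a)) 1)
  else symbol_part brk a.

Let symn := symmetrizationP charK heps he he' (@neg_sub _ _ _ g) (@neg_span _ _ _ _ _ _ _ _ he he').
Let symp := symmetrizationP charK heps he he' (@pos_sub _ _ _ g) (@pos_span _ _ _ _ _ _ _ _ he he').

Lemma Theta_linear : linear Theta /\ forall u v, Theta (tens u v) =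
  tens (@symmetrization _ _ _ g gn u) (@symmetrization _ _ _ g gp v).
Proof.
apply: tensor_liftP => [v c u u'|u c v v'].
  by rewrite symn.1; apply: tens_linl.
by rewrite symp.1; apply: tens_linr.
Qed.

Lemma Theta_normT a : Theta (symbol_part brz a) = casimir_normal_part a.
Proof.
have [Tl Tt] := Theta_linear; rewrite /casimir_normal_part /symbol_part; case: (ltrgt0P (dg a).1) => a0.
- rewrite Tt (sym_inl symn _ (dbi a)) ?(sym_inl symp _ (eb a)) //.
    exact: (bihom_gpos a0 (eb a)).
  by apply: (bihom_gneg _ (dbi a)); rewrite /= oppr_le0 ltW.
- rewrite (linZ Tl) Tt (sym_inl symn _ (eb a)) ?(sym_inl symp _ (dbi a)) //.
    by apply: (bihom_gpos _ (dbi a)); rewrite /= oppr_gt0.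
  exact: (bihom_gneg (ltW a0) (eb a)).
- have en : e a \in gn by apply: (bihom_gneg _ (eb a)); rewrite a0.
  have dn : e' a \in gn by apply: (bihom_gneg _ (dbi a)); rewrite /= a0 oppr0.
  rewrite Tt (sym_inl2 symn dn en (dbi a) (eb a)).
  have p0 : 0 \in gp by rewrite rpred0.
  rewrite (sym_one symp p0).
  have tl : linear (fun u => tens u 1 : normal brk) by exact: tens_linl.
  rewrite (linZ tl) (linD tl) (linZ tl) /= (epsNl heps) (epV heps).
  by [].
Qed.

Lemma symT_gr a : casimir_normal_part a \in normal_gr (br := brk) (0, `|(dg a).1|%N).
Proof.
rewrite /casimir_normal_part; case: eqP => [a0|_]; last exact: normT_gr.
rewrite a0; have d0 : (- dg a).1 = 0 by rewrite /= a0 oppr0.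
have h1 := tens_gr1 brk d0 a0 (dbi a) (eb a); rewrite addNr in h1.
have h2 := tens_gr1 brk a0 d0 (eb a) (dbi a); rewrite subrr in h2.
by apply: rpredZ; apply: rpredD; [exact: h1|apply: rpredZ; exact: h2].
Qed.

Local Notation nmb := (@normal_mul _ _ _ _ brk).

Lemma nm_symT a : nmb (casimir_normal_part a) =
  if 0 < (dg a).1 then Ein (e' a) * Ein (e a)
  else if (dg a).1 < 0 then ep a *: (Ein (e a) * Ein (e' a))
  else 2^-1 *: (Ein (e' a) * Ein (e a) + ep a *: (Ein (e a) * Ein (e' a))).
Proof.
have nl := (normal_mulP brk).1.
rewrite !(Ein_inl (e a)) !(Ein_inl (e' a)) /casimir_normal_part /symbol_part; case: (ltrgt0P (dg a).1) => a0.
- apply: nm_tens; last exact: (bihom_gpos a0 (eb a)).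
  by apply: (bihom_gneg _ (dbi a)); rewrite /= oppr_le0 ltW.
- rewrite (linZ nl); congr (_ *: _); apply: nm_tens.
    exact: (bihom_gneg (ltW a0) (eb a)).
  by apply: (bihom_gpos _ (dbi a)); rewrite /= oppr_gt0.
- have en : e a \in gn by apply: (bihom_gneg _ (eb a)); rewrite a0.
  have dn : e' a \in gn by apply: (bihom_gneg _ (dbi a)); rewrite /= a0 oppr0.
  rewrite (linZ nl) (linD nl) (linZ nl); congr (_ *: (_ + _ *: _)); exact: nm_tens1.
Qed.

Lemma casimir_deg d : d != 0 -> casimir e e' d = 0.
Proof.
move=> d0; apply: funext => r; rewrite /casimir /series_symmetrization symbol_deg //.
exact: (lin0 Theta_linear.1).
Qed.

Lemma casimir_gr d r : casimir e e' d r \in normal_gr (br := brk) (d, r).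
Proof.
have [->|/casimir_deg ->] := eqVneq d 0; last by rewrite rpred0.
rewrite /casimir /series_symmetrization; case: r => [|r].
  rewrite symbol0 (lin_sum Theta_linear.1) big_seq; apply: rpred_sum => a.
  by rewrite (in_Am he he') Theta_normT => /eqP a0; have := symT_gr a; rewrite a0.
rewrite symbolS // (linD Theta_linear.1) !(lin_sum Theta_linear.1).
apply: rpredD; rewrite big_seq; apply: rpred_sum => a;
  rewrite (in_Am he he') Theta_normT => /eqP a0; have := symT_gr a; by rewrite a0 ?abszN.
Qed.

Local Notation cas := (casimir_part e e' dg).

Lemma casimir_nm0 : nmb (casimir e e' 0 0%N) = cas 0.
Proof.
rewrite /casimir /series_symmetrization symbol0 (lin_sum Theta_linear.1).
rewrite (lin_sum (normal_mulP brk).1).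
(* One copy keeps its order and the other is reordered by [cas_swap]; together they match the
   averaged pairs. *)
have E : cas 0 = 2^-1 *: (cas 0 + cas 0).
  by rewrite -mulr2n -scaler_nat scalerA mulVf ?scale1r //; apply: (charK 1).
rewrite E {2}(cas_swap heps he he') oppr0 /casimir_part -big_split scaler_sumr /=.
apply: eq_big_seq => a; rewrite (in_Am he he') => /eqP a0.
by rewrite Theta_normT nm_symT a0 ltxx.
Qed.

Lemma casimir_nmS r : (0 < r)%N -> nmb (casimir e e' 0 r) = cas r%:Z *+ 2.
Proof.
move=> r0; rewrite /casimir /series_symmetrization symbolS //.
rewrite (linD Theta_linear.1) (linD (normal_mulP brk).1) !(lin_sum Theta_linear.1).
rewrite !(lin_sum (normal_mulP brk).1) mulr2n.
rewrite {2}(cas_swap heps he he'); congr (_ + _); apply: eq_big_seq => a;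
  rewrite (in_Am he he') => /eqP a0; rewrite Theta_normT nm_symT a0.
  by rewrite ltz_nat r0.
by rewrite ifF ?ifT //; lia.
Qed.
End CasimirTerms.

(** * Centrality *)

(** The Leibniz rule, for ordinary commutators because the partial sums of Omega have degree 0. *)
Lemma commutator_mulr (B : pzRingType) (P x u : B) :
  P * (x * u) - x * u * P = (P * x - x * P) * u + x * (P * u - u * P).
Proof.
by rewrite mulrBl mulrBr !mulrA addrA subrK.
Qed.

Lemma commutator_add (K : fieldType) (B : lalgType K) (c : K) (x p q v w : B) :
  (forall (c : K) (x y : B), c *: (x * y) = x * (c *: y)) ->
  x * q - q * x = w ->
  x * (p + c *: q) - (p + c *: q) * x - (v + c *: w) = x * p - p * x - v.
Proof.
move=> sAr <-; rewrite mulrDr mulrDl -sAr -scalerAl scalerBr.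
by rewrite opprD addrACA [v + _]addrC addrKA.
Qed.

Lemma commutator_lin (K : fieldType) (B : lalgType K) (P x y : B) (c : K) :
  (forall (c : K) (x y : B), c *: (x * y) = x * (c *: y)) ->
  P * (c *: x + y) - (c *: x + y) * P = c *: (P * x - x * P) + (P * y - y * P).
Proof.
by move=> sAr; rewrite mulrDr mulrDl -sAr -scalerAl opprD addrACA scalerBr.
Qed.

Lemma sum_head (W : zmodType) (F G : nat -> W) c N :
  F 0 = c -> (forall r, (0 < r)%N -> F r = G r *+ 2) ->
  \sum_(0 <= r < N.+1) F r = c + (\sum_(1 <= r < N.+1) G r) *+ 2.
Proof.
move=> F0 FG; rewrite big_ltn // F0 -sumrMnl; congr (_ + _).
by apply: eq_big_nat => r /andP[/FG].
Qed.

Lemma sum_lin (K : pzRingType) (W : lmodType K) (F G H : nat -> W) c m n :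
  (forall r, F r = G r + c *: H r) ->
  \sum_(m <= r < n) F r = \sum_(m <= r < n) G r + c *: \sum_(m <= r < n) H r.
Proof. by move=> h; rewrite scaler_sumr -big_split; apply: eq_bigr. Qed.

Lemma opp_sub_eq0 (W : zmodType) (p q : W) : - p = 0 -> p - q = 0 -> q = 0.
Proof. by move=> /eqP; rewrite oppr_eq0 => /eqP -> /eqP; rewrite sub0r oppr_eq0 => /eqP. Qed.

Section MainTheorem.
Context (K : fieldType) (charK : forall n, n.+1%:R != 0 :> K).
Context (Gam : zmodType) (eps : Gam -> Gam -> K).
Hypothesis heps : commutation_factor eps.
Context (g : zqColorLie eps).
Context (A : choiceType) (e e' : A -> g) (dg : A -> int * Gam).
Hypotheses (he : is_homogeneous_basis e dg) (he' : is_dual_basis e e').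
Context (rho : {scalar g}) (hrho : in_restricted_dual 0 rho).

Local Notation eb := (e_bihom he).
Local Notation brk := (@bracket _ _ _ g).
Local Notation U := (env eps (@cl_gr _ _ _ g) brk (@gall _ _ _ g)).
Local Notation bzq := (@zq_bracket _ _ _ g).
Local Notation bco := (bracket_color g).
Local Notation JJ := (@Jfil _ _ _ _ _ _ _ _ he he' brk).
Local Notation nmb := (@normal_mul _ _ _ _ brk).
Local Notation ngr := (@normal_gr _ _ _ _ brk).
Local Notation cmp := (@bidegree_part _ _ _ _ brk).
Local Notation wx := (central_defect e e' dg rho).

Let z : series brk := casimir e e' + 2 *: series_in brk (sharp rho).
Let shP := sharpP heps he he' hrho.

Lemma zE d r : z d r = casimir e e' d r + 2 *: cmp (d, r) (Ein (sharp rho)).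
Proof. by []. Qed.

Lemma z_gr d r : z d r \in ngr (d, r).
Proof.
rewrite zE; apply: rpredD; first exact: (casimir_gr charK heps he he' d r).
by apply: rpredZ; exact: (cmp_in charK heps he he' bco bzq).
Qed.

Lemma z_deg d : d != 0 -> z d = 0.
Proof.
move=> d0; apply: funext => r; rewrite zE (casimir_deg charK heps he he' d0).
rewrite (cmp_homog charK heps bco bzq r (Ein_homog charK heps (he := he) (he' := he') shP.1)) ?scaler0 ?addr0 //.
by rewrite eq_sym.
Qed.

(** Beyond R the partial sums contain the whole normal form of the sharp element. *)
Lemma partial_z : exists R, forall N, (R <= N)%N ->
  partial z 0 N = csum e e' dg N + 2 *: Ein (sharp rho).
Proof.
have hs := Ein_homog charK heps (he := he) (he' := he') shP.1.
have [R hR] := cmp_sum charK heps bco bzq hs; exists R => N RN.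
have nl := (normal_mulP brk).1.
have E : \sum_(0 <= r < N.+1) nmb (casimir e e' 0 r) = csum e e' dg N.
  apply: sum_head (casimir_nm0 charK heps he he') _ => r r0.
  exact: (casimir_nmS charK heps he he' r0).
rewrite (hR N RN) -E; apply: sum_lin => r.
by rewrite zE (linD nl) (linZ nl).
Qed.

Lemma comm_partial : exists R, forall x d N, (R <= N)%N -> x \in bihom d ->
  JJ (N%:Z + 1 - `|d.1|) (Ein x * partial z 0 N - partial z 0 N * Ein x - Ein (wx x d.1)).
Proof.
have [R hR] := partial_z; exists R => x d N RN xd; rewrite (hR N RN).
have sw : Ein x * Ein (sharp rho) - Ein (sharp rho) * Ein x = Ein (bracket x (sharp rho)).
  have := Ein_br xd shP.1; rewrite (eps0r heps) scale1r; exact: swap_sum.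
rewrite /central_defect (linD (@Ein_linear _ _ _ g)) (linZ (@Ein_linear _ _ _ g)).
rewrite (commutator_add _ _ _ (@env_scalerAr _ _ _ _ _ _ _) sw).
exact: comm_csum.
Qed.

Lemma Jfil_opp t (a b : U) : JJ t (a - b) -> JJ t (b - a).
Proof. by move/(JfilN charK heps bco); rewrite opprB. Qed.

Local Notation AC := (asym_central he he' z).

(** Linearity reduces asymptotic centrality to words in the basis, and the Leibniz rule treats these
    letter by letter. *)
Lemma central_of_wx : (forall a, wx (e a) (dg a).1 = 0) -> in_center z.
Proof.
move=> w0; apply: (central_suff charK heps (he := he) (he' := he') bco bzq z_gr z_deg) => u.
apply: (u_expand charK heps (he := he) (he' := he') bco (u := u) (Q := AC)).
- by move=> t; exists 0%N => N _; rewrite mulr0 mul0r subrr; apply: (Jfil0 charK heps bco).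
- move=> c x y hx hy t; have [N1 h1] := hx t; have [N2 h2] := hy t.
  exists (N1 + N2)%N => N NN; have k1 := h1 N (leq_trans (leq_addr _ _) NN).
  have k2 := h2 N (leq_trans (leq_addl _ _) NN).
  rewrite (commutator_lin _ _ _ _ (@env_scalerAr _ _ _ _ _ _ _)).
  exact: (JfilP charK heps bco k1 k2).
move=> w _; rewrite ofFA_word; elim: w => [|a w IH].
  move=> t; exists 0%N => N _; rewrite big_nil mulr1 mul1r subrr.
  exact: (Jfil0 charK heps bco).
have hw := homog_word charK heps (he := he) (he' := he') bco bzq (w := w).
rewrite ofFA_word in hw; rewrite big_cons -Ein_inl.
move: (\prod_(b <- w) _) IH hw => v IH hv t.
have [R hR] := comm_partial; have [N1 h1] := IH t.
(* Multiplying the commutator with e_a on the right by the rest of the word costs its degree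
   [(wdeg dg w).1], and the estimate for e_a itself costs |deg a|. *)
exists (R + N1 + `|t - (wdeg dg w).1|%N + `|(dg a).1|%N)%N => N NN; rewrite commutator_mulr.
apply: (JfilD charK heps bco); last first.
  by apply: (Jfil_left charK heps bco bzq); apply: h1; lia.
rewrite -[t](subrK (wdeg dg w).1); apply: (Jfil_right charK heps bco bzq _ hv).
apply: Jfil_opp.
have := hR (e a) (dg a) N _ (eb a); rewrite w0 (lin0 (@Ein_linear _ _ _ g)) subr0 => h.
by apply: (JfilW (M := N%:Z + 1 - `|(dg a).1|)); [lia|apply: h; lia].
Qed.

(** The commutator of e_a with a long partial sum equals the image of [central_defect] up to deep
    terms, while centrality kills each of its components. Hence all components of that image vanish;
    separation of the filtration and injectivity of g into U(g) finish the argument. *)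
Lemma wx_of_central : in_center z -> forall a, wx (e a) (dg a).1 = 0.
Proof.
move=> zc a; apply: (Ein_inj charK heps he he').
have wb := wx_bihom heps he he' hrho (eb a).
have hom := Ein_homog charK heps (he := he) (he' := he') wb.
apply: (Jfil_sep charK heps (he := he) (he' := he') bco) => M.
apply: (Jfil_cmp charK heps bco bzq) => d t _.
have [<-|dd] := eqVneq (dg a) d; last exact: (cmp_homog charK heps bco bzq t hom dd).
have [R hR] := comm_partial.
have he1 := Ein_homog charK heps (he := he) (he' := he') (eb a).
have [N1 h1] := central_nec charK heps (he := he) (he' := he') bco bzq z_gr z_deg zc he1 t.
pose N := (R + N1 + t + `|(dg a).1|)%N.
have J := hR (e a) (dg a) N _ (eb a).
have c0 := h1 N _; rewrite -opprB in c0.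
have cl := cmp_linear charK heps he he' bco bzq (dg a, t).
have E := cmp_Jfil charK heps bco bzq (dg a) (t := t) (J _) _.
rewrite (linB cl) in E; rewrite (linN cl) in c0.
by apply: (opp_sub_eq0 (c0 _) (E _ _)); rewrite /N; lia.
Qed.

Theorem casimir_central :
  in_center (casimir e e' + 2 *: series_in brk (sharp rho)) <->
  psiKP e e' dg =2 coboundary rho.
Proof.
apply: iff_trans (iff_sym (psi_coboundary charK heps he he' hrho)).
by split; [apply: wx_of_central|apply: central_of_wx].
Qed.
End MainTheorem.

Theorem corollary43 (R : realType) (Gam : zmodType)
    (eps : Gam -> Gam -> R[i]) (heps : commutation_factor eps)
    (g : zqColorLie eps)
    (A : choiceType) (e e' : A -> g) (dg : A -> int * Gam)
    (he : is_homogeneous_basis e dg) (he' : is_dual_basis e e')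
    (rho : {scalar g}) (hrho : in_restricted_dual 0 rho) :
  in_center (casimir e e' + 2 *: series_in (@bracket _ _ _ g) (sharp rho)) <->
  psiKP e e' dg =2 coboundary rho.
Proof.
by apply: casimir_central => // n; rewrite pnatr_eq0.
Qed.
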